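(* Let $n$ be odd and $W=M_n(\mathbb C)$. The polynomial $P_\Lambda$ belongs to the orbit closure of the determinant, i.e. $[P_\Lambda]\in\overline{GL(W)\cdot[\det_n]}$. Moreover, $\overline{GL(W)\cdot [P_\Lambda]}$ is an irreducible component of the boundary of $\overline{GL(W)\cdot[\det_n]}$, of codimension one in $\overline{GL(W)\cdot[\det_n]}$, and it is not contained in $\mathrm{End}(W)\cdot[\det_n]$. In particular, for $m$ odd, writing $P_{\Lambda,m}$ for the polynomial $P_\Lambda$ on $M_m(\mathbb C)$, $$\overline{dc}(P_{\Lambda,m})=m<dc(P_{\Lambda,m}).$$
   Context: $M_n(\mathbb C)$ is the space of complex $n\times n$ matrices, $S^n(M_n(\mathbb C))^*$ the space of homogeneous polynomials of degree $n$ on it, $\det_n$ the determinant. An endomorphism $u\in\mathrm{End}(W)$ acts by $(u\cdot\det_n)(M)=\det_n(u(M))$; $\mathrm{End}(W)\cdot[\det_n]$ is the set of classes of the nonzero such polynomials. Closures are Zariski closures in $\mathbb P(S^nW^* )$, and the boundary of $\overline{GL(W)\cdot[\det_n]}$ is $\overline{GL(W)\cdot[\det_n]}\setminus GL(W)\cdot[\det_n]$. $P_\Lambda\in S^n(M_n(\mathbb C))^*$ is defined by decomposing a matrix $M=A+S$ into its skew-symmetric part $A$ and symmetric part $S$ and setting $P_\Lambda(M)=\det_n(A,\ldots,A,S)$, where $\det_n(\cdot,\ldots,\cdot)$ is the complete polarization (symmetric multilinear form with $\det_n(M,\ldots,M)=\det_n(M)$) of the determinant and $A$ appears $n-1$ times.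 For a homogeneous polynomial $P$ of degree $m$ in $M$ variables, $dc(P)$ (resp. $\overline{dc}(P)$) is the smallest $n\ge m$ such that $\ell^{n-m}P\in\mathrm{End}(M_n(\mathbb C))\cdot\det_n$ (resp. $[\ell^{n-m}P]\in\overline{GL_{n^2}\cdot[\det_n]}$). Here $\ell$ is a linear coordinate on $\mathbb C$ and $\ell^{n-m}P$ is viewed as a degree $n$ form on $M_n(\mathbb C)$ via a linear inclusion $\mathbb C\oplus\mathbb C^M\subset M_n(\mathbb C)$, i.e. by taking $\ell$ and the variables of $P$ to be linearly independent linear forms on $M_n(\mathbb C)$ (if $n=m$, $\ell$ does not occur and only an inclusion $\mathbb C^M\subset M_n(\mathbb C)$ is needed).
   Formalization: The claims on the irreducible component of the boundary, codimension one, non-containment in End(W)·[det_n] and m < dc are stated for odd n, m > 1 only; for n = 1 they fail, since P_Λ = det_1, the boundary is empty and dc = 1. *)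

(* Defs.v *)
(* The definitions are over an arbitrary field K; C is the case K = R[i] with
   R : realType. *)
From HB Require Import structures.
From mathcomp Require Import all_boot all_order all_algebra all_fingroup.
From mathcomp Require Import reals complex mpoly.

Set Implicit Arguments.
Unset Strict Implicit.
Unset Printing Implicit Defensive.

Import GRing.Theory.
Local Open Scope ring_scope.

(* The base ring is an arbitrary comUnitRingType so that the same formulas apply
   to scalar matrices and to the generic matrix over {mpoly K[n * n]}. *)
Section Polarization.
Variables (R : comUnitRingType) (n : nat).

(* The complete polarization of det_n: expanding \det (\sum_k t_k M_k) by
   multilinearity in the rows, the coefficient of \prod_k t_k is the sum below,
   which is n! times det_n (M_0, ..., M_(n-1)). *)
Definition polar_det (M : 'I_n -> 'M[R]_n) : R :=
  (n`!%:R)^-1 * \sum_(s : 'S_n) \det (\matrix_(i, j) M (s i) i j).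

Definition skew_part (M : 'M[R]_n) : 'M[R]_n := 2^-1 *: (M - M^T).
Definition sym_part (M : 'M[R]_n) : 'M[R]_n := 2^-1 *: (M + M^T).

Definition PLambda_at (M : 'M[R]_n) : R :=
  polar_det (fun k : 'I_n => if (k < n.-1)%N then skew_part M else sym_part M).

Lemma polar_det_diag (M : 'M[R]_n) :
  (n`!%:R : R) \is a GRing.unit -> polar_det (fun _ => M) = \det M.
Proof.
move=> u; rewrite /polar_det (eq_bigr (fun _ => \det M)); last first.
  by move=> s _; congr (\det _); apply/matrixP => i j; rewrite mxE.
by rewrite sumr_const card_Sn -[\det M *+ _]mulr_natl mulKr.
Qed.

Lemma polar_det_sym (M : 'I_n -> 'M[R]_n) (t : 'S_n) :
  polar_det (fun k => M (t k)) = polar_det M.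
Proof.
rewrite /polar_det; congr (_ * _).
rewrite [RHS](reindex_inj (mulIg t)) /=; apply: eq_bigr => s _.
by congr (\det _); apply/matrixP => i j; rewrite !mxE permM.
Qed.

Lemma polar_det_linear (k : 'I_n) (b c : R) (M N L : 'I_n -> 'M[R]_n) :
  M k = b *: N k + c *: L k ->
  (forall l, l != k -> M l = N l /\ M l = L l) ->
  polar_det M = b * polar_det N + c * polar_det L.
Proof.
move=> Mk Ml; rewrite /polar_det !mulrA ![_ * (n`!%:R)^-1]mulrC -!mulrA -mulrDr.
rewrite !mulr_sumr -big_split /= !mulr_sumr; apply: eq_bigr => s _.
congr (_ * _).
have neq i : s (lift ((s^-1)%g k) i) != k.
  by apply/eqP => /(canRL (permK s)) h; move: (neq_lift ((s^-1)%g k) i); rewrite h eqxx.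
apply: (determinant_multilinear (i0 := (s^-1)%g k)).
- by apply/rowP => j; rewrite !mxE permKV Mk !mxE.
- by apply/matrixP => i j; rewrite !mxE; case: (Ml _ (neq i)) => <-.
- by apply/matrixP => i j; rewrite !mxE; case: (Ml _ (neq i)) => _ <-.
Qed.

End Polarization.

Section Forms.
Variable K : fieldType.

Definition linform N (a : 'rV[K]_N) : {mpoly K[N]} := \sum_(k < N) a 0 k *: 'X_k.

(* Polynomials on 'M[K]_n are elements of {mpoly K[n * n]}, the variable of index
   mxvec_index i j being the (i, j) entry; so P takes the value P.@[mxvec M 0] at M. *)
Definition generic_mx n : 'M[{mpoly K[n * n]}]_n :=
  \matrix_(i, j) 'X_(mxvec_index i j).

Definition det_form n : {mpoly K[n * n]} := \det (generic_mx n).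
Definition PLambda n : {mpoly K[n * n]} := PLambda_at (generic_mx n).

(* The polynomial M |-> P (u M); see act_meval. *)
Definition act n (u : 'End('M[K]_n)) (P : {mpoly K[n * n]}) : {mpoly K[n * n]} :=
  P \mPo [tuple linform (col k (lin_mx u))^T | k < n * n].

Lemma linform_meval N (a : 'rV[K]_N) (v : 'I_N -> K) :
  (linform a).@[v] = \sum_(k < N) a 0 k * v k.
Proof.
by rewrite /linform raddf_sum /=; apply: eq_bigr => k _; rewrite mevalZ mevalXU.
Qed.

Lemma map_generic_mx n (M : 'M[K]_n) :
  map_mx (meval (mxvec M 0)) (generic_mx n) = M.
Proof. by apply/matrixP => i j; rewrite !mxE mevalXU mxvecE. Qed.

Lemma det_form_meval n (M : 'M[K]_n) : (det_form n).@[mxvec M 0] = \det M.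
Proof. by rewrite /det_form -det_map_mx map_generic_mx. Qed.

Lemma PLambda_meval n (M : 'M[K]_n) : [pchar K] =i pred0 ->
  (PLambda n).@[mxvec M 0] = PLambda_at M.
Proof.
move=> chK.
have unat k : (0 < k)%N -> (k%:R : {mpoly K[n * n]}) \is a GRing.unit.
  move=> k0; rewrite -(mpolyC_nat (n * n) K k).
  by apply: rmorph_unit; rewrite unitfE ((pcharf0P K).1 chK) -lt0n.
rewrite /PLambda /PLambda_at /polar_det rmorphM /= rmorphV ?unat ?fact_gt0 //.
rewrite rmorph_nat rmorph_sum; congr (_ * _); apply: eq_bigr => s _ /=.
rewrite -det_map_mx; congr (\det _); apply/matrixP => i j.
rewrite ![in LHS]mxE [in RHS]mxE.
by case: ifP => _; rewrite !mxE rmorphM /= rmorphV ?unat // rmorph_nat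
  ?(rmorphB, rmorphD) /= !mevalXU !mxvecE.
Qed.

Lemma act_meval n (u : 'End('M[K]_n)) (P : {mpoly K[n * n]}) (M : 'M[K]_n) :
  (act u P).@[mxvec M 0] = P.@[mxvec (u M) 0].
Proof.
rewrite /act comp_mpoly_meval; apply: meval_eq => k.
rewrite tnth_mktuple linform_meval -(mul_vec_lin u) mxE.
by apply: eq_bigr => j _; rewrite !mxE mulrC.
Qed.

End Forms.

(* The Zariski topology of P(S^d (K^N)^* ).  A point [p] is given by any of its
   representatives p, so a subset of the projective space is a predicate on
   {mpoly K[N]} that only holds at nonzero forms of degree d and is invariant
   under nonzero scalars. *)
Section ProjectiveZariski.
Variables (K : fieldType) (N d : nat).
Implicit Types X Y Z : {mpoly K[N]} -> Prop.

Definition proj_point (p : {mpoly K[N]}) : Prop := p != 0 /\ p \is d.-homog.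

(* The coefficients of p at all monomials of degree at most d; those of degree
   less than d vanish when p is homogeneous of degree d. *)
Definition coefs (p : {mpoly K[N]}) (i : 'I_#|{: 'X_{1..N < d.+1}}|) : K :=
  p@_(bmnm (enum_val i)).

Definition psub X Y : Prop := forall p, X p -> Y p.
Definition peq X Y : Prop := forall p, X p <-> Y p.

Definition zclosed X : Prop :=
  exists S : {mpoly K[#|{: 'X_{1..N < d.+1}}|]} -> Prop,
    (forall f, S f -> exists e : nat, f \is e.-homog) /\
    (forall p, X p <-> proj_point p /\ forall f, S f -> f.@[coefs p] = 0).

Definition zclosure X : {mpoly K[N]} -> Prop :=
  fun p => forall Y, zclosed Y -> psub X Y -> Y p.

Definition irreducible Z : Prop :=
  (exists p, Z p) /\
  forall Y1 Y2, zclosed Y1 -> zclosed Y2 ->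
    psub Z (fun p => Y1 p \/ Y2 p) -> psub Z Y1 \/ psub Z Y2.

Definition irreducible_component Z X : Prop :=
  [/\ irreducible Z, psub Z X
    & forall Z', irreducible Z' -> psub Z Z' -> psub Z' X -> psub Z' Z].

Definition chain_above Z X (k : nat) : Prop :=
  exists C : nat -> {mpoly K[N]} -> Prop,
    [/\ peq (C 0%N) Z,
        forall i, (i <= k)%N -> [/\ zclosed (C i), irreducible (C i) & psub (C i) X]
      & forall i, (i < k)%N -> psub (C i) (C i.+1) /\ ~ psub (C i.+1) (C i)].

Definition has_codim Z X (k : nat) : Prop :=
  chain_above Z X k /\ forall j, chain_above Z X j -> (j <= k)%N.

End ProjectiveZariski.

Section Orbits.
Variables (K : fieldType) (n : nat).

Definition pclass (P : {mpoly K[n * n]}) : {mpoly K[n * n]} -> Prop :=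
  fun Q => P != 0 /\ exists2 c : K, c != 0 & Q = c *: P.

Definition GL_orbit (P : {mpoly K[n * n]}) : {mpoly K[n * n]} -> Prop :=
  fun Q => exists2 g : 'End('M[K]_n), lker g = 0%VS & pclass (act g P) Q.

Definition End_orbit (P : {mpoly K[n * n]}) : {mpoly K[n * n]} -> Prop :=
  fun Q => exists u : 'End('M[K]_n), pclass (act u P) Q.

(* The closure is taken among the forms of degree n. *)
Definition GL_closure (P : {mpoly K[n * n]}) : {mpoly K[n * n]} -> Prop :=
  zclosure n (GL_orbit P).

Definition det_boundary : {mpoly K[n * n]} -> Prop :=
  fun Q => GL_closure (det_form K n) Q /\ ~ GL_orbit (det_form K n) Q.

End Orbits.

Section DeterminantalComplexity.
Variables (K : fieldType) (M m : nat) (P : {mpoly K[M]}).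

(* P is meant to be homogeneous of degree m. Q is l^(n - m) P for some choice of linearly independent linear forms l, y_i
   on 'M[K]_n; when n = m the form l plays no role and is unconstrained. *)
Definition padding n (Q : {mpoly K[n * n]}) : Prop :=
  exists (l : 'rV[K]_(n * n)) (y : 'I_M -> 'rV[K]_(n * n)),
    free (if n == m then codom y else l :: codom y) /\
    Q = linform l ^+ (n - m) * (P \mPo [tuple linform (y i) | i < M]).

Definition least (A : nat -> Prop) (k : nat) : Prop :=
  A k /\ forall j, A j -> (k <= j)%N.

Definition is_dc (k : nat) : Prop :=
  least (fun n => (m <= n)%N /\ exists2 Q : {mpoly K[n * n]},
    padding Q & exists u : 'End('M[K]_n), Q = act u (det_form K n)) k.

Definition is_dcbar (k : nat) : Prop :=
  least (fun n => (m <= n)%N /\ exists2 Q : {mpoly K[n * n]},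
    padding Q & GL_closure (det_form K n) Q) k.

End DeterminantalComplexity.

(* Main.v *)
(* Write M = A + S with A skew and S symmetric; then n P_Lambda(M) = tr(adj(A) S).
   Since a skew matrix of odd size is singular, det(A + t S) = t (n P_Lambda(M) + O(t)),
   so P_Lambda is a limit of points of the orbit of det_n.  It is not of the form
   c det(u(M)): such a u would be injective, because no variable of P_Lambda is
   redundant, and would map the n(n+1)/2-dimensional space of symmetric matrices into
   matrices of rank at most 1.  Hence the closure Z of the orbit of P_Lambda avoids the
   orbit of det_n, which is open in its closure X.

   Codimension one is a dimension count.  Put r = n^4 - (2n^2 - 1).  Modulo
   M |-> U M V with det(U) det(V) = 1, a generic linear map lies in a normal form with
   r + 1 parameters, so any r + 2 polynomials in the coefficients of a form are
   dependent on X.  On the other hand the Lie algebra annihilator of P_Lambda is cut down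
   to 0 by 2n^2 - 1 linear conditions, so the tangent space of the orbit of P_Lambda has
   dimension at least r and at least r linear forms in the coefficients are independent
   on Z.  Since a proper irreducible closed subset loses one dimension, no chain
   Z < C1 < C2 of irreducible closed sets fits into X. *)

From HB Require Import structures.
From mathcomp Require Import all_boot all_order all_algebra all_fingroup.
From mathcomp Require Import boolp reals complex mpoly zify ring.
Require Import Defs.

Set Implicit Arguments.
Unset Strict Implicit.
Unset Printing Implicit Defensive.

Import Order.TTheory GRing.Theory Num.Theory.
Local Open Scope ring_scope.

(** * Values and dependence of polynomials *)

(** Dimensions are measured on cones, by algebraic dependence of polynomials in the coefficients: r
    + 1 bounds the cone over X from above, r the cone over Z from below, and [cut_dependence] plays
    the part of the principal ideal theorem. The number 2n^2 - 1 arises in two ways. The maps M |->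
    U M V with det(U) det(V) = 1 form a family of dimension 2n^2 - 2; the normal form prescribes
    2n^2 - 1 entries and gives one scalar back. For P_Lambda, congruences and scalings give n^2
    infinitesimal symmetries and the maps A + S |-> L A - A L^T, with L modulo scalars, n^2 - 1
    more; the chosen linear conditions are transversal to both families. The main obstacle is that
    an orbit is open in its closure. A form in the closure is a homomorphism on the ring generated
    by the coefficients of the generic orbit point; extending it to the ring of all parameters
    produces the matrix that realizes the form. Maximality of Z in the boundary and codimension one
    rest on the same bound on chains: a larger irreducible part of the boundary has a closure
    strictly between Z and X. *)

Section Values.
Variable K : numFieldType.

Lemma poly_neq0_value (p : {poly K}) : p != 0 -> exists x, p.[x] != 0.
Proof.
move=> p0; pose s := [seq (i%:R : K) | i <- iota 0 (size p)].
have us : uniq s by rewrite map_inj_uniq ?iota_uniq //; apply: mulrIn; exact: oner_neq0.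
have [/(max_poly_roots p0)/(_ us)|] := boolP (all (root p) s).
  by rewrite size_map size_iota ltnn.
by move=> /allPn[x _ rx]; exists x.
Qed.

(** [muni] reads [p] as a univariate polynomial in the last variable; through this identity a
    nonzero coefficient of [p] yields a nonzero coefficient of [muni p]. *)
Lemma mcoeff_muni N (p : {mpoly K[N.+1]}) (m : 'X_{1..N.+1}) :
  ((muni p)`_(m ord_max))@_[multinom m (widen_ord (leqnSn N) i) | i < N] = p@_m.
Proof.
rewrite muniE coef_sum raddf_sum /= (bigID (pred1 m)) /=.
rewrite [X in _ + X]big1 ?addr0; last first.
  move=> m' mm'; rewrite coefZ coefXn; case: eqP => [e|_]; last by rewrite mulr0 mcoeff0.
  rewrite mulr1 mcoeffZ mcoeffX; case: eqP => [/mnmP e'|_]; last by rewrite mulr0.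
  case/eqP: mm'; apply/mnmP => i.
  have [->|/eqP ni] := eqVneq i ord_max; first by rewrite e.
  have li : (i < N)%N by rewrite ltn_neqAle -ltnS ltn_ord andbT; apply/eqP => ei; apply: ni; apply: val_inj.
  have := e' (Ordinal li); rewrite !mnmE.
  by have -> : widen_ord (leqnSn N) (Ordinal li) = i by apply: val_inj.
have [mp|mp] := boolP (m \in msupp p); last first.
  rewrite big1_seq ?(memN_msupp_eq0 mp) // => m' /andP[/eqP -> ]; by rewrite (negPf mp).
rewrite -big_filter filter_pred1_uniq ?msupp_uniq // big_seq1.
by rewrite coefZ coefXn eqxx mulr1 mcoeffZ mcoeffX eqxx mulr1.
Qed.

Lemma meval_muni N (p : {mpoly K[N.+1]}) (v : 'I_N.+1 -> K) :
  p.@[v] = (map_poly (meval (fun i => v (widen_ord (leqnSn N) i))) (muni p)).[v ord_max].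
Proof.
rewrite muniE mevalE rmorph_sum horner_sum; apply: eq_bigr => m _ /=.
rewrite map_polyZ /= map_polyXn hornerZ hornerXn mevalZ mevalX big_ord_recr /= mulrA.
by congr (_ * _ * _); apply: eq_bigr => i _; rewrite mnmE.
Qed.

Lemma mpoly_neq0_value N (p : {mpoly K[N]}) : p != 0 -> exists v, p.@[v] != 0.
Proof.
elim: N p => [|N IH] p p0.
  exists (fun=> 0); rewrite (nvar0_mpolyC p) mevalC; apply: contraNneq p0 => e.
  by rewrite (nvar0_mpolyC p) e.
have [m pm] : exists m, p@_m != 0.
  by exists (mlead p); rewrite mleadc_eq0.
have /IH[w hw] : (muni p)`_(m ord_max) != 0.
  by apply: contraNneq pm => e; rewrite -mcoeff_muni e mcoeff0.
have /poly_neq0_value[x hx] : map_poly (meval w) (muni p) != 0.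
  by apply: contraNneq hw => /(congr1 (fun q : {poly K} => q`_(m ord_max))); rewrite coef_map coef0 /= => ->.
exists (fun i => if unlift ord_max i is Some j then w j else x).
rewrite meval_muni unlift_none.
rewrite (_ : map_poly _ _ = map_poly (meval w) (muni p)) //.
apply/polyP => k; rewrite !coef_map /=; apply: meval_eq => i.
by rewrite (_ : widen_ord _ i = lift ord_max i) ?liftK //; apply: val_inj; rewrite /= /bump leqNgt ltn_ord.
Qed.

Lemma mpoly_eq_value N (p q : {mpoly K[N]}) : (forall v, p.@[v] = q.@[v]) -> p = q.
Proof.
move=> e; apply/eqP; rewrite -subr_eq0; apply/negPn/negP => /mpoly_neq0_value[v].
by rewrite mevalB e subrr eqxx.
Qed.

End Values.

Section Dependence.
Variable K : fieldType.

(** Unknowns and equations are indexed by arbitrary finite types, so that systems made of several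
    kinds of equations can use sum types. *)
Lemma lindep (T T' : finType) (a : T -> T' -> K) : (#|T'| < #|T|)%N ->
  exists w : T -> K, (exists t, w t != 0) /\ forall t', \sum_t w t * a t t' = 0.
Proof.
move=> lt; pose M : 'M_(#|T|, #|T'|) := \matrix_(i, j) a (enum_val i) (enum_val j).
have /rowV0Pn[v /sub_kermxP vM v0] : kermx M != 0.
  by rewrite kermx_eq0 -row_leq_rank -ltnNge (leq_ltn_trans (rank_leq_col _)).
exists (fun t => v 0 (enum_rank t)); split.
  by have /rV0Pn[i vi] := v0; exists (enum_val i); rewrite enum_valK.
move=> t'; have /rowP/(_ (enum_rank t')) := vM; rewrite !mxE => e; rewrite -[RHS]e {e}.
rewrite [LHS](reindex (@enum_val T T)) /=; last exact/onW_bij/enum_val_bij.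
by apply: eq_bigr => i _; rewrite !mxE enum_valK enum_rankK.
Qed.

Lemma card_bmultinom_le N E : (#|{: 'X_{1..N < E.+1}}| <= E.+1 ^ N)%N.
Proof.
pose h (m : 'X_{1..N < E.+1}) : {ffun 'I_N -> 'I_E.+1} := [ffun i => inord (m i)].
rewrite -[X in (_ <= X ^ _)%N]card_ord -[X in (_ <= _ ^ X)%N]card_ord -card_ffun.
apply: (@leq_card _ _ h) => m m' /ffunP e; apply/val_inj/mnmP => i.
have b (m1 : 'X_{1..N < E.+1}) : (m1 i < E.+1)%N.
  apply: leq_ltn_trans (bmdeg m1); rewrite mdegE (bigD1 i) //=; exact: leq_addr.
by have := congr1 val (e i); rewrite !ffunE /= !inordK.
Qed.

Lemma msize_prod_le N k (F : 'I_k -> {mpoly K[N]}) D (e : 'I_k -> nat) b :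
  (forall i, msize (F i) <= D.+1)%N -> (forall i, e i <= b)%N ->
  (msize (\prod_i F i ^+ e i) <= (k * (b * D)).+1)%N.
Proof.
move=> hF he; have mul (p q : {mpoly K[N]}) x y :
    (msize p <= x.+1 -> msize q <= y.+1 -> msize (p * q) <= (x + y).+1)%N.
  move=> px qy; have [->|p0] := eqVneq p 0; first by rewrite mul0r mmeasure0.
  have [->|q0] := eqVneq q 0; first by rewrite mulr0 mmeasure0.
  rewrite msizeM //; have := leq_add px qy; rewrite addSn addnS.
  by case: (_ + _)%N => // n; rewrite ltnS.
have pw p j : (msize p <= D.+1 -> msize (p ^+ j : {mpoly K[N]}) <= (j * D).+1)%N.
  by move=> pD; elim: j => [|j IH]; rewrite ?expr0 ?mmeasure1 // exprS mulSn mul.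
rewrite -[k in (k * _)%N]card_ord -sum_nat_const.
elim/big_rec2: _ => [|i y1 y2 _ IH]; first by rewrite mmeasure1.
apply: mul IH; apply: (leq_trans (pw _ _ (hF i))).
by rewrite ltnS leq_mul2r he orbT.
Qed.

(** The products of the [F i] with exponents at most b number (b + 1)^M and lie in a space of
    dimension at most (E + 1)^N, where E grows linearly in b. Since N < M, a large b forces a linear
    relation among them. *)
Lemma mpoly_dependent N M (F : 'I_M -> {mpoly K[N]}) : (N < M)%N ->
  exists2 G : {mpoly K[M]}, G != 0 & forall v, G.@[fun i => (F i).@[v]] = 0.
Proof.
move=> lt_NM; pose D := \max_i msize (F i).
have hF i : (msize (F i) <= D.+1)%N by apply: leqW; exact: (leq_bigmax i).
(* Here E + 1 <= (b + 1) C, so b = C^N suffices: ((b + 1) C)^N = (b + 1)^N b < (b + 1)^(N + 1). *)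
pose C := (M * D).+1; pose b := (C ^ N)%N; pose E := (M * (b * D))%N.
have lt : (#|{: 'X_{1..N < E.+1}}| < #|{: {ffun 'I_M -> 'I_b.+1}}|)%N.
  apply: leq_ltn_trans (card_bmultinom_le _ _) _.
  rewrite card_ffun !card_ord.
  have le1 : (E.+1 <= b.+1 * C)%N.
    by rewrite /E /C; move: (b) (D) => x y; rewrite mulnS mulSn !mulnA mulnAC; lia.
  apply: (@leq_ltn_trans ((b.+1 * C) ^ N)).
    by move: (E.+1) (b.+1 * C)%N le1 => x y; case: (N) => // N' xy; rewrite leq_exp2r.
  apply: (@leq_trans (b.+1 ^ N.+1)); last by rewrite leq_pexp2l.
  by rewrite expnMn -/b expnSr ltn_pmul2l ?expn_gt0.
pose prodF (e : {ffun 'I_M -> 'I_b.+1}) := \prod_i F i ^+ e i.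
have [w [[e0 we0] hw]] := lindep (fun e (m : 'X_{1..N < E.+1}) => (prodF e)@_m) lt.
pose mon (e : {ffun 'I_M -> 'I_b.+1}) := [multinom (e i : nat) | i < M].
have mon_inj : injective mon.
  move=> e e' /mnmP h; apply/ffunP => i; apply/val_inj.
  by have := h i; rewrite !mnmE.
exists (\sum_e w e *: 'X_[mon e]).
  apply/negP => /eqP/(congr1 (mcoeff (mon e0))); rewrite mcoeff0 raddf_sum /= (bigD1 e0) //=.
  rewrite big1 ?addr0 => [|e ne]; first by rewrite mcoeffZ mcoeffX eqxx mulr1; apply/eqP.
  by rewrite mcoeffZ mcoeffX (inj_eq mon_inj) (negPf ne) mulr0.
have z : \sum_e w e *: prodF e = 0.
  apply/mpolyP => m; rewrite mcoeff0 raddf_sum /=.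
  have [lt_m|le_m] := ltnP (mdeg m) E.+1.
    by rewrite -[RHS](hw (BMultinom lt_m)); apply: eq_bigr => e _; rewrite mcoeffZ.
  rewrite big1 // => e _; rewrite mcoeffZ memN_msupp_eq0 ?mulr0 //.
  apply/negP => /msize_mdeg_lt; apply/negP; rewrite -leqNgt; apply: leq_trans le_m.
  by apply: msize_prod_le => // i; rewrite -ltnS.
move=> v; rewrite -[RHS](meval0 v) -z !raddf_sum /=; apply: eq_bigr => e _.
rewrite !mevalZ mevalX rmorph_prod /=; congr (_ * _); apply: eq_bigr => i _.
by rewrite rmorphXn /= mnmE.
Qed.

End Dependence.

(** * Homogeneous parts and restrictions to lines and curves *)

Section Univariate.
Variable K : numFieldType.

Lemma poly_eq0_off0 (q : {poly K}) : (forall t, t != 0 -> q.[t] = 0) -> q = 0.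
Proof.
move=> h; apply/eqP/negPn/negP => q0.
have [|x] := @poly_neq0_value _ (q * 'X); first by rewrite mulf_neq0 ?polyX_eq0.
by rewrite hornerM hornerX mulf_eq0 negb_or => /andP[+ x0]; rewrite h ?eqxx.
Qed.

Lemma horner_mmap N (g : 'I_N -> {poly K}) (H : {mpoly K[N]}) t :
  (mmap polyC g H).[t] = H.@[fun i => (g i).[t]].
Proof.
rewrite /mmap horner_sum mevalE; apply: eq_bigr => m _.
rewrite hornerM hornerC /mmap1 horner_prod; congr (_ * _).
by apply: eq_bigr => i _; rewrite horner_exp.
Qed.

Lemma meval_homog N e (p : {mpoly K[N]}) t v :
  p \is e.-homog -> p.@[fun i => t * v i] = t ^+ e * p.@[v].
Proof.
move/dhomogP => hp; rewrite !mevalE mulr_sumr; apply: eq_big_seq => m mp.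
have <- : mdeg m = e := hp _ mp.
rewrite mulrCA mdegE; congr (_ * _).
rewrite expr_sum -big_split /=; apply: eq_bigr => i _; exact: exprMn.
Qed.

Lemma pihomog_partition N (p : {mpoly K[N]}) :
  p = \sum_(e < msize p) pihomog mdeg e p.
Proof. by rewrite -pihomog_partitionE. Qed.

(** On the punctured line through [v], [p] is a polynomial in t whose coefficients are the values at
    [v] of its homogeneous parts. *)
Lemma pihomog_cone N (p : {mpoly K[N]}) v e :
  (forall t, t != 0 -> p.@[fun i => t * v i] = 0) -> (pihomog mdeg e p).@[v] = 0.
Proof.
move=> h; have [lt_e|ge_e] := ltnP e (msize p); last first.
  by rewrite pihomogE big1_seq ?meval0 // => m /andP[/eqP /= me /msize_mdeg_lt]; rewrite me ltnNge ge_e.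
pose q : {poly K} := \sum_(k < msize p) ((pihomog mdeg k p).@[v])%:P * 'X^k.
have : q = 0.
  apply: poly_eq0_off0 => t t0; rewrite -(h t t0) {1}(pihomog_partition p).
  rewrite horner_sum raddf_sum /=; apply: eq_bigr => k _.
  by rewrite (meval_homog _ _ (pihomogP _ _ _)) hornerM hornerC hornerXn mulrC.
move/(congr1 (fun q : {poly K} => q`_e)); rewrite coef0 coef_sum (bigD1 (Ordinal lt_e)) //=.
rewrite big1 ?addr0 => [|k ke]; rewrite coefCM coefXn.
  by rewrite eqxx mulr1.
by case: eqP => [ek|_]; rewrite ?mulr0 //; case/eqP: ke; apply: val_inj.
Qed.

(* The lowest homogeneous part of F at the point a vanishes on the tangent directions, which are all of K^k. *)
Lemma tangent_independent k (F : {mpoly K[k]}) (a : 'I_k -> K) :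
  (forall w : 'I_k -> K, exists g : 'I_k -> {poly K},
     (forall i, (g i).[0] = w i) /\ forall t, F.@[fun i => a i + t * (g i).[t]] = 0) ->
  F = 0.
Proof.
move=> hF; pose G := F \mPo [tuple (a i)%:MP + 'X_i | i < k].
have GE v : G.@[v] = F.@[fun i => a i + v i].
  rewrite comp_mpoly_meval; apply: meval_eq => i.
  by rewrite tnth_mktuple mevalD mevalC mevalXU.
suff G0 : G = 0.
  apply: mpoly_eq_value => v; rewrite meval0 -(meval0 (fun i => v i - a i)) -G0 GE.
  by apply: meval_eq => i; rewrite addrC subrK.
suff Ge e : pihomog mdeg e G = 0.
  by rewrite (pihomog_partition G) big1.
elim/ltn_ind: e => e IH; apply: mpoly_eq_value => w; rewrite meval0.
have [g [g0 gF]] := hF w.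
pose H f := mmap polyC g (pihomog mdeg f G).
(* With all parts of degree below e already zero, [q] is G(t g(t)) / t^e; at t = 0 it is the part of
   degree e at g(0) = w. *)
pose q : {poly K} := \sum_(f < msize G | (e <= f)%N) 'X^(f - e) * H f.
have q0 : q = 0.
  apply: poly_eq0_off0 => t t0; apply: (mulfI (expf_neq0 e t0)); rewrite mulr0.
  rewrite -(gF t) -GE {1}(pihomog_partition G) raddf_sum /= (bigID (fun f : 'I__ => (e <= f)%N)) /=.
  rewrite [X in _ = _ + X]big1 ?addr0 => [|f]; last by rewrite -ltnNge => /IH ->; rewrite meval0.
  rewrite horner_sum mulr_sumr; apply: eq_bigr => f ef.
  rewrite hornerM hornerXn horner_mmap (meval_homog _ _ (pihomogP _ _ _)).
  by rewrite mulrA -exprD subnKC.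
have [lt_e|ge_e] := ltnP e (msize G); last first.
  by rewrite pihomogE big1_seq ?meval0 // => m /andP[/eqP /= me /msize_mdeg_lt]; rewrite me ltnNge ge_e.
have := congr1 (fun q => q.[0]) q0; rewrite horner0 horner_sum (bigD1 (Ordinal lt_e)) //=.
rewrite big1 ?addr0 => [|f /andP[ef fe]].
  by rewrite subnn mul1r horner_mmap => <-; apply: meval_eq => i; rewrite g0.
rewrite hornerM hornerXn expr0n subn_eq0 (_ : (f <= e)%N = false) ?mul0r //.
apply/negP => fle; case/eqP: fe; apply: val_inj; apply/eqP; by rewrite eqn_leq fle.
Qed.

End Univariate.

(** * Functions and families of forms that depend polynomially on parameters *)

Section PolynomialFunctions.
Variables (K : comNzRingType) (s : nat).
Implicit Types f g : ('I_s -> K) -> K.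

(** Parametrizations are treated as functions on points; the closure properties below spare writing
    down the underlying polynomials. *)
Definition polyfun f := exists F : {mpoly K[s]}, forall v, f v = F.@[v].

Lemma eq_polyfun f g : f =1 g -> polyfun f -> polyfun g.
Proof. by move=> e [F h]; exists F => v; rewrite -e. Qed.

Lemma polyfun_const c : polyfun (fun=> c).
Proof. by exists c%:MP => v; rewrite mevalC. Qed.

Lemma polyfun_coord i : polyfun (fun v => v i).
Proof. by exists 'X_i => v; rewrite mevalXU. Qed.

Lemma polyfunD f g : polyfun f -> polyfun g -> polyfun (fun v => f v + g v).
Proof. by move=> [F hF] [G hG]; exists (F + G) => v; rewrite mevalD hF hG. Qed.

Lemma polyfunM f g : polyfun f -> polyfun g -> polyfun (fun v => f v * g v).
Proof. by move=> [F hF] [G hG]; exists (F * G) => v; rewrite mevalM hF hG. Qed.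

Lemma polyfunX f n : polyfun f -> polyfun (fun v => f v ^+ n).
Proof. by move=> [F hF]; exists (F ^+ n) => v; rewrite rmorphXn /= hF. Qed.

Lemma polyfun_sum (I : Type) (r : seq I) (P : pred I) (f : I -> ('I_s -> K) -> K) :
  (forall i, polyfun (f i)) -> polyfun (fun v => \sum_(i <- r | P i) f i v).
Proof.
move=> hf; elim: r => [|i r IH].
  by apply: eq_polyfun (polyfun_const 0) => v; rewrite big_nil.
have [Pi|Pi] := boolP (P i); last by apply: eq_polyfun IH => v; rewrite big_cons (negPf Pi).
by apply: eq_polyfun (polyfunD (hf i) IH) => v; rewrite big_cons Pi.
Qed.

Lemma polyfun_prod (I : Type) (r : seq I) (P : pred I) (f : I -> ('I_s -> K) -> K) :
  (forall i, polyfun (f i)) -> polyfun (fun v => \prod_(i <- r | P i) f i v).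
Proof.
move=> hf; elim: r => [|i r IH].
  by apply: eq_polyfun (polyfun_const 1) => v; rewrite big_nil.
have [Pi|Pi] := boolP (P i); last by apply: eq_polyfun IH => v; rewrite big_cons (negPf Pi).
by apply: eq_polyfun (polyfunM (hf i) IH) => v; rewrite big_cons Pi.
Qed.

Lemma polyfun_det n (A : ('I_s -> K) -> 'M[K]_n) :
  (forall i j, polyfun (fun v => A v i j)) -> polyfun (fun v => \det (A v)).
Proof.
move=> hA; apply: polyfun_sum => t; apply: polyfunM; first exact: polyfun_const.
by apply: polyfun_prod.
Qed.

Lemma polyfun_meval N (p : {mpoly K[N]}) (f : 'I_N -> ('I_s -> K) -> K) :
  (forall i, polyfun (f i)) -> polyfun (fun v => p.@[fun i => f i v]).
Proof.
move=> hf; apply: polyfun_sum => m; apply: polyfunM; first exact: polyfun_const.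
by apply: polyfun_prod => i; apply: polyfunX.
Qed.

Definition polyfam N (p : ('I_s -> K) -> {mpoly K[N]}) :=
  forall m, polyfun (fun v => (p v)@_m).

Lemma polyfam_const N (q : {mpoly K[N]}) : polyfam (fun=> q).
Proof. by move=> m; apply: polyfun_const. Qed.

Lemma polyfamZ N (f : ('I_s -> K) -> K) (p : ('I_s -> K) -> {mpoly K[N]}) :
  polyfun f -> polyfam p -> polyfam (fun v => f v *: p v).
Proof.
by move=> hf hp m; apply: eq_polyfun (polyfunM hf (hp m)) => v; rewrite mcoeffZ.
Qed.

Lemma polyfamM N (p q : ('I_s -> K) -> {mpoly K[N]}) :
  polyfam p -> polyfam q -> polyfam (fun v => p v * q v).
Proof.
move=> hp hq m; eapply eq_polyfun; first by move=> v; rewrite mcoeffM.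
by apply: polyfun_sum => k; apply: polyfunM.
Qed.

Lemma polyfam_sum N (I : Type) (r : seq I) (P : pred I) (p : I -> ('I_s -> K) -> {mpoly K[N]}) :
  (forall i, polyfam (p i)) -> polyfam (fun v => \sum_(i <- r | P i) p i v).
Proof.
move=> hp m; eapply eq_polyfun; first by move=> v; rewrite raddf_sum.
by apply: polyfun_sum => i; apply: hp.
Qed.

Lemma polyfam_prod N (I : Type) (r : seq I) (P : pred I) (p : I -> ('I_s -> K) -> {mpoly K[N]}) :
  (forall i, polyfam (p i)) -> polyfam (fun v => \prod_(i <- r | P i) p i v).
Proof.
move=> hp; elim: r => [|i r IH] m.
  by apply: eq_polyfun (polyfam_const 1 m) => v; rewrite big_nil.
have [Pi|Pi] := boolP (P i); last by apply: eq_polyfun (IH m) => v; rewrite big_cons (negPf Pi).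
by apply: eq_polyfun (polyfamM (hp i) IH m) => v; rewrite big_cons Pi.
Qed.

Lemma polyfam_comp N M (P : {mpoly K[M]}) (q : 'I_M -> ('I_s -> K) -> {mpoly K[N]}) :
  (forall i, polyfam (q i)) -> polyfam (fun v => P \mPo [tuple q i v | i < M]).
Proof.
move=> hq m.
have pw i k : polyfam (fun v => q i v ^+ k).
  elim: k => [|k IH] m1; first exact: (polyfam_const 1).
  by apply: eq_polyfun (polyfamM (hq i) IH m1) => v; rewrite exprS.
have h : polyfam (fun v => \sum_(m <- msupp P) P@_m *: \prod_(i < M) q i v ^+ m i).
  apply: polyfam_sum => m'; apply: polyfamZ; first exact: polyfun_const.
  by apply: polyfam_prod => i; apply: pw.
apply: eq_polyfun (h m) => v; rewrite comp_mpolyE; congr (_@_m).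
by apply: eq_bigr => m' _; congr (_ *: _); apply: eq_bigr => i _; rewrite tnth_mktuple.
Qed.

End PolynomialFunctions.

Lemma polyfam_linform (K : fieldType) s N (a : ('I_s -> K) -> 'rV[K]_N) :
  (forall k, polyfun (fun v => a v 0 k)) -> polyfam (fun v => linform (a v)).
Proof.
move=> ha; apply: polyfam_sum => k.
by apply: (@polyfamZ _ _ _ (fun v => a v 0 k)) => //; apply: polyfam_const.
Qed.

(** * Extension of homomorphisms *)

Section HomExtension.
Variables (D : idomainType) (K : closedFieldType).
Implicit Types (A : D -> Prop) (h : D -> K) (p q r s : {poly D}).

Definition subring A :=
  [/\ A 1, forall x y, A x -> A y -> A (x - y) & forall x y, A x -> A y -> A (x * y)].

(** [h] is total and arbitrary off [A], so homomorphisms on a growing chain of subrings all have the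
    same type. *)
Definition hom_on A h :=
  [/\ h 1 = 1, forall x y, A x -> A y -> h (x - y) = h x - h y
    & forall x y, A x -> A y -> h (x * y) = h x * h y].

Definition poly_in A q := forall i, A q`_i.

Definition adjoin A x : D -> Prop := fun y => exists2 q, poly_in A q & y = q.[x].

Section OneStep.
Variables (A : D -> Prop) (sA : subring A).

Lemma subring1 : A 1. Proof. by case: sA. Qed.
Lemma subringB x y : A x -> A y -> A (x - y). Proof. by case: sA => _ + _; apply. Qed.
Lemma subringM x y : A x -> A y -> A (x * y). Proof. by case: sA => _ _; apply. Qed.
Lemma subring0 : A 0. Proof. by rewrite -(subrr 1); apply: subringB subring1 subring1. Qed.
Lemma subringN x : A x -> A (- x).
Proof. by move=> Ax; rewrite -sub0r; apply: subringB subring0 Ax. Qed.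
Lemma subringD x y : A x -> A y -> A (x + y).
Proof. by move=> Ax Ay; rewrite -[y]opprK; apply/(subringB Ax)/subringN. Qed.
Lemma subring_sum n (F : 'I_n -> D) : (forall i, A (F i)) -> A (\sum_i F i).
Proof. by move=> AF; elim/big_rec: _ => [|i x _]; [apply: subring0|apply/subringD]. Qed.
Lemma subringX x n : A x -> A (x ^+ n).
Proof.
by move=> Ax; elim: n => [|n IH]; rewrite ?expr0 ?exprS; [apply: subring1|apply: subringM].
Qed.

Lemma poly_inC c : A c -> poly_in A c%:P.
Proof. by move=> Ac i; rewrite coefC; case: eqP => // _; apply: subring0. Qed.
Lemma poly_inXn n : poly_in A 'X^n.
Proof. by move=> i; rewrite coefXn; case: eqP => _; [apply: subring1|apply: subring0]. Qed.
Lemma poly_inB p q : poly_in A p -> poly_in A q -> poly_in A (p - q).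
Proof. by move=> Ap Aq i; rewrite coefB; apply: subringB. Qed.
Lemma poly_inD p q : poly_in A p -> poly_in A q -> poly_in A (p + q).
Proof. by move=> Ap Aq i; rewrite coefD; apply: subringD. Qed.
Lemma poly_inM p q : poly_in A p -> poly_in A q -> poly_in A (p * q).
Proof. by move=> Ap Aq i; rewrite coefM; apply: subring_sum => j; apply: subringM. Qed.
Lemma poly_inZ c p : A c -> poly_in A p -> poly_in A (c *: p).
Proof. by move=> Ac Ap i; rewrite coefZ; apply: subringM. Qed.

Lemma adjoin_subring x : subring (adjoin A x).
Proof.
split; first by exists 1%:P; [apply/poly_inC/subring1|rewrite hornerC].
  by move=> _ _ [p Ap ->] [q Aq ->]; exists (p - q); [apply: poly_inB|rewrite hornerD hornerN].
by move=> _ _ [p Ap ->] [q Aq ->]; exists (p * q); [apply: poly_inM|rewrite hornerM].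
Qed.

Lemma adjoin_sub x y : A y -> adjoin A x y.
Proof. by move=> Ay; exists y%:P; [apply: poly_inC|rewrite hornerC]. Qed.

Lemma adjoin_gen x : adjoin A x x.
Proof. by exists 'X; [apply: (poly_inXn 1)|rewrite hornerX]. Qed.

(** Quotient and remainder must keep their coefficients in [A], so every elimination step multiplies
    by the leading coefficient in place of dividing by it. *)
Lemma pseudo_division p q : poly_in A p -> p != 0 -> poly_in A q ->
  exists k s r, [/\ poly_in A s, poly_in A r, (size r < size p)%N
    & lead_coef p ^+ k *: q = s * p + r].
Proof.
move=> Ap p0; have [n] := ubnP (size q); elim: n => // n IH in q *.
rewrite ltnS => le_n Aq; have [lt|ge] := ltnP (size q) (size p).
  by exists 0%N, 0, q; rewrite expr0 scale1r mul0r add0r; split=> // i; rewrite coef0; apply: subring0.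
have q0 : q != 0.
  by apply: contraTneq ge => ->; rewrite size_poly0 -ltnNge size_poly_gt0.
pose t := lead_coef q *: 'X^(size q - size p).
pose q' := lead_coef p *: q - t * p.
have At : poly_in A t by apply: poly_inZ (poly_inXn _); apply: Aq.
have Alp : A (lead_coef p) by apply: Ap.
have sq0 : (0 < size q)%N by rewrite size_poly_gt0.
have sp0 : (0 < size p)%N by rewrite size_poly_gt0.
have lt_q' : (size q' < size q)%N.
  rewrite -[X in (_ < X)%N](prednK sq0) ltnS; apply/leq_sizeP => j le_j.
  rewrite coefB coefZ /t -scalerAl coefZ coefXnM.
  have [->|ne] := eqVneq j (size q).-1.
    rewrite ifF; last by apply/negbTE; rewrite -leqNgt; lia.
    by rewrite (_ : ((size q).-1 - (size q - size p))%N = (size p).-1) ?[_ * p`_ _]mulrC ?subrr //; lia.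
  have lt_j : (size q <= j)%N by rewrite -(prednK sq0) ltn_neqAle eq_sym ne le_j.
  rewrite nth_default //.
  have le_pj : (size p <= j - (size q - size p))%N.
    by rewrite leq_subRL ?subnK // (leq_trans (leq_subr _ _) lt_j).
  by rewrite (nth_default _ le_pj) if_same !mulr0 subrr.
have [|k [s [r [As Ar lt_r e]]]] := IH q' (leq_trans lt_q' le_n).
  by apply: poly_inB (poly_inM At Ap); apply: poly_inZ.
exists k.+1, (lead_coef p ^+ k *: t + s), r; split=> //.
  by apply: poly_inD As; apply: poly_inZ At; apply: subringX.
rewrite mulrDl -addrA -e -scalerAl -scalerDr /q' addrCA subrr addr0.
by rewrite exprSr scalerA.
Qed.

Section MapHom.
Variables (h : D -> K) (hh : hom_on A h).

Lemma homB x y : A x -> A y -> h (x - y) = h x - h y. Proof. by case: hh => _ + _; apply. Qed.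
Lemma homM x y : A x -> A y -> h (x * y) = h x * h y. Proof. by case: hh => _ _; apply. Qed.
Lemma hom0 : h 0 = 0. Proof. by rewrite -(subrr 1) homB ?subrr; try exact: subring1. Qed.
Lemma homN x : A x -> h (- x) = - h x.
Proof. by move=> Ax; rewrite -sub0r homB ?hom0 ?sub0r //; exact: subring0. Qed.
Lemma homD x y : A x -> A y -> h (x + y) = h x + h y.
Proof. by move=> Ax Ay; rewrite -{1}[y]opprK homB ?homN ?opprK //; exact: subringN. Qed.
Lemma hom_sum n (F : 'I_n -> D) : (forall i, A (F i)) -> h (\sum_i F i) = \sum_i h (F i).
Proof.
move=> AF; suff [] : A (\sum_i F i) /\ h (\sum_i F i) = \sum_i h (F i) by [].
elim/big_rec2: _ => [|i y x _ [Ax <-]]; first by split; [exact: subring0|exact: hom0].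
by split; [exact: subringD|exact: homD].
Qed.
Lemma homX x k : A x -> h (x ^+ k) = h x ^+ k.
Proof.
move=> Ax; elim: k => [|k IH]; first by rewrite !expr0; case: hh.
by rewrite !exprS homM ?IH //; apply: subringX.
Qed.

Definition map_hom q : {poly K} := \poly_(i < size q) h q`_i.

Lemma coef_map_hom q i : (map_hom q)`_i = h q`_i.
Proof. by rewrite coef_poly; case: ltnP => // le; rewrite nth_default ?hom0. Qed.

Lemma map_homB p q : poly_in A p -> poly_in A q -> map_hom (p - q) = map_hom p - map_hom q.
Proof. by move=> Ap Aq; apply/polyP => i; rewrite coefB !coef_map_hom coefB homB. Qed.
Lemma map_homM p q : poly_in A p -> poly_in A q -> map_hom (p * q) = map_hom p * map_hom q.
Proof.
move=> Ap Aq; apply/polyP => i; rewrite coefM !coef_map_hom coefM hom_sum.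
  by apply: eq_bigr => j _; rewrite !coef_map_hom homM.
by move=> j; apply: subringM.
Qed.
Lemma map_homZ c q : A c -> poly_in A q -> map_hom (c *: q) = h c *: map_hom q.
Proof. by move=> Ac Aq; apply/polyP => i; rewrite coefZ !coef_map_hom coefZ homM. Qed.
Lemma map_homC c : map_hom c%:P = (h c)%:P.
Proof. by apply/polyP => i; rewrite coef_map_hom !coefC; case: eqP => // _; rewrite hom0. Qed.

Lemma extend_hom x xi :
  (forall q, poly_in A q -> q.[x] = 0 -> (map_hom q).[xi] = 0) ->
  exists2 h' : D -> K, hom_on (adjoin A x) h' &
    forall q, poly_in A q -> h' q.[x] = (map_hom q).[xi].
Proof.
(* [rep] chooses an expression of y as a polynomial in x over [A], with default 0 elsewhere; [wd]
   makes the value at [xi] independent of the choice. *)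
move=> wd; pose rep y := if pselect (adjoin A x y) is left e then s2val (cid2 e) else 0.
pose h' y := (map_hom (rep y)).[xi].
have h'E q : poly_in A q -> h' q.[x] = (map_hom q).[xi].
  move=> Aq; have [Ar e] : poly_in A (rep q.[x]) /\ q.[x] = (rep q.[x]).[x].
    rewrite /rep; case: pselect => [e|[]]; last by exists q.
    by split; [exact: s2valP (cid2 e)|exact: s2valP' (cid2 e)].
  have := wd _ (poly_inB Ar Aq); rewrite hornerD hornerN -e subrr => /(_ erefl).
  by rewrite map_homB // hornerD hornerN => /subr0_eq.
exists h' => //; split.
- by rewrite -(hornerC 1 x) h'E ?map_homC ?hornerC; [case: hh|apply/poly_inC/subring1].
- move=> _ _ [p Ap ->] [q Aq ->]; rewrite -hornerN -hornerD !h'E ?map_homB ?hornerD ?hornerN //.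
  exact: poly_inB.
- move=> _ _ [p Ap ->] [q Aq ->]; rewrite -hornerM !h'E ?map_homM ?hornerM //.
  exact: poly_inM.
Qed.

End MapHom.

(* Reduce b modulo the minimal polynomial of x and continue the Euclidean algorithm. *)
Lemma algebraic_multiple x b p : poly_in A p -> p != 0 -> p.[x] = 0 ->
  (forall q, poly_in A q -> q != 0 -> q.[x] = 0 -> (size p <= size q)%N) ->
  adjoin A x b -> b != 0 ->
  exists c u, [/\ A c, c != 0, adjoin A x u & c = u * b].
Proof.
move=> Ap p0 px minp [q Aq bq] b0.
(* The sizes of polynomials over [A] whose value at x is a nonzero multiple of b. Size 1 is the
   goal. *)
pose good n := `[< exists r u, [/\ poly_in A r, size r = n, r.[x] != 0, adjoin A x u & r.[x] = u * b] >].
have lp0 : lead_coef p != 0 by rewrite lead_coef_eq0.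
have [k0 [s0 [r0 [As0 Ar0 lt0 e0]]]] := pseudo_division Ap p0 Aq.
have e0x : r0.[x] = lead_coef p ^+ k0 * b.
  by have := congr1 (fun q => q.[x]) e0; rewrite hornerZ hornerD hornerM px mulr0 add0r -bq.
have g0 : good (size r0).
  apply/asboolP; exists r0, (lead_coef p ^+ k0); split=> //.
    by rewrite e0x mulf_neq0 ?expf_neq0.
  by apply: adjoin_sub; apply: subringX; apply: Ap.
have exg : exists n, good n by exists (size r0).
case: (ex_minnP exg) => n /asboolP[r [u [Ar sr rx Au ru]]] minn.
have lt_np : (n < size p)%N by apply: leq_ltn_trans lt0; apply: minn.
have r_neq0 : r != 0 by apply: contraNneq rx => ->; rewrite horner0.
have lr0 : lead_coef r != 0 by rewrite lead_coef_eq0.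
have [le1|gt1] := leqP n 1.
  exists r`_0, u; rewrite -ru; have er : r = (r`_0)%:P by apply: size1_polyC; rewrite sr.
  have hr : r.[x] = r`_0 by rewrite {1}er hornerC.
  by rewrite hr; split=> //; rewrite -hr.
(* If n > 1, divide p by r. The remainder takes at x a multiple of b, hence vanishes there by
   minimality of n; then s(x) = 0, although s is shorter than p. *)
have [k [s [r' [As Ar' lt' e]]]] := pseudo_division Ar r_neq0 Ap.
have ex : s.[x] * r.[x] + r'.[x] = 0.
  by have := congr1 (fun q => q.[x]) e; rewrite hornerZ hornerD hornerM px mulr0 => <-.
have r'x : r'.[x] = 0.
  apply/eqP/negPn/negP => r'x; have : good (size r').
    apply/asboolP; exists r', (- s.[x] * u); split=> //.
      by have [_ _ mulA] := adjoin_subring x; apply: mulA => //; exists (- s); rewrite ?hornerN // => i; rewrite coefN; apply: subringN.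
    by move/eqP: ex; rewrite addrC addr_eq0 => /eqP ->; rewrite ru !mulNr mulrA.
  by move/minn; rewrite leqNgt -sr lt'.
have sx : s.[x] = 0.
  by move/eqP: ex; rewrite r'x addr0 mulf_eq0 (negPf rx) orbF => /eqP.
have sz : size (lead_coef r ^+ k *: p) = size p by rewrite size_scale ?expf_neq0.
have [s_eq0|s_neq0] := eqVneq s 0.
  by move: lt'; rewrite sr -[r']add0r -[X in X + r'](mul0r r) -s_eq0 -e sz ltnNge (ltnW lt_np).
have le_s := minp _ As s_neq0 sx.
have szM : size (s * r) = (size s + n).-1 by rewrite size_mul // sr.
have : size (s * r + r') = (size s + n).-1.
  by rewrite size_polyDl szM //; move: lt' lt_np; rewrite sr; lia.
by rewrite -e sz; lia.
Qed.

(** For x transcendental, b = q(x) and a is the leading coefficient of q: x is sent off the roots of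
    the image of q. For x algebraic, x is sent to a root of the image of its minimal polynomial, and
    a is the leading coefficient times a multiple of b that lies in [A]. *)
Lemma extension_step x b : adjoin A x b -> b != 0 ->
  exists a, [/\ A a, a != 0 & forall h, hom_on A h -> h a != 0 ->
    exists h', [/\ hom_on (adjoin A x) h', forall y, A y -> h' y = h y & h' b != 0]].
Proof.
move=> Ab b0.
have [[p0 [Ap0 p00 p0x]]|tr] := pselect (exists p, [/\ poly_in A p, p != 0 & p.[x] = 0]); last first.
  have [q Aq bq] := Ab; have q0 : q != 0 by apply: contraNneq b0 => q0; rewrite bq q0 horner0.
  exists (lead_coef q); split; [exact: Aq|by rewrite lead_coef_eq0|move=> h hh hl].
  have mq0 : map_hom h q != 0.
    apply: contraNneq hl => e.
    by rewrite lead_coefE -(coef_map_hom hh) e coef0.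
  have [xi hxi] := closed_nonrootP _ mq0.
  have [|h' hh' h'E] := extend_hom hh (x := x) (xi := xi).
    move=> r Ar rx; have [->|r0] := eqVneq r 0; last by case: tr; exists r.
    by rewrite map_homC // hom0 // horner0.
  exists h'; split=> // [y Ay|]; last by rewrite bq h'E.
  by rewrite -(hornerC y x) h'E ?map_homC ?hornerC //; apply: poly_inC.
pose good n := `[< exists p, [/\ poly_in A p, p != 0, p.[x] = 0 & size p = n] >].
have exg : exists n, good n by exists (size p0); apply/asboolP; exists p0.
case: (ex_minnP exg) => n /asboolP[p [Ap p_neq0 px sp]] minn.
have minp q : poly_in A q -> q != 0 -> q.[x] = 0 -> (size p <= size q)%N.
  by move=> Aq q0 qx; rewrite sp; apply: minn; apply/asboolP; exists q.
have [c [u [Ac c0 Au cub]]] := algebraic_multiple Ap p_neq0 px minp Ab b0.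
have Alp : A (lead_coef p) by apply: Ap.
exists (lead_coef p * c); split; first exact: subringM.
  by rewrite mulf_neq0 // lead_coef_eq0.
move=> h hh; rewrite homM // mulf_eq0 negb_or => /andP[hl hc].
have smp : size (map_hom h p) = size p.
  apply/anti_leq; rewrite size_poly /= leqNgt; apply/negP => lt.
  move: hl; rewrite lead_coefE -(coef_map_hom hh) nth_default ?eqxx //.
  by rewrite -ltnS prednK // size_poly_gt0.
have size_gt1 : (1 < size p)%N.
  rewrite ltnNge; apply/negP => /size1_polyC e; move: px p_neq0; rewrite e hornerC => ->.
  by rewrite eqxx.
have [xi /rootP hxi] : exists xi, root (map_hom h p) xi.
  by apply/closed_rootP; rewrite smp neq_ltn size_gt1 orbT.
have [|h' hh' h'E] := extend_hom hh (x := x) (xi := xi).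
  (* Up to a power of the leading coefficient, a relation of x is a multiple of p, so it also holds
     at [xi]. *)
  move=> q Aq qx; have [k [s [r [As Ar lt e]]]] := pseudo_division Ap p_neq0 Aq.
  have rx : r.[x] = 0.
    have := congr1 (fun q => q.[x]) e.
    by rewrite hornerZ hornerD hornerM px qx !mulr0 add0r.
  have r0 : r = 0.
    by apply/eqP/negPn/negP => r0; have := minp _ Ar r0 rx; rewrite leqNgt lt.
  have := congr1 (fun q => (map_hom h q).[xi]) e; rewrite r0 addr0.
  rewrite map_homZ //; last exact: subringX.
  rewrite map_homM // hornerZ hornerM hxi mulr0 homX // => /eqP.
  by rewrite mulf_eq0 expf_eq0 (negPf hl) andbF => /eqP.
have h'A y : A y -> h' y = h y.
  by move=> Ay; rewrite -(hornerC y x) h'E ?map_homC ?hornerC //; apply: poly_inC.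
exists h'; split=> //; apply: contraNneq hc => hb.
have [_ _ mulh'] := hh'; by rewrite -h'A // cub mulh' // hb mulr0.
Qed.

End OneStep.

Fixpoint adjoins A (xs : seq D) : D -> Prop :=
  if xs is x :: xs' then adjoins (adjoin A x) xs' else A.

Lemma adjoins_subring A xs : subring A -> subring (adjoins A xs).
Proof. by elim: xs A => [|x xs IH] A sA //=; apply/IH/adjoin_subring. Qed.

Lemma adjoins_sub A xs y : subring A -> A y -> adjoins A xs y.
Proof.
elim: xs A => [|x xs IH] A sA //= Ay; apply: IH; first exact: adjoin_subring.
exact: adjoin_sub.
Qed.

Lemma adjoins_gen A xs x : subring A -> x \in xs -> adjoins A xs x.
Proof.
elim: xs A => [|y xs IH] A sA //=; rewrite inE => /orP[/eqP -> | xxs].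
  by apply: adjoins_sub; [exact: adjoin_subring|exact: adjoin_gen].
by apply: IH => //; apply: adjoin_subring.
Qed.

(* Atiyah-Macdonald, Proposition 5.23, for finitely many generators. *)
Lemma extension_theorem A xs b : subring A -> adjoins A xs b -> b != 0 ->
  exists a, [/\ A a, a != 0 & forall h, hom_on A h -> h a != 0 ->
    exists h', [/\ hom_on (adjoins A xs) h', forall y, A y -> h' y = h y & h' b != 0]].
Proof.
elim: xs A => [|x xs IH] A sA /= Ab b0.
  by exists b; split=> // h hh hb; exists h.
have [a1 [Aa1 a10 ext1]] := IH _ (adjoin_subring sA x) Ab b0.
have [a [Aa a0 ext]] := extension_step sA Aa1 a10.
exists a; split=> // h hh ha; have [h1 [hh1 h1E h1a]] := ext h hh ha.
have [h' [hh' h'E h'b]] := ext1 h1 hh1 h1a; exists h'; split=> // y Ay.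
by rewrite h'E ?h1E //; apply: adjoin_sub.
Qed.

End HomExtension.

(** * Zariski closures in the space of forms *)

Section Zariski.
Variables (K : numClosedFieldType) (N d : nat).
Implicit Types (p q : {mpoly K[N]}) (X Y Z : {mpoly K[N]} -> Prop).
Local Notation c := #|{: 'X_{1..N < d.+1}}|.
Implicit Types f g : {mpoly K[c]}.
Local Notation co := (@coefs K N d).
Local Notation "f .[% p ]" := (f.@[co p]) (at level 2, format "f .[%  p ]").

Definition vanishes f X := forall p, X p -> f.[% p] = 0.
Definition conic X := forall t p, t != 0 -> X p -> X (t *: p).

Lemma coefsZ t p f : f.[% t *: p] = f.@[fun i => t * co p i].
Proof. by apply: meval_eq => i; rewrite /coefs mcoeffZ. Qed.

Lemma coefsZ_homog t p f e : f \is e.-homog -> f.[% t *: p] = t ^+ e * f.[% p].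
Proof. by move=> hf; rewrite coefsZ (meval_homog _ _ hf). Qed.

Lemma proj_pointZ t p : t != 0 -> proj_point d p -> proj_point d (t *: p).
Proof.
move=> t0 [p0 hp]; split; last exact: dhomogZ.
by rewrite mscalerI negb_or t0.
Qed.

Lemma zclosed_conic Y : zclosed d Y -> conic Y.
Proof.
move=> [S [Sh YE]] t p t0 /YE[pp Sp]; apply/YE; split; first exact: proj_pointZ.
by move=> f Sf; have [e fe] := Sh f Sf; rewrite (coefsZ_homog _ _ fe) Sp // mulr0.
Qed.

Lemma zclosed_proj Y : zclosed d Y -> psub Y (proj_point d).
Proof. by move=> [S [_ YE]] p /YE[]. Qed.

Lemma zclosed_separate Y p : zclosed d Y -> proj_point d p -> ~ Y p ->
  exists f, [/\ exists e : nat, f \is e.-homog, vanishes f Y & f.[% p] != 0].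
Proof.
move=> [S [Sh YE]] pp nYp; apply: contrapT => h; apply: nYp; apply/YE; split=> // f Sf.
apply: contrapT => /eqP fp; apply: h; exists f; split=> //; first exact: Sh.
by move=> q /YE[_]; apply.
Qed.

Lemma zclosed_zeros (S : {mpoly K[c]} -> Prop) : (forall f, S f -> exists e : nat, f \is e.-homog) ->
  zclosed d (fun p => proj_point d p /\ forall f, S f -> f.[% p] = 0).
Proof. by move=> hS; exists S; split. Qed.

Lemma zclosure_sub X : psub X (zclosure d X).
Proof. by move=> p Xp Y _; apply. Qed.

Lemma zclosure_min X Y : zclosed d Y -> psub X Y -> psub (zclosure d X) Y.
Proof. by move=> cY XY p; apply. Qed.

Lemma zclosureP X p : psub X (proj_point d) ->
  zclosure d X p <-> proj_point d p /\
    forall f, (exists e : nat, f \is e.-homog) -> vanishes f X -> f.[% p] = 0.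
Proof.
move=> Xp; split.
  move=> /(_ (fun p => proj_point d p /\ forall f, (exists e : nat, f \is e.-homog) /\ vanishes f X -> f.[% p] = 0)).
  case=> [||pp h]; first by apply: zclosed_zeros => f [].
    by move=> q Xq; split; [exact: Xp|move=> f [_]; apply].
  by split=> // f fe fX; apply: h.
move=> [pp h] Y cY XY; apply: contrapT => nYp.
have [f [fe fY]] := zclosed_separate cY pp nYp; rewrite h ?eqxx // => q /XY; exact: fY.
Qed.

Lemma zclosed_zclosure X : psub X (proj_point d) -> zclosed d (zclosure d X).
Proof.
move=> Xp; exists (fun f => (exists e : nat, f \is e.-homog) /\ vanishes f X); split; first by move=> f [].
move=> p; rewrite (zclosureP _ Xp); split=> -[pp h]; split=> // f; first by move=> []; apply: h.
by move=> fe fX; apply: h.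
Qed.

Lemma vanishes_pihomog f X e : conic X -> vanishes f X -> vanishes (pihomog mdeg e f) X.
Proof.
move=> cX fX p Xp; apply: pihomog_cone => t t0; rewrite -coefsZ; apply: fX; exact: cX.
Qed.

(** [zclosure] tests homogeneous equations only; on a conic set each homogeneous part of an equation
    is itself an equation. *)
Lemma vanishes_zclosure f X : psub X (proj_point d) -> conic X ->
  vanishes f X -> vanishes f (zclosure d X).
Proof.
move=> Xp cX fX p /(zclosureP _ Xp)[_ h].
rewrite {1}(pihomog_partition f) raddf_sum /= big1 // => e _; apply: h.
  by exists e; apply: pihomogP.
exact: vanishes_pihomog.
Qed.

Lemma irreducible_zclosure X : psub X (proj_point d) -> irreducible d X -> irreducible d (zclosure d X).
Proof.
move=> Xp [[p Xp'] irr]; split; first by exists p; apply: zclosure_sub.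
move=> Y1 Y2 cY1 cY2 sub; case: (irr Y1 Y2 cY1 cY2) => [q /zclosure_sub/sub //|h|h].
  by left; apply: zclosure_min.
by right; apply: zclosure_min.
Qed.

(** [f] may be inhomogeneous, so its zero set is replaced with the closed set [Y2] cut out by all
    its homogeneous parts. *)
Lemma irreducible_prime Y g f e : psub Y (proj_point d) -> conic Y -> irreducible d Y ->
  g \is e.-homog -> vanishes (g * f) Y -> vanishes g Y \/ vanishes f Y.
Proof.
move=> Yp cY [_ irr] ge gf.
pose Y1 p := proj_point d p /\ forall g', g' = g -> g'.[% p] = 0.
pose Y2 p := proj_point d p /\ forall f', (exists k, f' = pihomog mdeg k f) -> f'.[% p] = 0.
case: (irr Y1 Y2).
- by apply: zclosed_zeros => _ ->; exists e.
- by apply: zclosed_zeros => _ [k ->]; exists k; apply: pihomogP.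
- move=> p Yp'; have pp := Yp _ Yp'.
  have [gp|gp] := eqVneq g.[% p] 0; first by left; split=> // _ ->.
  right; split=> // _ [k ->]; apply: pihomog_cone => t t0; rewrite -coefsZ.
  have := gf _ (cY _ _ t0 Yp'); rewrite mevalM (coefsZ_homog _ _ ge) => /eqP.
  by rewrite !mulf_eq0 (negPf gp) expf_eq0 (negPf t0) andbF => /eqP.
- by move=> h; left=> p /h[_]; apply.
- move=> h; right=> p /h[_ {}h]; rewrite {1}(pihomog_partition f) raddf_sum /= big1 // => k _.
  by apply: h; exists k.
Qed.

(* Cancel the largest possible power of the variable that stands for g, then put g = 0. *)
Lemma cut_dependence m (C Z : {mpoly K[N]} -> Prop) (F : 'I_m -> {mpoly K[c]})
    g e (G : {mpoly K[m.+1]}) :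
  psub C (proj_point d) -> conic C -> irreducible d C -> psub Z C ->
  g \is e.-homog -> ~ vanishes g C -> vanishes g Z -> G != 0 ->
  (forall p, C p ->
     G.@[fun i => (if unlift ord_max i is Some j then F j else g).[% p]] = 0) ->
  exists2 G' : {mpoly K[m]}, G' != 0 & forall p, Z p -> G'.@[fun i => (F i).[% p]] = 0.
Proof.
move=> Cp cC iC ZC ge ngC gZ G0 GC.
have [j qj minj] : exists2 j, (muni G)`_j != 0 & forall i, (i < j)%N -> (muni G)`_i = 0.
  have ex : exists j, (muni G)`_j != 0.
    exists (mlead G ord_max); apply/negP => /eqP e0.
    by have := mcoeff_muni G (mlead G); rewrite e0 mcoeff0 => /esym/eqP; rewrite mleadc_eq0 (negPf G0).
  case: (ex_minnP ex) => j hj mj; exists j => // i ij; apply/eqP/negPn/negP => /mj.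
  by rewrite leqNgt ij.
set q := muni G in qj minj.
exists q`_j => //.
(* [f] is the substituted [G] divided by g^j; where g = 0 only its term i = 0 remains. *)
pose f := \sum_(i < size q) (q`_(i + j) \mPo [tuple F i | i < m]) * g ^+ i.
have fE p : f.[% p] = \sum_(i < size q) (q`_(i + j)).@[fun i => (F i).[% p]] * g.[% p] ^+ i.
  rewrite raddf_sum /=; apply: eq_bigr => i _; rewrite mevalM rmorphXn /= comp_mpoly_meval.
  by congr (_ * _); apply: meval_eq => i'; rewrite tnth_mktuple.
have gf : vanishes (g ^+ j * f) C.
  move=> p Cp'; rewrite -[RHS](GC p Cp') [RHS]meval_muni unlift_none mevalM rmorphXn /= fE.
  have -> : map_poly (meval (fun i => (if unlift ord_max (widen_ord (leqnSn m) i) is Some j0 then F j0 else g).[% p])) q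
     = map_poly (meval (fun i => (F i).[% p])) q.
    apply/polyP => k; rewrite !coef_map /=; apply: meval_eq => i.
    by rewrite (_ : widen_ord _ i = lift ord_max i) ?liftK //; apply: val_inj; rewrite /= /bump leqNgt ltn_ord.
  have sz : (size (map_poly (meval (fun i => (F i).[% p])) q) <= j + size q)%N.
    by rewrite (leq_trans (size_poly _ _)) // leq_addl.
  rewrite (horner_coef_wide _ sz) big_split_ord /= [X in _ = X + _]big1 ?add0r => [|i _].
    rewrite mulr_sumr; apply: eq_bigr => i _; rewrite coef_map /= exprD addnC.
    by rewrite mulrCA.
  by rewrite coef_map /= minj ?ltn_ord // meval0 mul0r.
have gjh : g ^+ j \is (e * j).-homog by apply: dhomogMn.
case: (irreducible_prime Cp cC iC gjh gf) => [gj|fC p Zp].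
  case: ngC => p /gj; rewrite rmorphXn /= => /eqP; rewrite expf_eq0 => /andP[_ /eqP] //.
have := fC p (ZC p Zp); rewrite fE gZ // => <-.
have sq : (0 < size q)%N by case: (size q) (leq_sizeP q 0) qj => // h; rewrite (elimT h) ?eqxx.
rewrite (bigD1 (Ordinal sq)) //= add0n expr0 mulr1 big1 ?addr0 // => i ne.
by rewrite expr0n; case: eqP => [i0|_]; rewrite ?mulr0 //; case/eqP: ne; apply: val_inj.
Qed.

(** Append to [F] an equation of Z that fails on C1, and one of C1 that fails on C2. The k + 2
    polynomials are dependent on C2; cutting twice gives a relation among the [F i] on Z. *)
Lemma no_long_chain k X Z C1 C2 (F : 'I_k -> {mpoly K[c]}) :
  (forall G : {mpoly K[k]}, (forall p, Z p -> G.@[fun i => (F i).[% p]] = 0) -> G = 0) ->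
  (forall H : 'I_k.+2 -> {mpoly K[c]}, exists2 G : {mpoly K[k.+2]}, G != 0 &
     forall p, X p -> G.@[fun i => (H i).[% p]] = 0) ->
  zclosed d Z -> zclosed d C1 -> irreducible d C1 -> zclosed d C2 -> irreducible d C2 ->
  psub Z C1 -> ~ psub C1 Z -> psub C1 C2 -> ~ psub C2 C1 -> ~ psub C2 X.
Proof.
move=> indep dep cZ cC1 iC1 cC2 iC2 ZC1 nC1Z C12 nC21 C2X.
have sep Y Y' : zclosed d Y -> zclosed d Y' -> ~ psub Y Y' ->
    exists f e, [/\ f \is e.-homog, vanishes f Y' & ~ vanishes f Y].
  move=> cY cY' /existsNP[p /not_implyP[Yp nYp]].
  have [f [[e fe] fY' fp]] := zclosed_separate cY' (zclosed_proj cY Yp) nYp.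
  by exists f, e; split=> // /(_ p Yp)/eqP; rewrite (negPf fp).
have [g1 [e1 [g1e g1Z g1C]]] := sep _ _ cC1 cZ nC1Z.
have [g2 [e2 [g2e g2C g2C']]] := sep _ _ cC2 cC1 nC21.
pose F1 (i : 'I_k.+1) := if unlift ord_max i is Some j then F j else g1.
pose F2 (i : 'I_k.+2) := if unlift ord_max i is Some j then F1 j else g2.
have [G2 G20 G2X] := dep F2.
have [|G1 G10 G1C] := cut_dependence (zclosed_proj cC2) (zclosed_conic cC2) iC2 C12 g2e g2C' g2C G20 (F := F1).
  by move=> p /C2X; apply: G2X.
have [|G G0 GZ] := cut_dependence (zclosed_proj cC1) (zclosed_conic cC1) iC1 ZC1 g1e g1C g1Z G10 (F := F).
  by move=> p /G1C.
by move: G0; rewrite (indep G GZ) eqxx.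
Qed.

(** * Images of polynomial maps; in the application [phi] is the orbit map and [delta] the
    determinant of the matrix *)

Section Parametrized.
Variables (s : nat) (phi : ('I_s -> K) -> {mpoly K[N]}) (delta : ('I_s -> K) -> K).
Hypotheses (hphi : polyfam phi) (hdelta : polyfun delta).
Hypothesis phi_proj : forall v, delta v != 0 -> proj_point d (phi v).
Hypothesis phi_homog : forall v, phi v \is d.-homog.
Hypothesis delta0 : exists v, delta v != 0.

Definition param_set p := exists2 v, delta v != 0 & p = phi v.
Hypothesis param_conic : conic param_set.

Lemma param_set_proj : psub param_set (proj_point d).
Proof. by move=> _ [v dv ->]; apply: phi_proj. Qed.

Lemma polyfun_phi f : polyfun (fun v => f.[% phi v]).
Proof. by apply: polyfun_meval => i; apply: hphi. Qed.

Lemma polyfun_common (f g : ('I_s -> K) -> K) : polyfun f -> polyfun g ->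
  (exists v, f v != 0) -> (exists v, g v != 0) -> exists v, f v != 0 /\ g v != 0.
Proof.
move=> [F hF] [G hG] [v fv] [w gw].
have F0 : F != 0 by apply: contraNneq fv => F0; rewrite hF F0 meval0.
have G0 : G != 0 by apply: contraNneq gw => G0; rewrite hG G0 meval0.
have [u] := mpoly_neq0_value (mulf_neq0 F0 G0).
by rewrite mevalM mulf_eq0 negb_or -hF -hG => /andP[]; exists u.
Qed.

(** Two equations that fail somewhere on the image, together with [delta], are nonzero polynomials
    in the parameters, hence nonzero at a common point. *)
Lemma param_set_irreducible : irreducible d param_set.
Proof.
split; first by have [v dv] := delta0; exists (phi v), v.
move=> Y1 Y2 cY1 cY2 sub; apply: contrapT => /not_orP[n1 n2].
have key Y : zclosed d Y -> ~ psub param_set Y -> exists f,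
    vanishes f Y /\ exists v, f.[% phi v] != 0.
  move=> cY /existsNP[p /not_implyP[Op nYp]].
  have [f [_ fY fp]] := zclosed_separate cY (param_set_proj Op) nYp.
  by exists f; split=> //; case: Op fp => v _ -> fp; exists v.
have [f1 [f1Y e1]] := key _ cY1 n1; have [f2 [f2Y e2]] := key _ cY2 n2.
have [v1 [a1 b1]] := polyfun_common (polyfun_phi f1) (polyfun_phi f2) e1 e2.
have [|v []] := polyfun_common (polyfunM (polyfun_phi f1) (polyfun_phi f2)) hdelta _ delta0.
  by exists v1; rewrite mulf_neq0.
rewrite mulf_eq0 negb_or => /andP[fv1 fv2] dv.
have : param_set (phi v) by exists v.
by case/sub => [/f1Y|/f2Y] /eqP; apply/negP.
Qed.

(* Chevalley: the points of the closure outside the zero set of f lift to parameters. *)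
Lemma param_set_open : exists f, [/\ exists e : nat, f \is e.-homog,
   exists v, delta v != 0 /\ f.[% phi v] != 0
 & forall q, zclosure d param_set q -> f.[% q] != 0 -> param_set q].
Proof.
have [Del DelE] := hdelta.
have [Phi PhiE] : exists Phi : 'I_c -> {mpoly K[s]}, forall i v, co (phi v) i = (Phi i).@[v].
  have /fin_all_exists[Phi h] : forall i : 'I_c, exists P : {mpoly K[s]}, forall v, co (phi v) i = P.@[v].
    by move=> i; apply: hphi.
  by exists Phi.
pose tPhi := [tuple Phi i | i < c].
have compE f v : (f \mPo tPhi).@[v] = f.[% phi v].
  by rewrite comp_mpoly_meval; apply: meval_eq => i; rewrite tnth_mktuple PhiE.
(* The ring generated by the coefficients of [phi], that is, the coordinate ring of the cone over
   the closure. *)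
pose A (y : {mpoly K[s]}) := exists f, y = f \mPo tPhi.
have sA : subring A.
  split; first by exists 1; rewrite comp_mpoly1.
    by move=> _ _ [f ->] [g ->]; exists (f - g); rewrite raddfB.
  by move=> _ _ [f ->] [g ->]; exists (f * g); rewrite rmorphM.
pose xs := [seq ('X_i : {mpoly K[s]}) | i : 'I_s].
have sD := adjoins_subring xs sA.
have AC t : A t%:MP by exists t%:MP; rewrite comp_mpolyC.
have full y : adjoins A xs y.
  rewrite (mpolyE y); elim/big_rec: _ => [|m y' _ Hy]; first exact: subring0.
  apply: (subringD sD) => //; rewrite -mul_mpolyC; apply: (subringM sD).
    by apply: adjoins_sub.
  rewrite mpolyXE_id; elim/big_rec: _ => [|i y'' _ Hy']; first exact: subring1.
  apply: (subringM sD) => //; apply: (subringX sD); apply: adjoins_gen => //.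
  by apply/imageP; exists i.
have Del0 : Del != 0 by have [v] := delta0; rewrite DelE; apply: contraNneq => ->; rewrite meval0.
(* A homomorphism on [A] that does not kill [a] extends to the whole ring of parameters without
   killing [Del]. *)
have [a [[f0 af0] a0 ext]] := extension_theorem K sA (full Del) Del0.
have lift q : zclosure d param_set q -> f0.[% q] != 0 -> param_set q.
  move=> cq f0q; have [[q0 hq] _] := (zclosureP q param_set_proj).1 cq.
  (* Evaluation at q descends to [A]: if f and g agree after substitution, f - g vanishes on the
     image and so at q. *)
  have wd f g : f \mPo tPhi = g \mPo tPhi -> f.[% q] = g.[% q].
    move=> e; apply/eqP; rewrite -subr_eq0 -mevalB; apply/eqP.
    apply: (vanishes_zclosure param_set_proj param_conic _ cq) => _ [v dv ->].
    by rewrite mevalB -!compE e subrr.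
  pose rep y := if pselect (A y) is left e then projT1 (cid e) else 0.
  pose h y := (rep y).[% q].
  have hE f : h (f \mPo tPhi) = f.[% q].
    apply: wd; rewrite /rep; case: pselect => [e|[]]; last by exists f.
    by rewrite -(projT2 (cid e)).
  have hh : hom_on A h.
    split; first by rewrite -(comp_mpoly1 tPhi) hE meval1.
      by move=> _ _ [f ->] [g ->]; rewrite -raddfB !hE mevalB.
    by move=> _ _ [f ->] [g ->]; rewrite -rmorphM !hE mevalM.
  have [|h' [hh' h'E h'D]] := ext h hh; first by rewrite af0 hE.
  (* The images of the variables are the parameters of q. *)
  pose v i := h' 'X_i.
  have h'v y : h' y = y.@[v].
    rewrite {1}(mpolyE y) mevalE.
    have : adjoins A xs (\sum_(m <- msupp y) y@_m *: 'X_[m]) by apply: full.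
    elim: (msupp y) => [|m r IH] _; first by rewrite !big_nil (hom0 sD hh').
    rewrite !big_cons (homD sD hh') ?IH; [|exact: full..].
    rewrite -mul_mpolyC (homM hh'); [|exact: full..].
    rewrite h'E // -(comp_mpolyC _ tPhi) hE mevalC; congr (_ * _ + _).
    rewrite mpolyXE_id; elim: (index_enum _) => [|i r' IH']; first by rewrite !big_nil; case: hh'.
    by rewrite !big_cons (homM hh') ?IH' ?(homX sD hh'); try exact: full.
  exists v; first by rewrite DelE -h'v.
  apply/mpolyP => m; have [md|md] := eqVneq (mdeg m) d; last first.
    by rewrite (dhomog_nemf_coeff hq md) (dhomog_nemf_coeff (phi_homog v) md).
  have lt : (mdeg m < d.+1)%N by rewrite md.
  have := PhiE (enum_rank (BMultinom lt)) v; rewrite /coefs enum_rankK /= => ->.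
  rewrite -h'v h'E; last by exists 'X_(enum_rank (BMultinom lt)); rewrite comp_mpolyXU -tnth_nth tnth_mktuple.
  have -> : Phi (enum_rank (BMultinom lt)) = 'X_(enum_rank (BMultinom lt)) \mPo tPhi.
    by rewrite comp_mpolyXU -tnth_nth tnth_mktuple.
  by rewrite hE mevalXU /coefs enum_rankK.
(* The test polynomial has to be homogeneous, so [f0] is replaced with a homogeneous part that does
   not vanish identically on the image. *)
have [e he] : exists e, pihomog mdeg e f0 \mPo tPhi != 0.
  apply: contrapT => /forallNP h; move: a0; rewrite af0 (pihomog_partition f0) raddf_sum /= big1 ?eqxx // => e _.
  by apply/eqP/negPn/negP; apply: h.
exists (pihomog mdeg e f0); split; first by exists e; apply: pihomogP.
  have [v] := mpoly_neq0_value (mulf_neq0 Del0 he).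
  by rewrite mevalM mulf_eq0 negb_or -DelE compE => /andP[]; exists v.
(* If one homogeneous part is nonzero at q, then [f0] itself is nonzero at some multiple of q;
   rescale at the end. *)
move=> q cq fq; have [t [t0 ft]] : exists t, t != 0 /\ f0.[% t *: q] != 0.
  apply: contrapT => /forallNP h; case/eqP: fq; apply: pihomog_cone => t t0.
  by rewrite -coefsZ; apply: contrapT => /eqP hf; apply: (h t).
have cc := zclosed_conic (zclosed_zclosure param_set_proj).
have /lift/(_ ft) := cc _ _ t0 cq.
by move/(param_conic (invr_neq0 t0)); rewrite scalerK.
Qed.

End Parametrized.

(** Along the curve, [f] is a polynomial in t that vanishes off 0, hence also at t = 0, where the
    curve passes through [Q 0]. *)
Lemma limit_zero m (Q : nat -> {mpoly K[N]}) f :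
  (forall t, t != 0 -> f.[% \sum_(k < m.+1) t ^+ k *: Q k] = 0) -> f.[% Q 0%N] = 0.
Proof.
move=> h; pose g i : {poly K} := \sum_(k < m.+1) (co (Q k) i)%:P * 'X^k.
have gE i t : (g i).[t] = co (\sum_(k < m.+1) t ^+ k *: Q k) i.
  rewrite horner_sum /coefs raddf_sum; apply: eq_bigr => k _ /=.
  by rewrite hornerM hornerC hornerXn mcoeffZ mulrC.
have := @poly_eq0_off0 K (mmap polyC g f).
have -> : f.[% Q 0%N] = (mmap polyC g f).[0].
  rewrite horner_mmap; apply: meval_eq => i; rewrite gE /coefs raddf_sum big_ord_recl /=.
  rewrite expr0 scale1r big1 ?addr0 // => k _; by rewrite exprS mul0r scale0r mcoeff0.
move=> -> => [|t t0]; first by rewrite horner0.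
by rewrite horner_mmap -[RHS](h t t0); apply: meval_eq => i; rewrite gE.
Qed.

(** Moves equations along the linear action on forms. The coefficients of [T p] are linear in those
    of p, and homogeneity ensures that [coefs] sees all of p. *)
Lemma pullback_linear (T : {mpoly K[N]} -> {mpoly K[N]}) f :
  (forall p q, T (p + q) = T p + T q) -> (forall t p, T (t *: p) = t *: T p) ->
  exists g, forall p, p \is d.-homog -> g.[% p] = f.[% T p].
Proof.
move=> TD TZ; have T0 : T 0 = 0 by have := TZ 0 0; rewrite !scale0r.
exists (f \mPo [tuple \sum_(j < c) (co (T 'X_[enum_val j]) i) *: 'X_j | i < c]) => p hp.
rewrite comp_mpoly_meval; apply: meval_eq => i; rewrite tnth_mktuple raddf_sum /=.
have sz : (msize p <= d.+1)%N.
  rewrite leqNgt; apply/negP => lt; have p0 : p != 0 by apply: contraTneq lt => ->; rewrite mmeasure0.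
  have := mlead_deg p0; have -> : mdeg (mlead p) = d.
    by have /dhomogP := hp; apply; exact: mlead_supp.
  by move=> e; rewrite -e ltnn in lt.
rewrite {2}(mpolywE sz).
have -> (r : seq 'X_{1..N < d.+1}) : T (\sum_(m <- r) p@_m *: 'X_[m]) = \sum_(m <- r) p@_m *: T 'X_[m].
  by elim: r => [|m r IH]; rewrite ?big_nil // !big_cons TD TZ IH.
rewrite /coefs raddf_sum /= [RHS](reindex (@enum_val _ (mem {: 'X_{1..N < d.+1}}))) /=; last exact/onW_bij/enum_val_bij.
by apply: eq_bigr => j _; rewrite mevalZ mevalXU mcoeffZ mulrC.
Qed.

End Zariski.

(** * Determinant pencils and the tangent map *)

Section DetDerivative.
Variables (R : comNzRingType) (n : nat).
Implicit Types A B S : 'M[R]_n.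

Definition replace_row A S i := \matrix_(k, j) (if k == i then S k j else A k j).

Lemma det_replace_row A S i : \det (replace_row A S i) = \sum_j S i j * cofactor A i j.
Proof.
rewrite (expand_det_row _ i); apply: eq_bigr => j _; rewrite mxE eqxx; congr (_ * _).
rewrite /cofactor; congr (_ * \det _); apply/matrixP => k l; rewrite !mxE.
by rewrite eq_sym (negPf (neq_lift _ _)).
Qed.

Lemma sum_det_replace_row A S : \sum_i \det (replace_row A S i) = \tr (\adj A *m S).
Proof.
under eq_bigr do rewrite det_replace_row.
rewrite exchange_big; apply: eq_bigr => j _ /=; rewrite mxE; apply: eq_bigr => i _.
by rewrite mxE mulrC.
Qed.

Lemma coef1_prod (I : eqType) (r : seq I) (F : I -> {poly R}) : uniq r ->
  (\prod_(i <- r) F i)`_1 = \sum_(i <- r) (F i)`_1 * \prod_(j <- r | j != i) (F j)`_0.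
Proof.
elim: r => [|x r IH]; first by rewrite !big_nil coef1.
rewrite /= => /andP[xr ur]; rewrite !big_cons eqxx coefM !big_ord_recl big_ord0 addr0 /=.
rewrite IH // coef0_prod addrC; congr (_ + _).
  congr (_ * _); rewrite big_seq [RHS]big_seq_cond; apply: eq_bigl => j.
  by case: eqVneq => [->|]; rewrite ?(negPf xr) ?andbT.
rewrite mulr_sumr; apply: eq_big_seq => i ir; rewrite big_cons.
by have -> : x != i by [apply: contraNneq xr => ->]; rewrite mulrCA.
Qed.

Definition lin_mx_poly A B : 'M[{poly R}]_n := map_mx polyC A + 'X *: map_mx polyC B.

Lemma lin_mx_polyE A B i j : lin_mx_poly A B i j = (A i j)%:P + 'X * (B i j)%:P.
Proof. by rewrite !mxE. Qed.

Lemma lin_mx_poly_horner A B t : map_mx (horner_eval t) (lin_mx_poly A B) = A + t *: B.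
Proof.
apply/matrixP => i j; rewrite mxE lin_mx_polyE !mxE /horner_eval.
by rewrite hornerD hornerM hornerX !hornerC.
Qed.

Lemma det_lin_coef0 A S : (\det (lin_mx_poly A S))`_0 = \det A.
Proof.
rewrite -horner_coef0 -[_.[0]]/(horner_eval 0 _) -det_map_mx lin_mx_poly_horner.
by rewrite scale0r addr0.
Qed.

Lemma det_lin_coef1 A S : (\det (lin_mx_poly A S))`_1 = \tr (\adj A *m S).
Proof.
rewrite -sum_det_replace_row exchange_big /= coef_sum; apply: eq_bigr => s _.
rewrite -mulr_sumr -(rmorph_sign polyC) coefCM; congr (_ * _).
rewrite coef1_prod ?index_enum_uniq //; apply: eq_bigr => i _.
rewrite [RHS](bigD1 i) //= [in RHS]mxE eqxx lin_mx_polyE coefD coefC coefXM coefC add0r; congr (_ * _).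
apply: eq_bigr => j ji; rewrite [in RHS]mxE (negPf ji) lin_mx_polyE coefD coefXM coefC.
by rewrite addr0.
Qed.

End DetDerivative.

Section PLambdaFormula.
Variable K : numFieldType.

Lemma PLambda_atE n (M : 'M[K]_n) : (0 < n)%N ->
  PLambda_at M = n%:R^-1 * \tr (\adj (skew_part M) *m sym_part M).
Proof.
case: n M => // m M _; set A := skew_part M; set S := sym_part M.
rewrite /PLambda_at /polar_det -sum_det_replace_row.
pose D i := \det (replace_row A S i).
have e (s : 'S_m.+1) : \det (\matrix_(i, j) (if (s i < m.+1.-1)%N then A else S) i j)
    = D ((s^-1)%g ord_max).
  congr (\det _); apply/matrixP => i j; rewrite [LHS]mxE [RHS]mxE.
  have -> : (s i < m)%N = (i != (s^-1)%g ord_max).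
    rewrite -(inj_eq (@perm_inj _ s)) permKV -val_eqE /= ltn_neqAle -ltnS ltn_ord andbT //.
  by case: (i == _).
under eq_bigr do rewrite e.
(* The sum does not depend on which argument j holds S, as a transposition shows; averaging over j
   replaces counting the permutations that send S to a given row. *)
have e2 (j : 'I_m.+1) : \sum_(s : 'S_m.+1) D ((s^-1)%g j) = \sum_(s : 'S_m.+1) D ((s^-1)%g ord_max).
  rewrite (reindex_inj (mulIg (tperm ord_max j))) /=; apply: eq_bigr => s _.
  by rewrite invMg permM tpermV tpermR.
have f0 k : (0 < k)%N -> (k%:R : K) != 0 by rewrite pnatr_eq0 lt0n.
apply: (mulfI (f0 m.+1 isT)); rewrite mulVKf ?f0 // mulrCA.
have -> : m.+1%:R * \sum_(s : 'S_m.+1) D ((s^-1)%g ord_max) = \sum_(j < m.+1) \sum_(s : 'S_m.+1) D ((s^-1)%g j).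
  by under [RHS]eq_bigr do rewrite e2; rewrite sumr_const card_ord mulr_natl.
rewrite exchange_big /=.
have e3 (s : 'S_m.+1) : \sum_(j < m.+1) D ((s^-1)%g j) = \sum_i D i.
  by rewrite [RHS](reindex_inj (@perm_inj _ (s^-1)%g)).
under eq_bigr do rewrite e3.
by rewrite sumr_const card_Sn -[X in _ * X]mulr_natl mulKf ?f0 ?fact_gt0.
Qed.

End PLambdaFormula.

Section Taylor.
Variables (K : fieldType) (N : nat) (l : 'I_N -> {mpoly K[N]}).
Implicit Types P Q : {mpoly K[N]}.

Definition dir_deriv P : {mpoly K[N]} := \sum_k P^`M(k) * l k.

Lemma dir_derivM P Q : dir_deriv (P * Q) = dir_deriv P * Q + P * dir_deriv Q.
Proof.
rewrite /dir_deriv mulr_suml mulr_sumr -big_split /=; apply: eq_bigr => k _.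
by rewrite mderivM mulrDl -!mulrA [Q * _]mulrC.
Qed.

Lemma dir_derivD P Q : dir_deriv (P + Q) = dir_deriv P + dir_deriv Q.
Proof. by rewrite /dir_deriv -big_split /=; apply: eq_bigr => k _; rewrite mderivD mulrDl. Qed.

(** Only the polynomiality of the remainder in t matters. The property [T] passes to sums and
    products, so it is checked on constants and variables. *)
Lemma taylor1 P : exists R : {poly {mpoly K[N]}}, forall t,
  P \mPo [tuple 'X_k + t *: l k | k < N] = P + t *: dir_deriv P + t ^+ 2 *: R.[t%:MP].
Proof.
pose T P := exists R : {poly {mpoly K[N]}}, forall t,
  P \mPo [tuple 'X_k + t *: l k | k < N] = P + t *: dir_deriv P + t ^+ 2 *: R.[t%:MP].
have TD P1 P2 : T P1 -> T P2 -> T (P1 + P2).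
  move=> [R1 h1] [R2 h2]; exists (R1 + R2) => t.
  by rewrite raddfD /= h1 h2 dir_derivD hornerD -!mul_mpolyC; ring.
have TM P1 P2 : T P1 -> T P2 -> T (P1 * P2).
  move=> [R1 h1] [R2 h2].
  exists (dir_deriv P1 *: (dir_deriv P2)%:P + P1 *: R2 + P2 *: R1
     + 'X * (dir_deriv P1 *: R2 + dir_deriv P2 *: R1) + 'X^2 * (R1 * R2)) => t.
  rewrite rmorphM /= h1 h2 dir_derivM.
  rewrite !(hornerE, hornerXn) -!mul_mpolyC rmorphXn /=.
  ring.
have TC c : T c%:MP.
  exists 0 => t; rewrite comp_mpolyC horner0 scaler0 addr0 /dir_deriv big1 ?scaler0 ?addr0 // => k _.
  by rewrite mderivC mul0r.
have TX k : T 'X_k.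
  exists 0 => t; rewrite comp_mpolyXU -tnth_nth tnth_mktuple horner0 scaler0 addr0.
  congr (_ + _ *: _); rewrite /dir_deriv (bigD1 k) //= big1 ?addr0 => [|j jk].
    rewrite mderivX mnm1E eqxx scale1r; have -> : (U_(k) - U_(k) = 0 :> 'X_{1..N})%MM.
      by apply/mnmP => i; rewrite mnmBE subnn mnm0E.
    by rewrite mpolyX0 mul1r.
  by rewrite mderivX mnm1E eq_sym (negPf jk) scale0r mul0r.
change (T P); elim/mpolyind: P => [|c m P _ _ TP]; first by rewrite -mpolyC0.
apply: (TD) => //; rewrite -mul_mpolyC; apply: (TM) => //.
rewrite mpolyXE_id; elim/big_rec: _ => [|k Q _ TQ]; first by rewrite -mpolyC1.
apply: (TM) => //; elim: (m k) => [|j IH]; first by rewrite expr0 -mpolyC1.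
by rewrite exprS; apply: (TM).
Qed.

End Taylor.

(** * Skew-symmetric matrices of odd size *)

(** Both sides are the coefficient of t in det(g (A + t S) g^T), which also covers singular [g]. *)
Lemma tr_adj_conj (R : comNzRingType) n (g A S : 'M[R]_n) :
  \tr (\adj (g *m A *m g^T) *m (g *m S *m g^T)) = \det g ^+ 2 * \tr (\adj A *m S).
Proof.
rewrite -!det_lin_coef1.
have -> : lin_mx_poly (g *m A *m g^T) (g *m S *m g^T)
    = map_mx polyC g *m lin_mx_poly A S *m (map_mx polyC g)^T.
  by rewrite /lin_mx_poly !map_mxM -map_trmx mulmxDr mulmxDl -scalemxAr -scalemxAl.
by rewrite !det_mulmx det_tr det_map_mx mulrAC -rmorphM coefCM expr2.
Qed.

Lemma det_skew_odd (R : idomainType) n (A : 'M[R]_n) :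
  (2%:R : R) != 0 -> odd n -> A^T = - A -> \det A = 0.
Proof.
move=> two on sA; have := det_tr A; rewrite sA -scaleN1r detZ -signr_odd on mulN1r => e.
have : 2%:R * \det A = 0 by rewrite mulr_natl mulr2n -{1}e addNr.
by move/eqP; rewrite mulf_eq0 (negPf two) => /eqP.
Qed.

Section SkewForm.
Variables (K : numFieldType) (m : nat).
Local Notation n := m.+1.
Implicit Types (A B S g h : 'M[K]_n).

Definition skew A := A^T = - A.
Definition symm A := A^T = A.
Local Notation E := (@delta_mx K n n).
Local Notation e0 := (delta_mx ord0 ord0 : 'cV[K]_n).

(* Such a J has kernel spanned by e0 and adjugate a multiple of E ord0 ord0. *)
Definition std_skew (J : 'M[K]_n) := skew J /\ J *m J = E ord0 ord0 - 1%:M.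

End SkewForm.

Lemma std_skew_exists (K : numFieldType) m : ~~ odd m -> exists J : 'M[K]_m.+1, std_skew J.
Proof.
move=> em; have [k ->] : exists k, m = (k + k)%N by exists m./2; rewrite addnn even_halfK.
pose J' : 'M[K]_(k + k) := block_mx 0 1%:M (- 1%:M) 0.
pose J : 'M[K]_(1 + (k + k)) := block_mx 0 0 0 J'.
have sJ' : J'^T = - J' by rewrite tr_block_mx opp_block_mx !(trmx0, trmx1, linearN) /= !trmx1 oppr0 opprK.
have JJ' : J' *m J' = - 1%:M.
  rewrite mulmx_block !(mul0mx, mulmx0, addr0, add0r, mulmx1, mul1mx).
  by rewrite [in RHS]scalar_mx_block opp_block_mx oppr0.
have sJ : J^T = - J by rewrite tr_block_mx opp_block_mx !trmx0 sJ' !oppr0.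
have JJ : J *m J = block_mx 0 0 0 (- 1%:M).
  by rewrite mulmx_block !(mul0mx, mulmx0, addr0, add0r) JJ'.
exists J; split=> //; rewrite JJ.
apply/matrixP => i j; rewrite -(@splitK 1 (k + k) i) -(@splitK 1 (k + k) j).
case: (@split 1 (k + k) i) => i'; case: (@split 1 (k + k) j) => j'; rewrite /= ?block_mxEul ?block_mxEur ?block_mxEdl ?block_mxEdr !mxE -!val_eqE /= ?ord1 //=.
- by rewrite subrr (@unsplitK 1 (k + k) (inl 0)) mxE (@unsplitK 1 (k + k) (inl 0)) mxE.
- by rewrite subr0 (@unsplitK 1 (k + k) (inl 0)) mxE (@unsplitK 1 (k + k) (inr j')) mxE.
- by rewrite subr0 (@unsplitK 1 (k + k) (inr i')) mxE (@unsplitK 1 (k + k) (inl 0)) mxE.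
- by rewrite sub0r (@unsplitK 1 (k + k) (inr i')) mxE (@unsplitK 1 (k + k) (inr j')) !mxE eqSS.
Qed.

Section StandardSkew.
Variables (K : numFieldType) (m : nat) (J : 'M[K]_m.+1).
Hypothesis hJ : std_skew J.
Local Notation n := m.+1.
Local Notation E := (@delta_mx K n n).
Local Notation e0 := (delta_mx ord0 ord0 : 'cV[K]_n).
Implicit Types (A B C S X Y g h : 'M[K]_n) (v : 'cV[K]_n).

Lemma skew_entry A i j : skew A -> A i j = - A j i.
Proof. by move=> sA; have /matrixP/(_ j i) := sA; rewrite !mxE. Qed.

Lemma skew_diag A i : skew A -> A i i = 0.
Proof.
move=> sA; have := skew_entry i i sA => e.
have /eqP : A i i *+ 2 = 0 by rewrite mulr2n {1}e addNr.
by rewrite mulrn_eq0 => /eqP.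
Qed.

Lemma symm_entry S i j : symm S -> S i j = S j i.
Proof. by move=> sS; have /matrixP/(_ j i) := sS; rewrite mxE. Qed.

Lemma std_skew_skew : skew J. Proof. by case: hJ. Qed.
Lemma std_skew_sq : J *m J = E ord0 ord0 - 1%:M. Proof. by case: hJ. Qed.

Lemma mul_deltaE i k X a b : (E i k *m X) a b = (a == i)%:R * X k b.
Proof.
rewrite mxE (bigD1 k) //= big1 ?addr0 ?mxE ?eqxx ?andbT // => l lk.
by rewrite mxE (negPf lk) andbF mul0r.
Qed.

Lemma mul_deltarE i k X a b : (X *m E i k) a b = X a i * (b == k)%:R.
Proof.
rewrite mxE (bigD1 i) //= big1 ?addr0 ?mxE ?eqxx // => l lk.
by rewrite mxE (negPf lk) mulr0.
Qed.

(** J commutes with J^2, hence with E_00; compare column 0, where the diagonal entry of a skew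
    matrix is 0. *)
Lemma std_skew_col0 i : J i ord0 = 0.
Proof.
have e : J *m E ord0 ord0 = E ord0 ord0 *m J.
  have := mulmxA J J J; rewrite std_skew_sq mulmxBr mulmxBl mulmx1 mul1mx.
  by move/addIr.
have /matrixP/(_ i ord0) := e; rewrite mul_deltaE mul_deltarE eqxx mulr1 => ->.
by rewrite (skew_diag _ std_skew_skew) mulr0.
Qed.

Lemma std_skew_row0 i : J ord0 i = 0.
Proof. by rewrite (skew_entry _ _ std_skew_skew) std_skew_col0 oppr0. Qed.

Lemma std_skew_sqE X i j : (J *m (J *m X)) i j = ((i == ord0)%:R - 1) * X i j.
Proof.
rewrite mulmxA std_skew_sq mulmxBl mul1mx mxE [X in _ + X]mxE mul_deltaE mulrBl mul1r.
by case: eqP => [->|]; rewrite ?mul0r.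
Qed.

Definition subspace (P : 'M[K]_n -> Prop) := forall a X Y, P X -> P Y -> P (a *: X + Y).

Lemma subspace_sum (P : 'M[K]_n -> Prop) (I : finType) (F : I -> 'M[K]_n) (a : I -> K) (Q : pred I) :
  subspace P -> P 0 -> (forall i, Q i -> P (F i)) -> P (\sum_(i | Q i) a i *: F i).
Proof. by move=> sP P0 PF; elim/big_rec: _ => // i X Qi PX; apply: sP => //; apply: PF. Qed.

Lemma unit_1delta i j : 1%:M + E i j \in unitmx.
Proof.
have [->|ij] := eqVneq i j.
  suff e : (1%:M + E j j) *m (1%:M - 2^-1 *: E j j) = 1%:M by case/mulmx1_unit: e.
  rewrite mulmxDl mul1mx mulmxBr mulmx1 -scalemxAr mul_delta_mx.
  rewrite -addrA -[RHS]addr0; congr (_ + _); apply/matrixP => a b; rewrite !mxE.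
  case: (_ && _); rewrite ?mulr1 ?mulr0; last by rewrite oppr0 !addr0.
  by rewrite addrCA -opprD -mulr2n -[2^-1 *+ 2]mulr_natr mulVf ?pnatr_eq0 ?subrr.
suff e : (1%:M + E i j) *m (1%:M - E i j) = 1%:M by case/mulmx1_unit: e.
rewrite mulmxDl mul1mx mulmxBr mulmx1 mul_delta_mx_0; last by rewrite eq_sym.
by rewrite subr0 subrK.
Qed.

(** Conjugating J by 1 + E_ij and subtracting J leaves [X j] = E_ij J + J E_ji, because J_jj = 0.
    Since J^2 is -1 off index 0, summing [X j] with weights - J_kj gives E_ik - E_ki. *)
Lemma span_basic (P : 'M[K]_n -> Prop) i k : subspace P -> k != ord0 -> P J ->
  (forall j, j != ord0 -> P ((1%:M + E i j) *m J *m (1%:M + E i j)^T)) ->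
  P (E i k - E k i).
Proof.
move=> sP k0 PJ Ph.
have P0 : P 0 by have := sP (-1) _ _ PJ PJ; rewrite scaleN1r addNr.
pose X j := E i j *m J + J *m E j i.
have PX j : j != ord0 -> P (X j).
  move=> /Ph; have -> : (1%:M + E i j) *m J *m (1%:M + E i j)^T = X j + J.
    rewrite linearD /= trmx1 trmx_delta mulmxDr mulmx1 mulmxDl mul1mx mulmxDl.
    have -> : E i j *m J *m E j i = 0.
      apply/matrixP => a b; rewrite mul_deltarE mul_deltaE (skew_diag _ std_skew_skew).
      by rewrite mulr0 mul0r mxE.
    by rewrite addr0 -addrA addrC.
  by move=> PXJ; have := sP (-1) _ _ PJ PXJ; rewrite scaleN1r addrC addrK.
have -> : E i k - E k i = \sum_(j | j != ord0) (- J k j) *: X j.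
  have -> : \sum_(j | j != ord0) (- J k j) *: X j = - \sum_j J k j *: X j.
    rewrite [in RHS](bigD1 ord0) //= std_skew_col0 scale0r add0r -sumrN.
    by apply: eq_bigr => j _; rewrite scaleNr.
  have e1 : \sum_j J k j *: E i j = E i k *m J.
    apply/matrixP => a b; rewrite mul_deltaE summxE (bigD1 b) //= big1 ?addr0 => [|j jb].
      by rewrite !mxE eqxx andbT mulrC.
    by rewrite !mxE [b == j]eq_sym (negPf jb) andbF mulr0.
  have e2 : \sum_j J k j *: E j i = J^T *m E k i.
    rewrite -[RHS]trmxK trmx_mul trmxK trmx_delta -e1 linear_sum; apply: eq_bigr => j _.
    by rewrite linearZ /= trmx_delta.
  have -> : \sum_j J k j *: X j = (\sum_j J k j *: E i j) *m J + J *m (\sum_j J k j *: E j i).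
    rewrite mulmx_suml mulmx_sumr -big_split; apply: eq_bigr => j _ /=.
    by rewrite /X scalerDr -scalemxAl -scalemxAr.
  rewrite e1 e2 std_skew_skew mulNmx mulmxN opprD opprK.
  rewrite -mulmxA std_skew_sq mulmxBr mulmx1 mul_delta_mx_0 // sub0r opprK.
  rewrite mulmxA std_skew_sq mulmxBl mul1mx mul_delta_mx_0 ?sub0r //.
  by rewrite eq_sym.
exact: subspace_sum.
Qed.

Lemma skew_decomp A : skew A -> A = \sum_(p : 'I_n * 'I_n) (2^-1 * A p.1 p.2) *: (E p.1 p.2 - E p.2 p.1).
Proof.
move=> sA; have e : A = \sum_(p : 'I_n * 'I_n) A p.1 p.2 *: E p.1 p.2.
  by rewrite {1}[A]matrix_sum_delta pair_bigA.
have e' : \sum_(p : 'I_n * 'I_n) A p.1 p.2 *: E p.2 p.1 = - A.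
  rewrite -sA {2}e linear_sum; apply: eq_bigr => p _; by rewrite linearZ /= trmx_delta.
rewrite (eq_bigr (fun p : 'I_n * 'I_n => 2^-1 *: (A p.1 p.2 *: E p.1 p.2 - A p.1 p.2 *: E p.2 p.1))).
  rewrite -scaler_sumr sumrB -e e' opprK -mulr2n -scaler_nat scalerA mulVf ?scale1r //.
  by rewrite pnatr_eq0.
by move=> p _; rewrite -scalerA scalerBr.
Qed.

Lemma exists_unit_col v : v != 0 -> exists2 h, h \in unitmx & h *m e0 = v.
Proof.
move=> v0; pose U : 'rV[K]_n := delta_mx 0 ord0; pose f := e0 *m v^T.
have Uf : U *m f = v^T by rewrite /f mulmxA mul_delta_mx; apply/matrixP => i j; rewrite mxE big_ord1 !ord1 mxE eqxx mul1r.
have [|g gu e] := @complete_unitmx _ _ _ U f.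
  rewrite Uf !rank_rV; have -> : v^T != 0 by rewrite -trmx0 (inj_eq trmx_inj).
  by have -> // : U != 0; apply/eqP => /matrixP/(_ 0 ord0); rewrite !mxE !eqxx => /eqP; rewrite oner_eq0.
exists g^T; first by rewrite unitmx_tr.
by apply: trmx_inj; rewrite trmx_mul trmxK trmx_delta -e Uf.
Qed.

Lemma exists_unit_dual v : v != 0 -> exists2 g, g \in unitmx & g^T *m v = e0.
Proof.
move=> /exists_unit_col[h hu e]; exists (invmx h)^T; first by rewrite unitmx_tr unitmx_inv.
by rewrite trmxK -e mulKmx.
Qed.

Lemma subspace_conj (P : 'M[K]_n -> Prop) g : subspace P -> subspace (fun X => P (g *m X *m g^T)).
Proof. by move=> sP a X Y PX PY; rewrite mulmxDr mulmxDl -scalemxAr -scalemxAl; apply: sP. Qed.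

(** Linear statements about skew matrices that kill [v] need testing only on congruence images of J.
    After moving [v] to e0, [span_basic] applies because 1 + E_ji fixes e0 for i != 0. *)
Lemma skew_span_kernel (P : 'M[K]_n -> Prop) v : subspace P -> v != 0 ->
  (forall g, g \in unitmx -> g^T *m v = e0 -> P (g *m J *m g^T)) ->
  forall A, skew A -> A *m v = 0 -> P A.
Proof.
move=> sP v0 Pg A sA Av; have [g gu gv] := exists_unit_dual v0.
have sP' := @subspace_conj P g sP; set P' := fun X => _ in sP'.
have PJ : P' J by apply: Pg.
have P0 : P' 0 by have := sP' (-1) _ _ PJ PJ; rewrite scaleN1r addNr.
have PE i k : i != ord0 -> k != ord0 -> P' (E i k - E k i).
  move=> i0 k0; apply: span_basic => // j j0; rewrite /P'.
  set h := 1%:M + E i j; have -> : g *m (h *m J *m h^T) *m g^T = (g *m h) *m J *m (g *m h)^T.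
    by rewrite trmx_mul !mulmxA.
  apply: Pg; first by rewrite unitmx_mul gu unit_1delta.
  rewrite trmx_mul -mulmxA gv /h linearD /= trmx1 trmx_delta mulmxDl mul1mx mul_delta_mx_0 ?addr0 //.
pose A' := invmx g *m A *m (invmx g)^T.
have gA : g *m A' *m g^T = A.
  rewrite /A' !mulmxA mulmxV // mul1mx -mulmxA -trmx_mul mulmxV // trmx1 mulmx1 //.
have sA' : skew A' by rewrite /skew /A' !trmx_mul trmxK sA mulNmx mulmxN mulmxA.
have A'0 i : A' i ord0 = 0.
  have : A' *m e0 = 0.
    by rewrite -gv /A' mulmxA -[_ *m g^T]mulmxA -trmx_mul mulmxV // trmx1 mulmx1 -mulmxA Av mulmx0.
  by move/matrixP/(_ i ord0); rewrite !mxE (bigD1 ord0) //= big1 ?addr0 => [|j j0]; rewrite !mxE ?eqxx ?mulr1 // (negPf j0) mulr0.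
rewrite -gA -/(P' A') (skew_decomp sA').
rewrite (bigID (fun p : 'I_n * 'I_n => (p.1 != ord0) && (p.2 != ord0))) /= addrC.
rewrite big1 ?add0r => [|[i k] /=].
  by apply: subspace_sum => // -[i k] /andP[]; apply: PE.
rewrite negb_and !negbK => /orP[]/eqP ->; last by rewrite A'0 mulr0 scale0r.
by rewrite (skew_entry _ _ sA') A'0 oppr0 mulr0 scale0r.
Qed.

(** Now [h] itself, not its transpose, carries e0 to [v]. Every 1 + E_ij with j != 0 fixes e0, and i
    = 0 is allowed, so no skew matrix is missed. *)
Lemma skew_span_all (P : 'M[K]_n -> Prop) v : subspace P -> v != 0 ->
  (forall h, h \in unitmx -> h *m e0 = v -> P (h *m J *m h^T)) ->
  forall A, skew A -> P A.
Proof.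
move=> sP v0 Ph A sA; have [g gu gv] := exists_unit_col v0.
have sP' := @subspace_conj P g sP; set P' := fun X => _ in sP'.
have PJ : P' J by apply: Ph.
have P0 : P' 0 by have := sP' (-1) _ _ PJ PJ; rewrite scaleN1r addNr.
have PE i k : k != ord0 -> P' (E i k - E k i).
  move=> k0; apply: span_basic => // j j0; rewrite /P'.
  set h := 1%:M + E i j; have -> : g *m (h *m J *m h^T) *m g^T = (g *m h) *m J *m (g *m h)^T.
    by rewrite trmx_mul !mulmxA.
  apply: Ph; first by rewrite unitmx_mul gu unit_1delta.
  by rewrite -mulmxA /h mulmxDl mul1mx mul_delta_mx_0 ?addr0.
pose A' := invmx g *m A *m (invmx g)^T.
have gA : g *m A' *m g^T = A.
  by rewrite /A' !mulmxA mulmxV // mul1mx -mulmxA -trmx_mul mulmxV // trmx1 mulmx1.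
have sA' : skew A' by rewrite /skew /A' !trmx_mul trmxK sA mulNmx mulmxN mulmxA.
rewrite -gA -/(P' A') (skew_decomp sA'); apply: subspace_sum => // -[i k] _ /=.
have [->|k0] := eqVneq k ord0; last exact: PE.
have [->|i0] := eqVneq i ord0; first by rewrite subrr.
by have := sP' (-1) _ _ (PE ord0 i i0) P0; rewrite addr0 scaleN1r opprB.
Qed.

End StandardSkew.

(** * The annihilator of P_Lambda *)

Lemma quadratic_zero (K : numFieldType) (p2 p1 p0 : K) :
  (forall t, t ^+ 2 * p2 + t * p1 + p0 = 0) -> [/\ p2 = 0, p1 = 0 & p0 = 0].
Proof.
move=> q; have h0 : p0 = 0 by have := q 0; rewrite expr0n !mul0r !add0r.
have h1 := q 1; have h2 := q (-1).
move: h1 h2; rewrite h0 !addr0 expr1n !mul1r sqrrN expr1n mul1r mulN1r => h1 /subr0_eq h2.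
by move/eqP: h1; rewrite h2 -mulr2n mulrn_eq0 /= => /eqP ->.
Qed.

Section AdjugateCurve.
Variables (K : numFieldType) (m : nat) (J : 'M[K]_m.+1).
Hypothesis hJ : std_skew J.
Hypothesis em : ~~ odd m.
Local Notation n := m.+1.
Local Notation E := (@delta_mx K n n).
Local Notation e0 := (delta_mx ord0 ord0 : 'cV[K]_n).
Implicit Types (A B C S X Y g h : 'M[K]_n) (v : 'cV[K]_n).

Let minor0 (R : nzRingType) (A : 'M[R]_n) := row' ord0 (col' ord0 A).
Definition kap := \adj J ord0 ord0.
(** The first-order variation of [kap] when J moves in the direction [B]. *)
Definition kap1 B := (\adj (lin_mx_poly J B) ord0 ord0)`_1.

Let kapE : kap = \det (minor0 J).
Proof. by rewrite /kap mxE /cofactor addn0 expr0 mul1r. Qed.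

Let minor0_sq : minor0 J *m minor0 J = - 1%:M.
Proof.
apply/matrixP => i j; rewrite !mxE.
have /matrixP/(_ (lift ord0 i) (lift ord0 j)) := std_skew_sq hJ.
rewrite mxE big_ord_recl (std_skew_col0 hJ) mul0r add0r !mxE.
rewrite (inj_eq lift_inj) (_ : (lift ord0 i == ord0) = false) ?andFb ?sub0r; last by rewrite eq_sym (negPf (neq_lift _ _)).
by move=> <-; apply: eq_bigr => k _; rewrite !mxE.
Qed.

Lemma kap_neq0 : kap != 0.
Proof.
rewrite kapE -unitfE -[_ \is a _]/(minor0 J \in unitmx).
have : minor0 J *m (- minor0 J) = 1%:M by rewrite mulmxN minor0_sq opprK.
by case/mulmx1_unit.
Qed.

(** Since det J = 0, J and adj J annihilate each other on both sides; J^2 = E_00 - 1 then kills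
    every entry of adj J except (0, 0). *)
Lemma adj_std_skew : \adj J = kap *: E ord0 ord0.
Proof.
have dJ : \det J = 0.
  by apply: det_skew_odd; [rewrite pnatr_eq0|rewrite /= em|exact: std_skew_skew hJ].
have e1 : J *m \adj J = 0 by rewrite mul_mx_adj dJ; apply/matrixP => i j; rewrite !mxE mul0rn.
have e2 : \adj J *m J = 0 by rewrite mul_adj_mx dJ; apply/matrixP => i j; rewrite !mxE mul0rn.
have z1 i j : i != ord0 -> (\adj J) i j = 0.
  move=> i0; have := std_skew_sqE hJ (\adj J) i j.
  rewrite e1 mulmx0 (negPf i0) sub0r mulN1r => /eqP.
  by rewrite [X in X == _]mxE eq_sym oppr_eq0 => /eqP.
have z2 i j : j != ord0 -> (\adj J) i j = 0.
  move=> j0; have : \adj J *m (J *m J) = 0 by rewrite mulmxA e2 mul0mx.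
  rewrite (std_skew_sq hJ) mulmxBr mulmx1 => /matrixP/(_ i j).
  by rewrite mxE mul_deltarE (negPf j0) mulr0 add0r !mxE => /eqP; rewrite oppr_eq0 => /eqP.
apply/matrixP => i j; rewrite [RHS]mxE [E _ _ _ _]mxE.
have [->|i0] := eqVneq i ord0; last by rewrite z1 // mulr0.
have [->|j0] := eqVneq j ord0; last by rewrite z2 // mulr0.
by rewrite mulr1.
Qed.

Section Curve.
Variable B : 'M[K]_n.
Hypothesis sB : skew B.
Let L := lin_mx_poly J B.
Let C1 : 'M[K]_n := \matrix_(i, j) (\adj L i j)`_1.

Let adj0 i j : (\adj L i j)`_0 = \adj J i j.
Proof.
have := map_mx_adj (horner_eval (0 : K)) L; rewrite lin_mx_poly_horner scale0r addr0 => <-.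
by rewrite [in RHS]mxE -horner_coef0.
Qed.

Let skewL : L^T = - L.
Proof.
apply/matrixP => i j; rewrite mxE [in RHS]mxE !lin_mx_polyE opprD -mulrN -!polyCN.
by rewrite (skew_entry _ _ sB) (skew_entry j i (std_skew_skew hJ)).
Qed.

Let detL : \det L = 0.
Proof.
by apply: det_skew_odd skewL; rewrite ?oddS ?em // -polyC_natr polyC_eq0 pnatr_eq0.
Qed.

Let symC1 i j : C1 i j = C1 j i.
Proof.
rewrite !mxE -[cofactor L j i]/(_ j i) -[cofactor L i j]/(_ i j).
have : (\adj L)^T = \adj L.
  by rewrite trmx_adj skewL -scaleN1r adjZ /= -signr_odd (negPf em) expr0 scale1r.
by move/matrixP/(_ j i); rewrite [in LHS]mxE [(\adj L) i j]mxE [(\adj L) j i]mxE => ->.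
Qed.

Let JC1 : J *m C1 = - (B *m \adj J).
Proof.
have e : L *m \adj L = 0 by rewrite mul_mx_adj detL; apply/matrixP => i j; rewrite !mxE mul0rn.
apply/matrixP => i j; have /matrixP/(_ i j)/(congr1 (fun p : {poly K} => p`_1)) := e.
rewrite [in RHS]mxE coef0 [in LHS]mxE coef_sum => e'.
apply/eqP; rewrite -subr_eq0 [X in _ - X]mxE opprK -[X in _ == X]e' !mxE -big_split /=.
apply/eqP/eq_bigr => k _; rewrite -adj0 [C1 k j]mxE -[L i k]/(lin_mx_poly J B i k) lin_mx_polyE.
rewrite mulrDl coefD coefCM -mulrA coefXM /= coefCM //.
Qed.

(** [C1] is the derivative of adj(J + t B). Off row 0 it equals - J J C1 = J B adj J, by
    differentiating L adj L = 0; [C1] is symmetric because m is even, which gives row 0, and entry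
    (0, 0) is [kap1 B] by definition. *)
Let C1E : C1 = kap1 B *: E ord0 ord0
   + kap *: (J *m B *m E ord0 ord0 + (J *m B *m E ord0 ord0)^T).
Proof.
have c i j : i != ord0 -> C1 i j = kap * (J *m B *m E ord0 ord0) i j.
  move=> i0; have := std_skew_sqE hJ C1 i j; rewrite JC1 adj_std_skew mulmxN.
  rewrite (negPf i0) sub0r mulN1r mxE => /oppr_inj <-.
  by rewrite -!scalemxAr mulmxA [in LHS]mxE.
have r0 j : (J *m B *m E ord0 ord0) ord0 j = 0.
  rewrite mul_deltarE mxE big1 ?mul0r // => k _; by rewrite (std_skew_row0 hJ) mul0r.
have c0 i j : j != ord0 -> (J *m B *m E ord0 ord0) i j = 0.
  by move=> j0; rewrite mul_deltarE (negPf j0) mulr0.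
apply/matrixP => i j; rewrite [RHS]mxE [X in X + _]mxE [X in _ + X]mxE [X in kap * X]mxE [(_^T) i j]mxE [E _ _ i j]mxE.
have [->|i0] := eqVneq i ord0; last first.
  by rewrite mulr0 add0r c // (c0 j) // addr0.
have [->|j0] := eqVneq j ord0; last first.
  by rewrite symC1 c // mulr0 add0r r0 add0r.
by rewrite !r0 addr0 mulr0 addr0 mulr1 mxE.
Qed.

Lemma adj_curve_coef1 S C : symm S ->
  (\tr (\adj L *m lin_mx_poly S C))`_1 =
    kap1 B * S ord0 ord0 + 2%:R * kap * (S *m J *m B) ord0 ord0 + kap * C ord0 ord0.
Proof.
move=> sS.
have trE X : \tr (X *m E ord0 ord0) = X ord0 ord0.
  rewrite /mxtrace (bigD1 ord0) //= big1 ?addr0 => [|i i0]; rewrite mul_deltarE ?eqxx ?mulr1 //.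
  by rewrite (negPf i0) mulr0.
have -> : (\tr (\adj L *m lin_mx_poly S C))`_1 = \tr (C1 *m S) + \tr (\adj J *m C).
  rewrite /mxtrace coef_sum -big_split; apply: eq_bigr => i _ /=.
  rewrite !mxE coef_sum -big_split; apply: eq_bigr => k _ /=.
  rewrite -adj0 [C1 i k]mxE lin_mx_polyE mulrDr coefD coefMC; congr (_ + _).
  by rewrite mulrCA coefXM /= coefMC.
have trE' X : \tr (E ord0 ord0 *m X) = X ord0 ord0 by rewrite mxtrace_mulC trE.
rewrite adj_std_skew -scalemxAl mxtraceZ trE'; congr (_ + _).
rewrite C1E mulmxDl -!scalemxAl mxtraceD !mxtraceZ trE'; congr (_ + _).
have trT X : \tr (X^T *m S) = \tr (S *m X) by rewrite -mxtrace_tr trmx_mul trmxK sS.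
rewrite mulmxDl mxtraceD trT [X in X + _]mxtrace_mulC mulmxA trE mulmxA.
by ring.
Qed.

End Curve.

Let kap1E B : kap1 B = \tr (\adj (minor0 J) *m minor0 B).
Proof.
rewrite /kap1 mxE /cofactor addn0 expr0 mul1r -det_lin_coef1.
suff -> : row' ord0 (col' ord0 (lin_mx_poly J B)) = lin_mx_poly (minor0 J) (minor0 B) by [].
by apply/matrixP => i j; rewrite !mxE.
Qed.

Lemma kap1_linear a B B' : kap1 (a *: B + B') = a * kap1 B + kap1 B'.
Proof.
rewrite !kap1E -mxtraceZ scalemxAr -mxtraceD -mulmxDr; congr (\tr (_ *m _)).
by apply/matrixP => i j; rewrite !mxE.
Qed.

(** Euler's formula for [kap], a minor of size m; it is what finally kills the scalar by which the
    annihilator acts on skew matrices. *)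
Lemma kap1_scale a : kap1 (a *: J) = a * m%:R * kap.
Proof.
have k0 : kap1 0 = 0 by have := kap1_linear (-1) 0 0; rewrite scaleN1r oppr0 addr0 mulN1r addNr.
rewrite -[a *: J]addr0 kap1_linear k0 addr0 -mulrA; congr (_ * _).
by rewrite kap1E mul_adj_mx -kapE mxtrace_scalar mulr_natl.
Qed.

(* The coefficient of t in n P_Lambda (M + t (u M)), where M = A + S. *)
Definition annihilates (u : 'M[K]_n -> 'M[K]_n) := forall A S, skew A -> symm S ->
  (\tr (\adj (lin_mx_poly A (skew_part (u (A + S)))) *m lin_mx_poly S (sym_part (u (A + S)))))`_1 = 0.

Lemma symm0 : symm (0 : 'M[K]_n). Proof. by rewrite /symm trmx0. Qed.

Lemma skew_part_skew X : skew (skew_part X).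
Proof. by rewrite /skew /skew_part linearZ linearB /= trmxK -scalerN opprB. Qed.

Lemma skew_part_conj g X : skew_part (g *m X *m g^T) = g *m skew_part X *m g^T.
Proof.
by rewrite /skew_part !trmx_mul trmxK mulmxA -scalemxAr -scalemxAl mulmxBr mulmxBl.
Qed.

Lemma sym_part_conj g X : sym_part (g *m X *m g^T) = g *m sym_part X *m g^T.
Proof.
by rewrite /sym_part !trmx_mul trmxK mulmxA -scalemxAr -scalemxAl mulmxDr mulmxDl.
Qed.

Section Annihilator.
Variable u : {linear 'M[K]_n -> 'M[K]_n}.
Hypothesis hu : annihilates u.

(** [u] transported by the congruence X |-> g X g^T, which multiplies [tr(adj A S)] only by
    det(g)^2. Every test at A = g J g^T thus becomes a test at J. *)
Let pull g X := invmx g *m u (g *m X *m g^T) *m (invmx g)^T.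

Lemma annihilator_eq g S : g \in unitmx -> symm S ->
  let Y := pull g (J + S) in
  kap1 (skew_part Y) * S ord0 ord0 + 2%:R * kap * (S *m J *m skew_part Y) ord0 ord0
    + kap * Y ord0 ord0 = 0.
Proof.
move=> gu sS Y.
have gY : u (g *m J *m g^T + g *m S *m g^T) = g *m Y *m g^T.
  rewrite /Y /pull; set X := u (_ *m (J + S) *m _); rewrite !mulmxA mulmxV // mul1mx -[RHS]mulmxA -trmx_mul mulmxV // trmx1 mulmx1 /X.
  by rewrite mulmxDr mulmxDl.
have sgJ : skew (g *m J *m g^T).
  by rewrite /skew !trmx_mul trmxK (std_skew_skew hJ) mulNmx mulmxN mulmxA.
have sgS : symm (g *m S *m g^T) by rewrite /symm !trmx_mul trmxK sS mulmxA.
have := hu sgJ sgS; rewrite gY skew_part_conj sym_part_conj.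
have lc X X' : lin_mx_poly (g *m X *m g^T) (g *m X' *m g^T)
    = map_mx polyC g *m lin_mx_poly X X' *m (map_mx polyC g)^T.
  by rewrite /lin_mx_poly !map_mxM -map_trmx mulmxDr mulmxDl -scalemxAr -scalemxAl.
rewrite !lc tr_adj_conj det_map_mx -rmorphXn coefCM => /eqP.
rewrite mulf_eq0 expf_eq0 /= -[\det g == 0]negbK -unitfE -[_ \is a _]/(g \in unitmx) gu /= => /eqP.
rewrite adj_curve_coef1 //; last exact: skew_part_skew.
have -> : sym_part Y ord0 ord0 = Y ord0 ord0.
  by rewrite !mxE -mulr2n -[X in _ * X]mulr_natl mulKf // pnatr_eq0.
by [].
Qed.

Let mul_scaled_entry t X Y A B : (t *: X *m Y *m (t *: A + B)) ord0 ord0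
  = t ^+ 2 * (X *m Y *m A) ord0 ord0 + t * (X *m Y *m B) ord0 ord0.
Proof.
rewrite -!scalemxAl mulmxDr -scalemxAr scalerDr scalerA -expr2.
by rewrite mxE [X in X + _]mxE [X in _ + X]mxE.
Qed.

(** Replacing S by t S makes [annihilator_eq] quadratic in t. Its coefficients separate the blocks
    of [u]: skew to symmetric, the two diagonal blocks together, symmetric to skew. *)
Lemma annihilator_split g S : g \in unitmx -> symm S ->
  [/\ (pull g J) ord0 ord0 = 0,
      kap1 (skew_part (pull g J)) * S ord0 ord0
       + 2%:R * kap * (S *m J *m skew_part (pull g J)) ord0 ord0 + kap * (pull g S) ord0 ord0 = 0
    & kap1 (skew_part (pull g S)) * S ord0 ord0
       + 2%:R * kap * (S *m J *m skew_part (pull g S)) ord0 ord0 = 0].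
Proof.
move=> gu sS.
have spD t : skew_part (pull g (J + t *: S)) = t *: skew_part (pull g S) + skew_part (pull g J).
  rewrite /pull mulmxDr mulmxDl linearD -scalemxAr -scalemxAl linearZ /= mulmxDr mulmxDl.
  rewrite -scalemxAr -scalemxAl; set X := invmx g *m _ *m _; set X' := invmx g *m _ *m _.
  by apply/matrixP => i j; rewrite !mxE; ring.
have pD t : (pull g (J + t *: S)) ord0 ord0 = t * (pull g S) ord0 ord0 + (pull g J) ord0 ord0.
  rewrite /pull mulmxDr mulmxDl linearD -scalemxAr -scalemxAl linearZ /= mulmxDr mulmxDl.
  by rewrite -scalemxAr -scalemxAl mxE [X in _ + X = _]mxE addrC.
pose al := skew_part (pull g J); pose be := skew_part (pull g S).
pose p2 := kap1 be * S ord0 ord0 + 2%:R * kap * (S *m J *m be) ord0 ord0.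
pose p1 := kap1 al * S ord0 ord0 + 2%:R * kap * (S *m J *m al) ord0 ord0 + kap * (pull g S) ord0 ord0.
pose p0 := kap * (pull g J) ord0 ord0.
have q t : t ^+ 2 * p2 + t * p1 + p0 = 0.
  have stS : symm (t *: S) by rewrite /symm linearZ /= sS.
  have := annihilator_eq gu stS; rewrite /= spD pD kap1_linear mul_scaled_entry.
  rewrite [(t *: S) _ _]mxE => <-; rewrite /p2 /p1 /p0 -/al -/be.
  move: (kap1 _) (kap1 _) (S ord0 ord0) (fun_of_matrix (S *m _ *m _) _ _) => x1 x2 x3 x4.
  move: (fun_of_matrix (S *m _ *m _) _ _) (pull g S ord0 ord0) (pull g J ord0 ord0) (kap) => x5 x6 x7 x8.
  ring.
have [h2 h1 /eqP] := quadratic_zero q; rewrite mulf_eq0 (negPf kap_neq0) => /eqP h0.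
by split.
Qed.

End Annihilator.
End AdjugateCurve.

Section BilinearValues.
Variables (K : numFieldType) (n : nat).
Implicit Types (x y v : 'cV[K]_n) (X Y : 'M[K]_n).

Definition bform x y X : K := (x^T *m X *m y) 0 0.
Definition evec i : 'cV[K]_n := delta_mx i 0.

Lemma bformDl x x' y X : bform (x + x') y X = bform x y X + bform x' y X.
Proof. by rewrite /bform linearD /= !mulmxDl mxE. Qed.
Lemma bformDr x y y' X : bform x (y + y') X = bform x y X + bform x y' X.
Proof. by rewrite /bform !mulmxDr mxE. Qed.
Lemma bformZl a x y X : bform (a *: x) y X = a * bform x y X.
Proof. by rewrite /bform linearZ /= -!scalemxAl mxE. Qed.
Lemma bformZr a x y X : bform x (a *: y) X = a * bform x y X.
Proof. by rewrite /bform -!scalemxAr mxE. Qed.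
Lemma bformNl x y X : bform (- x) y X = - bform x y X.
Proof. by rewrite -scaleN1r bformZl mulN1r. Qed.
Lemma bformNr x y X : bform x (- y) X = - bform x y X.
Proof. by rewrite -scaleN1r bformZr mulN1r. Qed.
Lemma bformD x y X Y : bform x y (X + Y) = bform x y X + bform x y Y.
Proof. by rewrite /bform mulmxDr mulmxDl mxE. Qed.
Lemma bformZ a x y X : bform x y (a *: X) = a * bform x y X.
Proof. by rewrite /bform -scalemxAr -scalemxAl mxE. Qed.
Lemma bformN x y X : bform x y (- X) = - bform x y X.
Proof. by rewrite -scaleN1r bformZ mulN1r. Qed.
Lemma bform0 x y : bform x y 0 = 0.
Proof. by rewrite /bform mulmx0 mul0mx mxE. Qed.
Lemma bform_tr v X : bform v v X^T = bform v v X.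
Proof.
rewrite /bform -[v^T *m X *m v]trmxK [in RHS]mxE; congr (fun_of_matrix _ 0 0).
by rewrite !trmx_mul trmxK mulmxA.
Qed.

Lemma mul_ev p (X : 'M[K]_(p, n)) i k : (X *m evec i) k 0 = X k i.
Proof.
rewrite mxE (bigD1 i) //= big1 ?addr0 => [|j ji]; rewrite mxE ?eqxx ?mulr1 //.
by rewrite (negPf ji) mulr0.
Qed.

Lemma bform_ev i j X : bform (evec i) (evec j) X = X i j.
Proof.
rewrite /bform mul_ev mxE (bigD1 i) //= big1 ?addr0 => [|k ki]; rewrite !mxE ?eqxx ?mul1r //.
by rewrite (negPf ki) mul0r.
Qed.

Definition bformE := (bformDl, bformDr, bformZl, bformZr, bformNl, bformNr, bformD, bformZ, bformN, bform_ev).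

Lemma evE i k : evec i k 0 = (k == i)%:R. Proof. by rewrite mxE andbT. Qed.

Lemma bform_alternating X : (forall v, bform v v X = 0) -> X^T = - X.
Proof.
move=> h; apply/matrixP => i j; rewrite !mxE.
have := h (evec i + evec j); rewrite !bformE.
have := h (evec i); have := h (evec j); rewrite !bform_ev => -> ->.
by rewrite add0r addr0 addrC => /eqP; rewrite addr_eq0 => /eqP.
Qed.

(* Polarization off the hyperplanes v_i = 0 and v_j = 0, along the line w + t (e_i + e_j). *)
Lemma bform_dense i j X : (forall v, v i 0 != 0 -> v j 0 != 0 -> bform v v X = 0) ->
  forall w, bform w w X = 0.
Proof.
move=> h w; pose z := evec i + evec j.
pose q : {poly K} := (bform w w X)%:P + 'X * (bform w z X + bform z w X)%:P + 'X^2 * (bform z z X)%:P.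
have qE t : q.[t] = bform (w + t *: z) (w + t *: z) X.
  by rewrite !(hornerE, hornerXn) !bformE; ring.
have zi : z i 0 != 0 by rewrite mxE !evE eqxx -natrD pnatr_eq0.
have zj : z j 0 != 0 by rewrite mxE !evE eqxx -natrD pnatr_eq0 addn_eq0 andbF.
pose l k : {poly K} := (w k 0)%:P + 'X * (z k 0)%:P.
have l0 k : z k 0 != 0 -> l k != 0.
  move=> zk; apply: contraNneq zk => /(congr1 (fun p : {poly K} => p`_1)).
  by rewrite coefD coefC coefXM coefC coef0 /= add0r => ->.
have : q = 0.
  apply/eqP/negPn/negP => q0; have [t] := poly_neq0_value (mulf_neq0 (mulf_neq0 q0 (l0 i zi)) (l0 j zj)).
  rewrite !hornerM !mulf_eq0 !negb_or => /andP[/andP[qt li] lj].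
  case/eqP: qt; rewrite qE; apply: h.
    by apply: contraNneq li => e; rewrite -e !hornerE !mxE.
  by apply: contraNneq lj => e; rewrite -e !hornerE !mxE.
by move=> q0; have := qE 0; rewrite q0 horner0 scale0r addr0.
Qed.

End BilinearValues.

(** * The annihilator meets the chosen linear conditions only in 0 *)

Section AnnihilatorTrivial.
Variables (K : numFieldType) (m : nat) (J : 'M[K]_m.+1).
Hypothesis hJ : std_skew J.
Hypothesis em : ~~ odd m.
Hypothesis m_gt1 : (1 < m)%N.
Local Notation n := m.+1.
Local Notation E := (@delta_mx K n n).
Local Notation e0 := (delta_mx ord0 ord0 : 'cV[K]_n).
Local Notation ev := (@evec K n).
Implicit Types (A B C S X Y g h : 'M[K]_n) (v : 'cV[K]_n) (i j k l p q : 'I_n).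

Variable u : {linear 'M[K]_n -> 'M[K]_n}.
Hypothesis hu : annihilates u.
Let wedge i j := E i j - E j i.
Let vee i j := E i j + E j i.
(** On the symmetry A + S |-> L A - A L^T, [cond_diag] reads L_ji = 0 and [cond_row0] reads L_00 =
    L_jj, so L is scalar and the symmetry is 0. [cond_sym] does the same for infinitesimal
    congruences and scalings. *)
Hypothesis cond_diag : forall i j, i != j -> u (wedge i j) j j = 0.
Hypothesis cond_row0 : forall j, j != ord0 -> u (wedge ord0 j) ord0 j + u (wedge ord0 j) j ord0 = 0.
Hypothesis cond_sym : forall k l, u (E l l) k l + u (E l l) l k = 0.

Let third i j : exists k, k != i /\ k != j.
Proof.
have /existsP[k /andP[]] : [exists k, (k != i) && (k != j)]; last by exists k.
apply/contraT; rewrite negb_exists => /forallP h.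
have : (#|'I_n| <= #|[set i; j]|)%N.
  apply/subset_leq_card/subsetP => k _; have := h k; rewrite negb_and !negbK !inE //.
by rewrite card_ord cards2; case: (_ != _); lia.
Qed.

Let pull g X := invmx g *m u (g *m X *m g^T) *m (invmx g)^T.

Let pull00 g v X : g \in unitmx -> g^T *m v = e0 ->
  (pull g X) ord0 ord0 = bform v v (u (g *m X *m g^T)).
Proof.
move=> gu gv; rewrite -bform_ev -[evec _ _]/e0 -gv /bform /pull trmx_mul trmxK.
have gVg : (invmx g)^T *m g^T = 1%:M by rewrite -trmx_mul mulmxV // trmx1.
by rewrite !mulmxA -[v^T *m g *m _]mulmxA mulmxV // mulmx1 -[_ *m _ *m g^T]mulmxA gVg mulmx1.
Qed.


Let wedge_skew i j : skew (wedge i j).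
Proof. by rewrite /skew /wedge linearB /= !trmx_delta opprB. Qed.

Let vee_symm i j : symm (vee i j).
Proof. by rewrite /symm /vee linearD /= !trmx_delta addrC. Qed.

Let wedgeN i j : wedge j i = - wedge i j.
Proof. by rewrite /wedge opprB. Qed.

Let uN X : u (- X) = - u X. Proof. by rewrite linearN. Qed.
Let uZ a X : u (a *: X) = a *: u X. Proof. by rewrite linearZ. Qed.
Let uD X Y : u (X + Y) = u X + u Y. Proof. by rewrite linearD. Qed.

Let mulE i j v : E i j *m v = v j 0 *: ev i.
Proof.
apply/matrixP => a b; rewrite ord1 !mxE (bigD1 j) //= big1 ?addr0 => [|l lj].
  by rewrite !mxE eqxx !andbT mulrC.
by rewrite !mxE (negPf lj) andbF mul0r.
Qed.

Let mul_wedge i j v : wedge i j *m v = v j 0 *: ev i - v i 0 *: ev j.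
Proof. by rewrite /wedge mulmxBl !mulE. Qed.

Let bform_subspace v : subspace (fun X => bform v v (u X) = 0).
Proof. by move=> a X Y; rewrite linearP !bformE => -> ->; rewrite mulr0 addr0. Qed.

(** For A = g J g^T this is the first equation of [annihilator_split], and such A span the skew
    matrices that kill [v]. *)
Let bform_skew v A : v != 0 -> skew A -> A *m v = 0 -> bform v v (u A) = 0.
Proof.
move=> v0; apply: (@skew_span_kernel _ _ _ hJ (fun X => bform v v (u X) = 0) v) => // g gu gv.
rewrite -pull00 //.
by have [] := annihilator_split hJ em hu gu (symm0 _ _).
Qed.

Let evD_neq0 i j a b c k : i != j -> i != k -> a != 0 -> a *: ev i + b *: ev j + c *: ev k != 0.
Proof.
move=> ij ik a0; apply: contraNneq a0 => /matrixP/(_ i 0).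
by rewrite !mxE !eqxx (negPf ij) (negPf ik) !mulr0 !addr0 mulr1 => ->.
Qed.

(** Twice the (k, l) entry of the symmetric part of the image of a basic skew matrix; the block skew
    to symmetric vanishes once all of these do. *)
Let c i j k l := u (wedge i j) k l + u (wedge i j) l k.

Let ev_neq0 i : ev i != 0.
Proof. by apply/eqP => /matrixP/(_ i 0); rewrite !mxE !eqxx => /eqP; rewrite oner_eq0. Qed.

Let c_out i j k l : k != i -> k != j -> l != i -> l != j -> c i j k l = 0.
Proof.
move=> ki kj li lj.
have hk p : p != i -> p != j -> u (wedge i j) p p = 0.
  move=> pi pj; rewrite -bform_ev; apply: bform_skew => //.
  by rewrite mul_wedge !evE [j == p]eq_sym [i == p]eq_sym (negPf pi) (negPf pj) !scale0r subrr.
have [<-|kl] := eqVneq k l; first by rewrite /c hk // addr0.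
have : bform (ev k + ev l) (ev k + ev l) (u (wedge i j)) = 0.
  apply: bform_skew => //; last first.
    rewrite mulmxDr !mul_wedge !evE ![j == _]eq_sym ![i == _]eq_sym.
    by rewrite (negPf ki) (negPf kj) (negPf li) (negPf lj) !scale0r subrr addr0.
  by have := evD_neq0 1 0 kl kl (oner_neq0 _); rewrite !scale1r scale0r addr0.
by rewrite !bformE !hk // add0r addr0.
Qed.

Let cN i j k l : c j i k l = - c i j k l.
Proof. by rewrite /c wedgeN uN !mxE opprD. Qed.

Let wedgeC_c i j k l : c i j k l = - c j i k l.
Proof. exact: cN. Qed.

Let cC i j k l : c i j k l = c i j l k. Proof. by rewrite /c addrC. Qed.

Let c_diag i j k : i != j -> u (wedge i j) k k = 0.
Proof.
move=> ij; have [->|kj] := eqVneq k j; first exact: cond_diag.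
have [->|ki] := eqVneq k i.
  have := cond_diag (i := j) (j := i); rewrite eq_sym ij wedgeN uN mxE => /(_ isT)/eqP.
  by rewrite oppr_eq0 => /eqP.
have := c_out ki kj ki kj; rewrite /c -mulr2n => /eqP; rewrite mulrn_eq0 /= => /eqP //.
Qed.

Let c_in i j k : i != j -> i != k -> j != k -> c i j i k = 0.
Proof.
move=> ij ik jk.
have key (s : K) : s ^+ 2 * c i j i k + s * c j k i k + 0 = 0.
  (* For each s this skew matrix kills e_i + s e_k, which gives an identity quadratic in s. *)
  have : bform (ev i + s *: ev k) (ev i + s *: ev k) (u (wedge j k + s *: wedge i j)) = 0.
    apply: bform_skew.
    - by have := evD_neq0 s 0 ik ik (oner_neq0 _); rewrite scale1r scale0r addr0.
    - by rewrite /skew linearD linearZ /= !wedge_skew; rewrite scalerN -opprD.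
    - have vE l : (ev i + s *: ev k) l 0 = (l == i)%:R + s * (l == k)%:R by rewrite mxE [X in _ + X]mxE !evE.
      rewrite mulmxDl -scalemxAl !mul_wedge !vE !eqxx (negPf ik) [k == i]eq_sym (negPf ik) (negPf jk).
      rewrite [j == i]eq_sym (negPf ij) !(mulr0, mulr1, add0r, addr0) !scale0r !subr0 scale1r sub0r scalerN.
      by rewrite subrr.
  rewrite uD linearZ /= bformD bformZ !bformE !c_diag // => e; rewrite -[RHS]e /c; ring.
by have [] := quadratic_zero key.
Qed.

(** When 0 is among the indices this is [cond_row0]. Otherwise w_pq - w_0q + w_0p kills e_0 + e_p +
    e_q, and all terms but the wanted one are known to vanish. *)
Let c_wedge i j : i != j -> c i j i j = 0.
Proof.
have pos p q : p != ord0 -> q != ord0 -> p != q -> c p q p q = 0.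
  move=> p0 q0 pq; have op : ord0 != p by rewrite eq_sym.
  have oq : ord0 != q by rewrite eq_sym.
  have : bform (ev ord0 + ev p + ev q) (ev ord0 + ev p + ev q)
      (u (wedge p q - wedge ord0 q + wedge ord0 p)) = 0.
    apply: bform_skew.
    - by have := evD_neq0 1 1 op oq (oner_neq0 _); rewrite !scale1r.
    - by apply/matrixP => a b; rewrite !mxE ![(b == _) && _]andbC; ring.
    - have vE l : (ev ord0 + ev p + ev q) l 0 = (l == ord0)%:R + (l == p)%:R + (l == q)%:R.
        by rewrite mxE [X in X + _ = _]mxE !evE.
      rewrite mulmxDl mulmxBl !mul_wedge !vE !eqxx (negPf op) (negPf oq) (negPf p0) (negPf q0) (negPf pq).
      rewrite [q == p]eq_sym (negPf pq) !(add0r, addr0) !scale1r.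
      by apply/matrixP => a b; rewrite !mxE; ring.
  rewrite 2!uD uN !(bformD, bformN) !bformE !c_diag //.
  have qp : q != p by rewrite eq_sym.
  have z1 : c p q ord0 p = 0 by rewrite cC c_in.
  have z2 : c p q ord0 q = 0 by rewrite cC wedgeC_c c_in ?oppr0.
  have z3 : c ord0 q ord0 p = 0 by rewrite c_in.
  have z4 : c ord0 q ord0 q = 0 by apply: cond_row0.
  have z5 : c ord0 q p q = 0 by rewrite cC wedgeC_c c_in ?oppr0.
  have z6 : c ord0 p ord0 p = 0 by apply: cond_row0.
  have z7 : c ord0 p ord0 q = 0 by rewrite c_in.
  have z8 : c ord0 p p q = 0 by rewrite wedgeC_c c_in ?oppr0.
  move=> e; have : c p q p q + c p q ord0 p + c p q ord0 q
     - (c ord0 q ord0 p + c ord0 q ord0 q + c ord0 q p q)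
     + c ord0 p ord0 p + c ord0 p ord0 q + c ord0 p p q = 0.
    by rewrite -[RHS]e /c; ring.
  by rewrite z1 z2 z3 z4 z5 z6 z7 z8 !addr0 subr0.
move=> ij; have [i0|i0] := eqVneq i ord0; last first.
  have [j0|j0] := eqVneq j ord0; last exact: pos.
  by rewrite j0 wedgeC_c cC -[c _ _ _ _]/(c _ _ _ _) /c cond_row0 ?oppr0.
by rewrite i0; apply: cond_row0; rewrite -i0 eq_sym.
Qed.

Let c_eq0 i j k l : i != j -> c i j k l = 0.
Proof.
move=> ij; have ji : j != i by rewrite eq_sym.
have [<-|kl] := eqVneq k l; first by rewrite /c c_diag // addr0.
have i_case x y a : x != y -> a != x -> c x y x a = 0.
  move=> xy ax; have [->|ay] := eqVneq a y; first exact: c_wedge.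
  by apply: c_in => //; rewrite eq_sym.
have [ek|ki] := eqVneq k i; first by rewrite ek i_case // eq_sym -ek.
have [->|li] := eqVneq l i; first by rewrite cC; apply: i_case.
have [ek|kj] := eqVneq k j; first by rewrite ek wedgeC_c i_case ?oppr0 // eq_sym -ek.
have [->|lj] := eqVneq l j; first by rewrite cC wedgeC_c i_case ?oppr0.
exact: c_out.
Qed.

Let bform_u_skew v A : skew A -> bform v v (u A) = 0.
Proof.
move=> sA; rewrite (skew_decomp sA) linear_sum /=.
rewrite /bform mulmx_sumr mulmx_suml summxE big1 // => -[i j] _ /=.
rewrite -/(wedge i j) linearZ /= -[LHS]/(bform v v _) bformZ.
have [->|ij] := eqVneq i j; first by rewrite /wedge subrr linear0 bform0 mulr0.
suff -> : bform v v (u (wedge i j)) = 0 by rewrite mulr0.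
have sk : u (wedge i j) + (u (wedge i j))^T = 0.
  by apply/matrixP => k l; rewrite !mxE; apply: c_eq0.
have := congr1 (bform v v) sk; rewrite bformD bform_tr bform0 -mulr2n => /eqP.
by rewrite mulrn_eq0 => /eqP.
Qed.

(** In coordinates where [v] is e0, row and column 0 of S vanish, so the second equation of
    [annihilator_split] keeps only its last term. *)
Let bform_symm v S : v != 0 -> symm S -> S *m v = 0 -> bform v v (u S) = 0.
Proof.
move=> v0 sS Sv; have [g gu gv] := exists_unit_dual v0.
pose S' := invmx g *m S *m (invmx g)^T.
have gS : g *m S' *m g^T = S.
  by rewrite /S' !mulmxA mulmxV // mul1mx -mulmxA -trmx_mul mulmxV // trmx1 mulmx1.
have sS' : symm S' by rewrite /symm /S' !trmx_mul trmxK sS mulmxA.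
have S'0 i : S' i ord0 = 0.
  have : S' *m e0 = 0.
    by rewrite -gv /S' mulmxA -[_ *m g^T]mulmxA -trmx_mul mulmxV // trmx1 mulmx1 -mulmxA Sv mulmx0.
  by move/matrixP/(_ i 0) => e; rewrite -mul_ev [LHS]e mxE.
have r0 X Y : (S' *m X *m Y) ord0 ord0 = 0.
  rewrite -mulmxA mxE big1 // => k _.
  by rewrite (symm_entry _ _ sS') S'0 mul0r.
have [_ e1 _] := annihilator_split hJ em hu gu sS'.
move: e1; rewrite r0 S'0 !mulr0 !add0r -/(pull g S') (pull00 _ gu gv) gS => /eqP.
by rewrite mulf_eq0 (negPf (kap_neq0 hJ)) => /eqP.
Qed.

Let d l j k := u (E l l) j k + u (E l l) k j.

Let E_symm l : symm (E l l). Proof. by rewrite /symm trmx_delta. Qed.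

Let d_eq0 l j k : d l j k = 0.
Proof.
have [->|kl] := eqVneq k l; first by rewrite /d cond_sym.
have [->|jl] := eqVneq j l; first by rewrite /d addrC cond_sym.
have hp p : p != l -> u (E l l) p p = 0.
  move=> pl; rewrite -bform_ev; apply: bform_symm => //.
  by rewrite mulE evE eq_sym (negPf pl) scale0r.
have [<-|jk] := eqVneq j k; first by rewrite /d hp // addr0.
have : bform (ev j + ev k) (ev j + ev k) (u (E l l)) = 0.
  apply: bform_symm => //; last first.
    by rewrite mulmxDr !mulE !evE ![l == _]eq_sym (negPf jl) (negPf kl) !scale0r addr0.
  by have := evD_neq0 1 0 jk jk (oner_neq0 _); rewrite !scale1r scale0r addr0.
by rewrite !bformE !hp // add0r addr0.
Qed.

Let bform_Ell v l : bform v v (u (E l l)) = 0.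
Proof.
have sk : u (E l l) + (u (E l l))^T = 0.
  by apply/matrixP => k j; rewrite !mxE; apply: d_eq0.
have := congr1 (bform v v) sk; rewrite bformD bform_tr bform0 -mulr2n => /eqP.
by rewrite mulrn_eq0 => /eqP.
Qed.

Let bform_vee v i j : i != j -> bform v v (u (vee i j)) = 0.
Proof.
move=> ij; apply: (@bform_dense _ _ i j) => {}v vi vj.
(* This is z z^T for z = v_i e_j - v_j e_i, which is orthogonal to v. *)
pose S := v i 0 ^+ 2 *: E j j + v j 0 ^+ 2 *: E i i - (v i 0 * v j 0) *: vee i j.
have sS : symm S by apply/matrixP => a b; rewrite !mxE ![(b == _) && _]andbC; ring.
have Sv : S *m v = 0.
  rewrite /S !mulmxDl mulNmx -!scalemxAl mulmxDl !mulE.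
  by apply/matrixP => a b; rewrite !mxE; ring.
have v0 : v != 0 by apply: contraNneq vi => ->; rewrite mxE.
have := bform_symm v0 sS Sv; rewrite /S 2!uD uN !uZ !(bformD, bformN, bformZ) !bform_Ell !mulr0 add0r => /eqP.
by rewrite sub0r oppr_eq0 !mulf_eq0 (negPf vi) (negPf vj) => /eqP.
Qed.

Let symm_decomp S : symm S -> S = \sum_(p : 'I_n * 'I_n) (2^-1 * S p.1 p.2) *: vee p.1 p.2.
Proof.
move=> sS; have e : S = \sum_(p : 'I_n * 'I_n) S p.1 p.2 *: E p.1 p.2.
  by rewrite {1}[S]matrix_sum_delta pair_bigA.
have e' : \sum_(p : 'I_n * 'I_n) S p.1 p.2 *: E p.2 p.1 = S.
  rewrite -[RHS]sS {2}e linear_sum; apply: eq_bigr => p _; by rewrite linearZ /= trmx_delta.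
rewrite (eq_bigr (fun p : 'I_n * 'I_n => 2^-1 *: (S p.1 p.2 *: E p.1 p.2 + S p.1 p.2 *: E p.2 p.1))).
  rewrite -scaler_sumr big_split /= -e e' -mulr2n -scaler_nat scalerA mulVf ?scale1r //.
  by rewrite pnatr_eq0.
by move=> p _; rewrite -scalerA scalerDr.
Qed.

Let bform_u_symm v S : symm S -> bform v v (u S) = 0.
Proof.
move=> sS; rewrite (symm_decomp sS) linear_sum /=.
rewrite /bform mulmx_sumr mulmx_suml summxE big1 // => -[i j] _.
rewrite uZ -[LHS]/(bform v v _) bformZ.
have [->|ij] := eqVneq i j; last by rewrite bform_vee ?mulr0.
by rewrite /vee uD bformD bform_Ell addr0 mulr0.
Qed.

Let a X := skew_part (u X).

Let a_skew X : skew (a X). Proof. exact: skew_part_skew. Qed.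

Let aP b X Y : a (b *: X + Y) = b *: a X + a Y.
Proof. by rewrite /a linearP /skew_part; apply/matrixP => i j; rewrite !mxE; ring. Qed.

Let aD X Y : a (X + Y) = a X + a Y. Proof. by rewrite -[X in a (X + _)]scale1r aP scale1r. Qed.
Let aN X : a (- X) = - a X.
Proof. by rewrite /a uN /skew_part; apply/matrixP => i j; rewrite !mxE; ring. Qed.
Let aZ b X : a (b *: X) = b *: a X.
Proof. by rewrite /a uZ /skew_part; apply/matrixP => i j; rewrite !mxE; ring. Qed.
Let a0 : a 0 = 0. Proof. by rewrite /a linear0 /skew_part trmx0 subr0 scaler0. Qed.
Let a_sum (I : finType) (F : I -> 'M[K]_n) : a (\sum_i F i) = \sum_i a (F i).
Proof.
elim/big_rec2: _ => [|i X Y _ <-]; last exact: aD.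
by rewrite /a linear0 /skew_part trmx0 subr0 scaler0.
Qed.

Let skew_pull g X : skew_part (pull g X) = invmx g *m a (g *m X *m g^T) *m (invmx g)^T.
Proof. by rewrite /pull skew_part_conj. Qed.

(** The symmetric part of [u S] is already 0 for symmetric S, so the second equation of
    [annihilator_split] is linear in S with data from J alone; S = E_00 and S = E_0k + E_k0
    suffice. *)
Let kap1_a g : g \in unitmx -> kap1 J (skew_part (pull g J)) = 0 /\ skew_part (pull g J) *m e0 = 0.
Proof.
move=> gu; set al := skew_part (pull g J).
have eq S : symm S -> kap1 J al * S ord0 ord0 + 2%:R * kap J * (S *m J *m al) ord0 ord0 = 0.
  move=> sS; have [_ + _] := annihilator_split hJ em hu gu sS; rewrite -/(pull g S) -/(pull g J) -/al => <-.
  pose v := (invmx g)^T *m e0.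
  have gv : g^T *m v = e0 by rewrite /v mulmxA -trmx_mul mulVmx // trmx1 mul1mx.
  rewrite (pull00 _ gu gv) bform_u_symm ?mulr0 ?addr0 //.
  by rewrite /symm !trmx_mul trmxK sS mulmxA.
have Jal0 k : (J *m al) ord0 k = 0.
  by rewrite mxE big1 // => l _; rewrite (std_skew_row0 hJ) mul0r.
have k0 : kap1 J al = 0.
  by have := eq _ (E_symm ord0); rewrite -mulmxA mul_deltaE Jal0 mxE !eqxx !mulr0 addr0 mulr1.
have nz : 2%:R * kap J != 0 by rewrite mulf_neq0 ?(kap_neq0 hJ) // pnatr_eq0.
have Jal k : (J *m al) k ord0 = 0.
  have [->|kn] := eqVneq k ord0; first exact: Jal0.
  have := eq _ (vee_symm ord0 k); rewrite k0 mul0r add0r => /eqP.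
  rewrite mulf_eq0 (negPf nz) /= -mulmxA /vee mulmxDl mxE !mul_deltaE eqxx mul1r.
  by rewrite [ord0 == k]eq_sym (negPf kn) mul0r addr0 => /eqP.
split=> //; apply/matrixP => i j; rewrite (ord1 j) -[e0]/(ev ord0) mul_ev [RHS]mxE.
have [->|i0] := eqVneq i ord0; first exact: skew_diag (skew_part_skew _).
have := std_skew_sqE hJ al i ord0; rewrite (negPf i0) sub0r mulN1r mxE.
rewrite big1 => [/esym/eqP|k _]; last by rewrite Jal mulr0.
by rewrite oppr_eq0 => /eqP.
Qed.

Let a_kernel v A : v != 0 -> skew A -> A *m v = 0 -> a A *m v = 0.
Proof.
move=> v0; apply: (@skew_span_kernel _ _ _ hJ (fun X => a X *m v = 0) v) => //.
  by move=> b X Y aX aY; rewrite aP mulmxDl -scalemxAl aX aY scaler0 addr0.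
move=> g gu gv; have [_] := kap1_a gu; rewrite skew_pull -gv; set Y := a _.
rewrite -(mulmxA (invmx g *m Y)) (mulmxA (invmx g)^T) -trmx_mul mulmxV // trmx1 mul1mx -mulmxA.
by move=> e; have := congr1 (mulmx g) e; rewrite mulmx0 mulKVmx.
Qed.

Let a_out i j k l : l != i -> l != j -> a (wedge i j) k l = 0.
Proof.
move=> li lj; have h : a (wedge i j) *m ev l = 0.
  apply: a_kernel => //; rewrite mul_wedge !evE [j == l]eq_sym [i == l]eq_sym.
  by rewrite (negPf li) (negPf lj) !scale0r subrr.
by rewrite -mul_ev h mxE.
Qed.

Let lam i j := a (wedge i j) i j.

Let a_wedge i j : i != j -> a (wedge i j) = lam i j *: wedge i j.
Proof.
move=> ij; have ji : j != i by rewrite eq_sym.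
apply/matrixP => k l; rewrite [RHS]mxE /wedge [X in _ * X]mxE [X in _ * (_ + X)]mxE ![E _ _ _ _]mxE -/(wedge i j).
have [->|kn] := eqVneq k i; have [->|ln] := eqVneq l j => /=.
- by rewrite (negPf ij) subr0 mulr1.
- rewrite (negPf ij) subr0 mulr0; have [->|li] := eqVneq l i; last exact: a_out.
  exact: skew_diag.
- rewrite (negPf ji) andbF subrr mulr0.
  have [->|kj] := eqVneq k j; first exact: skew_diag.
  by rewrite (skew_entry _ _ (a_skew _)) a_out ?oppr0.
have [->|kj] := eqVneq k j; have [->|li] := eqVneq l i => /=; rewrite ?subrr ?sub0r ?mulr0.
- by rewrite mulrN1 (skew_entry _ _ (a_skew _)).
- exact: a_out.
- by rewrite (skew_entry _ _ (a_skew _)) a_out ?oppr0.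
- exact: a_out.
Qed.

Let lamC i j : lam i j = lam j i.
Proof. by rewrite /lam wedgeN aN mxE (skew_entry _ _ (a_skew _)) opprK. Qed.

Let lam_step i j k : i != j -> i != k -> j != k -> lam i j = lam j k.
Proof.
move=> ij ik jk.
(* The matrix w_jk + w_ij kills e_i + e_k; entry j of the result compares the two eigenvalues. *)
have : a (wedge j k + wedge i j) *m (ev i + ev k) = 0.
  apply: a_kernel.
  - by have := evD_neq0 1 0 ik ik (oner_neq0 _); rewrite !scale1r scale0r addr0.
  - by apply/matrixP => x y; rewrite !mxE ![(y == _) && _]andbC; ring.
  - have vE l : (ev i + ev k) l 0 = (l == i)%:R + (l == k)%:R by rewrite mxE !evE.
    rewrite mulmxDl !mul_wedge !vE !eqxx (negPf ik) [k == i]eq_sym (negPf ik) (negPf jk).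
    rewrite [j == i]eq_sym (negPf ij) !(add0r, addr0) !scale0r !subr0 scale1r sub0r.
    by rewrite subrr.
move/matrixP/(_ j 0); rewrite mulmxDr mxE !mul_ev aD mxE [X in _ + X]mxE [RHS]mxE.
rewrite [a (wedge j k) j i]a_out // [a (wedge i j) j k]a_out // 1?eq_sym // add0r addr0.
by rewrite (skew_entry _ _ (a_skew _)) -/(lam i j) -/(lam j k) addrC => /subr0_eq.
Qed.

Let lam_const i j k l : i != j -> k != l -> lam i j = lam k l.
Proof.
move=> ij kl.
have share x y z : x != y -> x != z -> lam x y = lam x z.
  move=> xy xz; have [->//|yz] := eqVneq y z.
  by rewrite lamC; apply: lam_step => //; rewrite eq_sym.
have [ik|ik] := eqVneq i k; first by rewrite ik; apply: share => //; rewrite -ik.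
by rewrite (share i j k) // lamC (share k i l) // eq_sym.
Qed.

(** All eigenvalues [lam] agree, so [a] is a scalar on skew matrices; [kap1_a] at g = 1 gives lam m
    [kap] = 0 for that scalar. *)
Let a_eq0 A : skew A -> a A = 0.
Proof.
have i01 : ord0 != ord_max :> 'I_n by rewrite -val_eqE /= eq_sym -lt0n; lia.
have aL B : skew B -> a B = lam ord0 ord_max *: B.
  move=> sB; rewrite {1 2}(skew_decomp sB) a_sum scaler_sumr; apply: eq_bigr => -[i j] _ /=.
  rewrite aZ -/(wedge i j); have [->|ij] := eqVneq i j.
    by rewrite /wedge subrr a0 !scaler0.
  by rewrite a_wedge // [LHS]scalerA [RHS]scalerA mulrC (lam_const ij i01).
have : lam ord0 ord_max = 0.
  have [+ _] := kap1_a (unitmx1 _ _); rewrite skew_pull invmx1 !mul1mx trmx1 !mulmx1.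
  rewrite (aL J (std_skew_skew hJ)) kap1_scale => /eqP.
  rewrite !mulf_eq0 (negPf (kap_neq0 hJ)) orbF pnatr_eq0.
  by case/orP => [/eqP //|/eqP m0]; exfalso; move: m_gt1; clear -m0; rewrite m0.
by move=> l0 sA; rewrite aL // l0 scale0r.
Qed.

(** As S_pp = 0, the third equation of [annihilator_split] says that h J h^T pairs S e_p and (a S)
    e_p to 0 whenever h e0 = e_p. These matrices span all skew matrices, so the two vectors are
    proportional. *)
Let b_colinear p S i k : symm S -> S p p = 0 -> S i p * a S k p = S k p * a S i p.
Proof.
move=> sS Spp; set v := ev p; set w := S *m v; set x := a S *m v.
have v0 : v != 0 by apply: ev_neq0.
have hP : subspace (fun Y => bform w x Y = 0).
  by move=> b X Y hX hY; rewrite bformD bformZ hX hY mulr0 addr0.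
have : bform w x (wedge i k) = 0.
  apply: (skew_span_all hJ hP v0) (wedge_skew i k) => h hu1 hv.
  pose g := (invmx h)^T.
  have gu : g \in unitmx by rewrite unitmx_tr unitmx_inv.
  have gVE : invmx g = h^T by rewrite /g -trmx_inv invmxK.
  pose S' := h^T *m S *m h.
  have sS' : symm S' by rewrite /symm /S' !trmx_mul trmxK sS mulmxA.
  have gS : g *m S' *m g^T = S.
    rewrite /S' /g trmxK !mulmxA -trmx_mul mulmxV // trmx1 mul1mx.
    by rewrite -mulmxA mulmxV // mulmx1.
  have S'00 : S' ord0 ord0 = 0.
    rewrite -bform_ev -[ev ord0]/e0 /bform /S' !mulmxA -trmx_mul hv -mulmxA hv.
    by rewrite -[LHS]/(bform v v S) bform_ev.
  have [_ _] := annihilator_split hJ em hu gu sS'.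
  rewrite S'00 mulr0 add0r -/(pull g S') skew_pull gS gVE trmxK => /eqP.
  rewrite mulf_eq0 mulf_eq0 pnatr_eq0 (negPf (kap_neq0 hJ)) /= => /eqP.
  rewrite -bform_ev -[ev ord0]/e0 /bform => <-.
  rewrite /w /x -hv /S' !trmx_mul sS !mulmxA //.
rewrite /bform /wedge mulmxBr mulmxBl mxE [X in _ + X]mxE.
have eE j l : (w^T *m E j l *m x) 0 0 = w j 0 * x l 0.
  rewrite -mulmxA mulE -scalemxAr mxE mulrC; congr (_ * _).
  by rewrite mul_ev mxE.
by rewrite !eE /w /x !mul_ev => /subr0_eq.
Qed.

Let b_kernel p S : symm S -> S *m ev p = 0 -> a S *m ev p = 0.
Proof.
move=> sS Sp; have S0 i : S i p = 0 by rewrite -mul_ev Sp mxE.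
apply/matrixP => k x; rewrite (ord1 x) mul_ev [RHS]mxE.
(* For S e_p = 0 colinearity is void. Adding E_pq + E_qp turns column p into e_q, and row k != q of
   both images must vanish. *)
have [q [qp qk]] := third p k.
have vE i : vee p q i p = (i == q)%:R.
  by rewrite /vee !mxE eqxx [p == q]eq_sym (negPf qp) andbF andbT add0r.
have pq : p == q = false by rewrite eq_sym (negPf qp).
have kq : k == q = false by rewrite eq_sym (negPf qk).
have e1 := b_colinear q k (vee_symm p q) (etrans (vE p) (congr1 _ (congr1 _ pq))).
have sST : symm (S + vee p q) by rewrite /symm linearD /= sS vee_symm.
have STp : (S + vee p q) p p = 0 by rewrite mxE S0 vE pq addr0.
have e2 := b_colinear q k sST STp.
have eS i : (S + vee p q) i p = (i == q)%:R by rewrite mxE S0 vE add0r.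
have eA i : a (S + vee p q) i p = a S i p + a (vee p q) i p by rewrite aD mxE.
by move: e1 e2; rewrite !eS !eA !vE eqxx kq !mul1r !mul0r => ->; rewrite addr0.
Qed.

Let b_col p S k : symm S -> S *m ev p = 0 -> a S k p = 0.
Proof. by move=> sS Sp; rewrite -mul_ev b_kernel // mxE. Qed.

Let b_Ell l : a (E l l) = 0.
Proof.
have h p k : p != l -> a (E l l) k p = 0.
  by move=> pl; apply: b_col => //; rewrite mulE evE eq_sym (negPf pl) scale0r.
apply/matrixP => k p; rewrite [RHS]mxE; have [->|pl] := eqVneq p l; last exact: h.
have [->|kl] := eqVneq k l; first exact: skew_diag.
by rewrite (skew_entry _ _ (a_skew _)) h ?oppr0.
Qed.

Let b_out i j p k : p != i -> p != j -> a (vee i j) k p = 0.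
Proof.
move=> pi pj; apply: b_col => //.
rewrite /vee mulmxDl !mulE !evE [j == p]eq_sym [i == p]eq_sym (negPf pi) (negPf pj).
by rewrite !scale0r addr0.
Qed.

Let veeC i j : vee i j = vee j i. Proof. by rewrite /vee addrC. Qed.

Let mu i j := a (vee i j) i j.

Let mu_anti i j : mu j i = - mu i j.
Proof. by rewrite /mu veeC (skew_entry _ _ (a_skew _)). Qed.

Let mu_step i j k : i != j -> i != k -> j != k -> mu i j = mu i k.
Proof.
move=> ij ik jk.
have ss : symm (vee i j + vee i k) by rewrite /symm [LHS]raddfD /= !vee_symm.
have vE x y z : x != y -> vee x y z x = (z == y)%:R.
  by move=> xy; rewrite /vee !mxE eqxx (negPf xy) andbF andbT add0r.
have sE z : (vee i j + vee i k) z i = (z == j)%:R + (z == k)%:R.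
  by rewrite [LHS]mxE !vE.
have := b_colinear (p := i) j k ss; rewrite !sE aD (negPf ij) (negPf ik) addr0 => /(_ erefl).
rewrite !eqxx [k == j]eq_sym (negPf jk) addr0 add0r !mul1r mxE [RHS]mxE.
rewrite (skew_entry k i (a_skew _)) [a (vee i j) i k]b_out // 1?eq_sym // oppr0 add0r.
rewrite (skew_entry j i (a_skew (vee i k))) [a (vee i k) i j]b_out // 1?eq_sym // oppr0 addr0.
by rewrite (skew_entry k i (a_skew _)) (skew_entry j i (a_skew _)) /mu => /oppr_inj ->.
Qed.

(** [mu] is antisymmetric and does not depend on its second index; going once around three distinct
    indices yields mu = - mu. *)
Let mu0 i j : i != j -> mu i j = 0.
Proof.
move=> ij; have [k [ki kj]] := third i j.
have ik : i != k by rewrite eq_sym. have jk : j != k by rewrite eq_sym.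
have ji : j != i by rewrite eq_sym.
have e : mu i j = - mu i j.
  by rewrite {1}(mu_step ij ik jk) (mu_anti k i) (mu_step ki kj ij) -!mu_anti (mu_step jk ji ki).
have /eqP : mu i j *+ 2 = 0 by rewrite mulr2n {1}e addNr.
by rewrite mulrn_eq0 => /eqP.
Qed.

Let b_vee i j : a (vee i j) = 0.
Proof.
have [->|ij] := eqVneq i j; first by rewrite /vee aD b_Ell addr0.
apply/matrixP => k p; rewrite [RHS]mxE.
have out p' k' : p' != i -> p' != j -> a (vee i j) k' p' = 0 by apply: b_out.
have [kp|kp] := eqVneq k p; first by rewrite kp; exact: skew_diag.
have [pi|pi] := eqVneq p i; have [pj|pj] := eqVneq p j; last exact: out.
- by move: ij; rewrite -pi pj eqxx.
- rewrite (skew_entry _ _ (a_skew _)) pi; have [->|kj] := eqVneq k j.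
    by rewrite -/(mu i j) mu0 // oppr0.
  by rewrite out ?oppr0 // -pi.
- rewrite pj; have [->|ki] := eqVneq k i; first by rewrite -/(mu i j) mu0.
  by rewrite (skew_entry _ _ (a_skew _)) out ?oppr0 // -pj.
Qed.

Lemma annihilator_trivial X : u X = 0.
Proof.
have a_all Y : a Y = 0.
  have -> : Y = skew_part Y + sym_part Y.
    by apply/matrixP => i j; rewrite !mxE; field.
  rewrite aD a_eq0 ?add0r; last exact: skew_part_skew.
  have sy : symm (sym_part Y) by rewrite /symm /sym_part linearZ linearD /= trmxK addrC.
  rewrite (symm_decomp sy) a_sum big1 // => -[i j] _ /=.
  by rewrite aZ b_vee scaler0.
have s_all Y v : bform v v (u Y) = 0.
  have -> : Y = skew_part Y + sym_part Y.
    by apply/matrixP => i j; rewrite !mxE; field.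
  rewrite uD bformD bform_u_skew ?bform_u_symm ?addr0 //; last exact: skew_part_skew.
  by rewrite /symm /sym_part linearZ linearD /= trmxK addrC.
have sk := bform_alternating (s_all X).
have := a_all X; rewrite /a /skew_part sk opprK => /matrixP e.
apply/matrixP => i j; have /eqP := e i j; rewrite !mxE mulf_eq0 invr_eq0 pnatr_eq0 /=.
by rewrite -mulr2n mulrn_eq0 => /eqP.
Qed.

End AnnihilatorTrivial.

(** * Normal forms modulo the stabilizer of det_n *)

Section Line.
Variable K : numFieldType.

Lemma polyfun_line s (f : ('I_s -> K) -> K) v w : polyfun f ->
  exists q : {poly K}, forall t, q.[t] = f (fun i => v i + t * w i).
Proof.
move=> [F hF]; exists (mmap polyC (fun i => (v i)%:P + 'X * (w i)%:P) F) => t.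
by rewrite horner_mmap hF; apply: meval_eq => i; rewrite !hornerE.
Qed.

Lemma line_density (q k : {poly K}) : (exists t, k.[t] != 0) ->
  (forall t, k.[t] != 0 -> q.[t] = 0) -> q = 0.
Proof.
move=> [t0 kt0] h; apply/eqP/negPn/negP => q0.
have k0 : k != 0 by apply: contraNneq kt0 => ->; rewrite horner0.
have [t] := poly_neq0_value (mulf_neq0 q0 k0).
by rewrite hornerM mulf_eq0 negb_or => /andP[qt kt]; rewrite h ?eqxx in qt.
Qed.

End Line.

Section Krylov.
Variables (R : comNzRingType) (m : nat).
Local Notation n := m.+1.
Local Notation e0 := (delta_mx ord0 ord0 : 'cV[R]_n).

(** In the basis e0, A e0, A^2 e0, ... the matrix A becomes a companion matrix: every column but the
    last is that of [shift_mx]. *)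
Definition krylov (A : 'M[R]_n) : 'M[R]_n := \matrix_(i, j) (iter j (mulmx A) e0) i 0.

Lemma krylov_col (A : 'M[R]_n) j : krylov A *m delta_mx j 0 = iter j (mulmx A) (e0 : 'cV[R]_n).
Proof.
apply/matrixP => i k; rewrite ord1 mxE (bigD1 j) //= big1 ?addr0 => [|l lj].
  by rewrite !mxE eqxx mulr1.
by rewrite !mxE (negPf lj) mulr0.
Qed.

Definition shift_mx : 'M[R]_n := \matrix_(i, j) (i == j.+1 :> nat)%:R.

Lemma krylov_shift : krylov shift_mx = 1%:M.
Proof.
have h j : (j < n)%N -> forall i, (iter j (mulmx shift_mx) e0) i 0 = (i == j :> nat)%:R.
  elim: j => [|j IH] lt i; first by rewrite mxE andbT.
  rewrite /= mxE (bigD1 (Ordinal (ltnW lt))) //= big1 ?addr0 => [|k kj].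
    by rewrite (IH (ltnW lt)) /= eqxx mulr1 mxE.
  by rewrite (IH (ltnW lt)) (_ : (k == j :> nat) = false) ?mulr0 //; apply/negbTE.
by apply/matrixP => i j; rewrite !mxE h.
Qed.

End Krylov.

Lemma map_krylov (R R' : comNzRingType) (f : {rmorphism R -> R'}) m (A : 'M[R]_m.+1) :
  map_mx f (krylov A) = krylov (map_mx f A).
Proof.
apply/matrixP => i j; rewrite !mxE.
have -> : iter j (mulmx (map_mx f A)) (delta_mx ord0 ord0) = map_mx f (iter j (mulmx A) (delta_mx ord0 ord0 : 'cV_m.+1)).
  elim: (nat_of_ord j) => [|k IH]; first by apply/matrixP => a b; rewrite !mxE rmorph_nat.
  by rewrite /= map_mxM -IH.
by rewrite mxE.
Qed.

Lemma exists_eigencol (K : numClosedFieldType) m (A : 'M[K]_m.+1) :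
  exists2 v : 'cV[K]_m.+1, v != 0 & exists a, A *m v = a *: v.
Proof.
have [a ra] : exists a, root (char_poly A^T) a.
  by apply/closed_rootP; rewrite size_char_poly.
have : eigenvalue A^T a by rewrite eigenvalue_root_char.
case/eigenvalueP => v vA v0; exists v^T; first by rewrite -trmx0 (inj_eq trmx_inj).
by exists a; apply: trmx_inj; rewrite trmx_mul trmxK vA linearZ /= trmxK.
Qed.

Section DetNormalForm.
Variables (K : numClosedFieldType) (m : nat).
Local Notation n := m.+1.
Local Notation N := (n * n)%N.
Local Notation E := (@delta_mx K n n).
Local Notation e0 := (delta_mx ord0 ord0 : 'cV[K]_n).
Implicit Types (G H : 'M[K]_N) (A B M U : 'M[K]_n).
Hypothesis m_gt0 : (0 < m)%N.

Definition vact G M : 'M[K]_n := vec_mx (mxvec M *m G).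

Lemma vact_linear G : linear (vact G).
Proof. by move=> a X Y; rewrite /vact !linearP /= mulmxDl -scalemxAl linearP. Qed.

Definition vslot G p : 'M[K]_n := vec_mx (row p G).

Lemma vact_slots G M : vact G M = \sum_i \sum_j M i j *: vslot G (mxvec_index i j).
Proof.
rewrite /vact mulmx_sum_row linear_sum (reindex _ (curry_mxvec_bij _ _)) /=.
by rewrite pair_bigA; apply: eq_bigr => -[i j] _; rewrite linearZ /= mxvecE.
Qed.

Lemma slots_ext G H : (forall p, vslot G p = vslot H p) -> G = H.
Proof. by move=> h; apply/row_matrixP => p; have := h p => /(can_inj vec_mxK). Qed.

Definition two_sided A G B : 'M[K]_N := \matrix_p mxvec (A *m vslot G p *m B).

Lemma two_sided_slot A G B p : vslot (two_sided A G B) p = A *m vslot G p *m B.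
Proof. by rewrite /vslot rowK mxvecK. Qed.

Lemma two_sided_vact A G B M : vact (two_sided A G B) M = A *m vact G M *m B.
Proof.
rewrite !vact_slots mulmx_sumr mulmx_suml; apply: eq_bigr => i _.
rewrite mulmx_sumr mulmx_suml; apply: eq_bigr => j _.
by rewrite two_sided_slot -scalemxAr -scalemxAl.
Qed.

Definition set_slot G p U : 'M[K]_N := \matrix_q (if q == p then mxvec U else row q G).

Lemma set_slotE G p U q : vslot (set_slot G p U) q = if q == p then U else vslot G q.
Proof. by rewrite /vslot rowK; case: ifP => _; rewrite ?mxvecK. Qed.

Let ia : 'I_N := mxvec_index ord0 ord0.
Let ib : 'I_N := mxvec_index ord0 ord_max.
Let ic : 'I_N := mxvec_index ord_max ord0.

Let maxn0 : (ord_max : 'I_n) != ord0. Proof. by rewrite -val_eqE /= -lt0n. Qed.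

Let mxvec_index_inj i j k l : (mxvec_index i j == mxvec_index k l :> 'I_N) = (i == k) && (j == l).
Proof.
apply/eqP/andP => [e|[/eqP -> /eqP ->] //].
have := congr1 (fun p => mxvec (E k l) 0 p) e; rewrite /= !mxvecE !mxE !eqxx /=.
by case: (i == k); case: (j == l) => //= /eqP; rewrite eq_sym oner_eq0.
Qed.

Let ia_ib : ia != ib. Proof. by rewrite mxvec_index_inj eqxx eq_sym (negPf maxn0). Qed.
Let ia_ic : ia != ic. Proof. by rewrite mxvec_index_inj eq_sym (negPf maxn0). Qed.
Let ib_ic : ib != ic. Proof. by rewrite mxvec_index_inj eq_sym (negPf maxn0). Qed.

(* Row mxvec_index i j of G is the image of the basis matrix E_ij.  Two-sided multiplication
   turns a generic first image into a scalar matrix; conjugation by the Krylov basis of the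
   second image, started at an eigenvector of the third, gives the other two conditions. *)
Definition normal_form G := [/\ exists c, vslot G ia = c%:M,
   forall k (l : 'I_n), l != ord_max -> vslot G ib k l = shift_mx K m k l
 & forall k, k != ord0 -> vslot G ic k ord0 = 0].

Section Density.
(** Stands for an equation of forms composed with the orbit map. Polynomiality on lines is enough,
    as each density argument moves one slot along one line. *)
Variable D : 'M[K]_N -> K.
Hypothesis D_poly : forall G H, exists q : {poly K}, forall t, q.[t] = D (G + t *: H).
Hypothesis D_inv : forall A B G, \det A * \det B = 1 -> D (two_sided A G B) = D G.
Hypothesis D_normal : forall G, normal_form G -> D G = 0.

Let conj_inv A G : A \in unitmx -> D (two_sided (invmx A) G A) = D G.
Proof.
by move=> Au; apply: D_inv; rewrite det_inv mulVf // -unitfE.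
Qed.

(* Moving the slot p along the segment from U to U', on which the polynomial k does not vanish identically. *)
Let slot_density G p U (k : {poly K}) : k.[1] != 0 ->
  (forall t, k.[t] != 0 -> D (set_slot G p (vslot G p + t *: (U - vslot G p))) = 0) -> D G = 0.
Proof.
move=> k1 h; pose H : 'M[K]_N := set_slot 0 p (U - vslot G p).
have GH t : G + t *: H = set_slot G p (vslot G p + t *: (U - vslot G p)).
  apply: slots_ext => q; rewrite set_slotE.
  have -> : vslot (G + t *: H) q = vslot G q + t *: vslot H q.
    by rewrite /vslot [G + _]addrC linearP linearP addrC.
  rewrite set_slotE; case: eqP => [->|_] //.
  by rewrite {2}/vslot !linear0 addr0.
have [q qE] := D_poly G H.
have q0 : q = 0.
  apply: (line_density (k := k)); first by exists 1.
  by move=> t kt; rewrite qE GH h.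
by have := qE 0; rewrite q0 horner0 scale0r addr0.
Qed.

Let D1 G c a : vslot G ia = c%:M -> vslot G ic *m e0 = a *: e0 ->
  krylov (vslot G ib) \in unitmx -> D G = 0.
Proof.
move=> Ga Gc Ku; set B := krylov _ in Ku.
rewrite -(conj_inv G Ku); apply: D_normal; split.
- exists c; rewrite two_sided_slot Ga mul_mx_scalar -scalemxAl mulVmx // scale_scalar_mx mulr1 //.
- move=> k l lm; rewrite two_sided_slot.
  have lt : (l.+1 < n)%N by rewrite ltn_neqAle ltn_ord andbT; apply: contraNneq lm => e; apply/eqP/val_inj; case: e.
  have : invmx B *m vslot G ib *m B *m (delta_mx l 0 : 'cV_n) = delta_mx (Ordinal lt) 0.
    rewrite -!mulmxA krylov_col; apply: (can_inj (mulKmx Ku)).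
    by rewrite mulKVmx // krylov_col.
  move/matrixP/(_ k 0); rewrite -[delta_mx l 0]/(evec K l) mul_ev => ->.
  by rewrite !mxE andbT -val_eqE.
move=> k k0; rewrite two_sided_slot -mul_ev -[evec K ord0]/e0.
have Be0 : B *m e0 = e0 by rewrite /B krylov_col.
have Ve0 : invmx B *m e0 = e0 by rewrite -{1}Be0 mulKmx.
by rewrite -!mulmxA Be0 Gc -scalemxAr Ve0 !mxE (negPf k0) mulr0.
Qed.

Let D2 G c a : vslot G ia = c%:M -> vslot G ic *m e0 = a *: e0 -> D G = 0.
Proof.
move=> Ga Gc; set U := vslot G ib.
(* At t = 1 the slot is the shift matrix, whose Krylov matrix is 1; hence almost every t gives an
   invertible one. *)
pose k := \det (krylov (lin_mx_poly U (shift_mx K m - U))).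
have kE t : k.[t] = \det (krylov (U + t *: (shift_mx K m - U))).
  rewrite -[_.[t]]/(horner_eval t _) -det_map_mx; congr (\det _).
  by rewrite (map_krylov (horner_eval t)) lin_mx_poly_horner.
apply: (@slot_density G ib (shift_mx K m) k).
  by rewrite kE scale1r addrC subrK krylov_shift det1 oner_eq0.
move=> t; rewrite kE => kt; apply: (D1 (c := c) (a := a)); rewrite set_slotE.
- by rewrite (negPf ia_ib).
- by rewrite eq_sym (negPf ib_ic).
- by rewrite eqxx unitmxE unitfE.
Qed.

Let D3 G c : vslot G ia = c%:M -> D G = 0.
Proof.
move=> Ga; have [v v0 [a va]] := exists_eigencol (vslot G ic).
have [B Bu Bv] := exists_unit_col v0.
rewrite -(conj_inv G Bu); apply: (D2 (c := c) (a := a)); rewrite two_sided_slot.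
  by rewrite Ga mul_mx_scalar -scalemxAl mulVmx // scale_scalar_mx mulr1.
by rewrite -!mulmxA Bv va -scalemxAr -Bv mulKmx.
Qed.

Let D4 G : vslot G ia \in unitmx -> D G = 0.
Proof.
move=> Gu; set U := vslot G ia in Gu.
(* Left multiplication by c U^-1 has determinant 1 and turns the first slot into the scalar matrix
   c. *)
pose c := n.-root (\det U); have cn : c ^+ n = \det U by apply: rootCK.
rewrite -(@D_inv (c *: invmx U) 1%:M).
  by apply: (D3 (c := c)); rewrite two_sided_slot mulmx1 -scalemxAl mulVmx // scale_scalar_mx mulr1.
by rewrite det1 mulr1 detZ cn det_inv mulfV // -unitfE.
Qed.

Lemma normal_form_dense G : D G = 0.
Proof.
set U := vslot G ia; pose k := \det (lin_mx_poly U (1%:M - U)).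
have kE t : k.[t] = \det (U + t *: (1%:M - U)).
  by rewrite -[_.[t]]/(horner_eval t _) -det_map_mx lin_mx_poly_horner.
apply: (@slot_density G ia 1%:M k).
  by rewrite kE scale1r addrC subrK det1 oner_eq0.
by move=> t; rewrite kE => kt; apply: D4; rewrite set_slotE eqxx unitmxE unitfE.
Qed.

End Density.

(* The entries (p, q) of G that normal_form prescribes, up to the scalar c. *)
Let fixed_type := ('I_n * 'I_n + 'I_n * 'I_m + 'I_m)%type.

Let fixed_entry (x : fixed_type) : 'I_N * 'I_N :=
  match x with
  | inl (inl kl) => (ia, mxvec_index kl.1 kl.2)
  | inl (inr kl) => (ib, mxvec_index kl.1 (lift ord_max kl.2))
  | inr k => (ic, mxvec_index (lift ord0 k) ord0)
  end.

Let fixed_entry_inj : injective fixed_entry.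
Proof.
have ba : (ib == ia) = false by rewrite eq_sym (negPf ia_ib).
have ca : (ic == ia) = false by rewrite eq_sym (negPf ia_ic).
have cb : (ic == ib) = false by rewrite eq_sym (negPf ib_ic).
move=> x y /eqP; rewrite -pair_eqE.
case: x y => [[[i j]|[i j]]|i] [[[k l]|[k l]]|k] /=;
  rewrite ?eqxx ?(negPf ia_ib) ?(negPf ia_ic) ?(negPf ib_ic) ?ba ?ca ?cb //= mxvec_index_inj.
- by move=> /andP[/eqP -> /eqP ->].
- by rewrite (inj_eq lift_inj) => /andP[/eqP -> /eqP ->].
- by rewrite (inj_eq lift_inj) => /andP[/eqP ->].
Qed.

Let fixed : {set 'I_N * 'I_N} := [set fixed_entry x | x : fixed_type].

Definition free_entries := {x : 'I_N * 'I_N | x \notin fixed}.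

(** Slot [ia] prescribes n^2 entries, slot [ib] n (n - 1), and slot [ic] n - 1. *)
Lemma card_free_entries : (#|{: free_entries}| + (2 * n ^ 2).-1 = N * N)%N.
Proof.
rewrite card_sig -[X in (_ = X * X)%N]card_ord -card_prod -(cardC (mem fixed)) addnC; congr (_ + _)%N.
rewrite (card_imset _ fixed_entry_inj) !card_sum !card_prod !card_ord; lia.
Qed.

Let frame c : 'M[K]_N := set_slot (set_slot 0 ib (shift_mx K m)) ia c%:M.

Let frame_slot c p : vslot (frame c) p =
  if p == ia then c%:M else if p == ib then shift_mx K m else 0.
Proof. by rewrite /frame !set_slotE /vslot !linear0. Qed.

Let slot_entry G p i j : vslot G p i j = G p (mxvec_index i j).
Proof. by rewrite !mxE. Qed.

Lemma normal_form_param G : normal_form G ->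
  exists c (w : free_entries -> K), forall p q,
    G p q = if insub (p, q) is Some x then w x else frame c p q.
Proof.
move=> [[c Ga] Gb Gc]; exists c, (fun x => G (val x).1 (val x).2) => p q.
have [fx|nfx] := boolP ((p, q) \in fixed); last first.
  by rewrite (insubT (fun x => x \notin fixed) nfx).
rewrite insubF ?fx //; case/imsetP: fx => -[[[i j]|[i j]]|i] _ [-> ->] /=;
  rewrite -!slot_entry frame_slot ?eqxx.
- by rewrite Ga.
- by rewrite eq_sym (negPf ia_ib) Gb //; rewrite eq_sym neq_lift.
- rewrite [ic == ia]eq_sym (negPf ia_ic) [ic == ib]eq_sym (negPf ib_ic) [RHS]mxE.
  by rewrite Gc // eq_sym neq_lift.
Qed.

(** The additional coordinate, placed at [ord0], carries the scalar c of the first slot. *)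
Lemma normal_form_parametrized :
  exists Phi : ('I_(#|{: free_entries}|.+1) -> K) -> 'M[K]_N,
    (forall p q, polyfun (fun v => Phi v p q)) /\
    forall G, normal_form G -> exists v, G = Phi v.
Proof.
pose Phi (v : 'I_(#|{: free_entries}|.+1) -> K) : 'M[K]_N := \matrix_(p, q)
  if insub (p, q) is Some x then v (lift ord0 (enum_rank (x : free_entries)))
  else if p == ia then v ord0 * mxvec 1%:M 0 q else frame 0 p q.
exists Phi; split=> [p q|G /normal_form_param[c [w e]]].
  apply: (@eq_polyfun _ _ (fun v => if insub (p, q) is Some x then v (lift ord0 (enum_rank (x : free_entries)))
    else if p == ia then v ord0 * mxvec 1%:M 0 q else frame 0 p q)) => [v|]; first by rewrite [RHS]mxE.
  case: insubP => [x _ _|_]; first exact: polyfun_coord.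
  case: eqP => _; last exact: polyfun_const.
  by apply: polyfunM; [apply: polyfun_coord|apply: polyfun_const].
exists (fun i => if unlift ord0 i is Some j then w (enum_val j) else c).
apply/matrixP => p q; rewrite e [RHS]mxE; case: insubP => [x _ _|_].
  by rewrite liftK enum_rankK.
rewrite unlift_none /frame mxE [in RHS]mxE; case: eqP => // _.
by rewrite -[c%:M]scalemx1 linearZ [LHS]mxE.
Qed.

End DetNormalForm.

(** * P_Lambda is not a specialization of det_n *)

Lemma rank_le1_minor (K : fieldType) n (A : 'M[K]_n) i j k l :
  (\rank A <= 1)%N -> A i j * A k l = A i l * A k j.
Proof.
have AE a b : A a b = \sum_x col_base A a x * row_base A x b.
  by rewrite -{1}(mulmx_base A) mxE.
rewrite !AE; move: (col_base A) (row_base A) {AE}; case: (\rank A) => [|[|//]] C R _.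
  by rewrite !big_ord0 !mul0r.
by rewrite !big_ord1; ring.
Qed.

(* N = L D_r R with D_r a partial identity; complementing D_r exhibits the order n - r in t. *)
Lemma rank_le1_of_det (K : numFieldType) m (A : 'M[K]_m.+1) :
  (forall Y, exists a b, forall t, \det (t *: Y + A) = t ^+ m * (t * a + b)) -> (\rank A <= 1)%N.
Proof.
move=> h; set r := \rank A; rewrite leqNgt; apply/negP => r1.
have rn : (r <= m.+1)%N := rank_leq_row A.
pose L := col_ebase A; pose R := row_ebase A.
have [a [b e]] := h (L *m copid_mx r *m R).
have eA : A = L *m pid_mx r *m R by rewrite mulmx_ebase.
have LR : \det L * \det R != 0.
  by rewrite mulf_neq0 // -unitfE -[_ \is a _]/(_ \in unitmx) ?col_ebase_unit ?row_ebase_unit.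
have dE t : \det (t *: (L *m copid_mx r *m R) + A) = \det L * \det R * t ^+ (m.+1 - r).
  rewrite {1}eA scalemxAl scalemxAr -mulmxDl -mulmxDr !det_mulmx mulrAC; congr (_ * _).
  pose dv := \row_(i < m.+1) (if (i < r)%N then 1 else t : K).
  have -> : t *: copid_mx r + pid_mx r = diag_mx dv.
    apply/matrixP => i j; rewrite !mxE; have [->|ij] := eqVneq i j.
      by rewrite eqxx /=; case: ifP => _; rewrite /= ?subrr ?subr0 ?mulr0 ?mulr1 ?add0r ?addr0.
    by rewrite (_ : (i == j :> nat) = false) ?andFb ?subr0 ?mulr0 ?addr0 //; apply/negbTE.
  rewrite det_diag; under eq_bigr do rewrite mxE.
  rewrite -(big_mkord xpredT (fun i => if (i < r)%N then 1 else t)) (big_cat_nat (n := r)) //=.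
  rewrite big_nat big1 ?mul1r => [|i /andP[_ ->] //].
  rewrite big_nat (eq_bigr (fun=> t)) => [|i /andP[ri _]]; last by rewrite ltnNge ri.
  by rewrite -big_nat prodr_const_nat.
pose q : {poly K} := (\det L * \det R)%:P * 'X^(m.+1 - r) - 'X^m * ('X * a%:P + b%:P).
have q0 : q = 0.
  by apply: poly_eq0_off0 => t _; rewrite !hornerE -dE e subrr.
(* Because r > 1, the exponent n - r is below m, and only the first term of [q] contributes. *)
have := congr1 (fun q : {poly K} => q`_(m.+1 - r)) q0.
rewrite coefB coefCM coefXn eqxx mulr1 coefXnM coef0.
by rewrite ifT ?subr0 => [/eqP|]; [rewrite (negPf LR)|lia].
Qed.

Section NotEndOrbit.
Variables (K : numFieldType) (m : nat).
Hypothesis em : ~~ odd m.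
Hypothesis m_gt1 : (1 < m)%N.
Local Notation n := m.+1.
Local Notation E := (@delta_mx K n n).
Local Notation e0 := (delta_mx ord0 ord0 : 'cV[K]_n).
Implicit Types (A S M X g : 'M[K]_n).

(** This is n P_Lambda, without its denominator. *)
Definition tr_form M : K := \tr (\adj (skew_part M) *m sym_part M).

Lemma tr_formE A S : skew A -> symm S -> tr_form (A + S) = \tr (\adj A *m S).
Proof.
move=> sA sS; rewrite /tr_form; have -> : skew_part (A + S) = A.
  by rewrite /skew_part [(A + S)^T]linearD /= sA sS; apply/matrixP => i j; rewrite !mxE; field.
have -> // : sym_part (A + S) = S.
by rewrite /sym_part [(A + S)^T]linearD /= sA sS; apply/matrixP => i j; rewrite !mxE; field.
Qed.

Lemma skew_sym_partE M : M = skew_part M + sym_part M.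
Proof. by apply/matrixP => i j; rewrite !mxE; field. Qed.

Lemma sym_part_symm M : symm (sym_part M).
Proof. by rewrite /symm /sym_part linearZ linearD /= trmxK addrC. Qed.

Lemma tr_form_conj g M : tr_form (g *m M *m g^T) = \det g ^+ 2 * tr_form M.
Proof. by rewrite /tr_form skew_part_conj sym_part_conj tr_adj_conj. Qed.

Lemma tr_form_scale A S S' t : skew A -> symm S -> symm S' ->
  tr_form (t *: (A + S') + S) = t ^+ m * (t * tr_form (A + S') + tr_form (A + S)).
Proof.
move=> sA sS sS'; rewrite scalerDr -addrA [tr_form (t *: A + _)]tr_formE; last 2 first.
- by rewrite /skew linearZ /= sA scalerN.
- by rewrite /symm linearD linearZ /= sS sS'.
rewrite !tr_formE // adjZ -scalemxAl mxtraceZ mulmxDr mxtraceD -scalemxAr mxtraceZ //.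
Qed.

Lemma bform_conj (v : 'cV[K]_n) g X : g^T *m v = e0 -> (v^T *m (g *m X *m g^T) *m v) 0 0 = X ord0 ord0.
Proof.
move=> gv; rewrite !mulmxA -mulmxA gv -[X in X *m _ *m _]trmxK trmx_mul trmxK gv.
by rewrite -[LHS]/(bform (evec K ord0) (evec K ord0) X) bform_ev.
Qed.

Variable J : 'M[K]_n.
Hypothesis hJ : std_skew J.

(** For A = g J g^T with g^T v = e0, the trace is a nonzero multiple of v^T S v, and every nonzero v
    occurs. *)
Lemma tr_adj_nondegenerate S : symm S ->
  (forall A, skew A -> \tr (\adj A *m S) = 0) -> S = 0.
Proof.
move=> sS h; have bS (v : 'cV[K]_n) : bform v v S = 0.
  have [->|v0] := eqVneq v 0; first by rewrite /bform mulmx0 mxE.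
  have [g gu gv] := exists_unit_dual v0.
  pose S' := invmx g *m S *m (invmx g)^T.
  have gS : g *m S' *m g^T = S.
    by rewrite /S' !mulmxA mulmxV // mul1mx -mulmxA -trmx_mul mulmxV // trmx1 mulmx1.
  have sgJ : skew (g *m J *m g^T).
    by rewrite /skew !trmx_mul trmxK (std_skew_skew hJ) mulNmx mulmxN mulmxA.
  have := h _ sgJ; rewrite -{1}gS tr_adj_conj (adj_std_skew hJ em) -scalemxAl mxtraceZ => /eqP.
  have d0 : \det g ^+ 2 != 0 by rewrite expf_neq0 // -unitfE -[_ \is a _]/(g \in unitmx).
  rewrite mulf_eq0 (negPf d0) mulf_eq0 (negPf (kap_neq0 hJ)) /= mxtrace_mulC => /eqP.
  rewrite -{1}gS /bform bform_conj // => <-.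
  rewrite /mxtrace (bigD1 ord0) //= big1 ?addr0 => [|i i0]; rewrite mul_deltarE ?eqxx ?mulr1 //.
  by rewrite (negPf i0) mulr0.
have := bform_alternating bS; rewrite sS => /eqP; rewrite -addr_eq0 -mulr2n -scaler_nat scaler_eq0.
by rewrite pnatr_eq0 => /eqP.
Qed.

(** Translating M by minus the skew part shows that the symmetric part of [M0] pairs to 0 with all
    adjugates. A skew translation then keeps adj J, so J + M1 still kills e0; congruences carry this
    from e0 to every vector. *)
Lemma tr_form_essential M0 : (forall M, tr_form (M + M0) = tr_form M) -> M0 = 0.
Proof.
have S0 M1 : (forall M, tr_form (M + M1) = tr_form M) -> sym_part M1 = 0.
  move=> h; apply: tr_adj_nondegenerate (sym_part_symm _) _ => A sA.
  have sA' : skew (A - skew_part M1) by rewrite /skew linearB /= sA skew_part_skew -opprB opprK addrC opprB.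
  have := h (A - skew_part M1); rewrite {2}(skew_sym_partE M1) addrA subrK [tr_form (A + sym_part _)]tr_formE //; last exact: sym_part_symm.
  move=> ->; rewrite -[A - _]addr0 tr_formE //; last exact: symm0.
  by rewrite mulmx0 mxtrace0.
have key M1 : (forall M, tr_form (M + M1) = tr_form M) -> M1 *m e0 = 0.
  move=> h; have M1E : M1 = skew_part M1 by rewrite {1}(skew_sym_partE M1) S0 // addr0.
  have sM : skew M1 by rewrite M1E; apply: skew_part_skew.
  have sJM : skew (J + M1) by rewrite /skew linearD /= (std_skew_skew hJ) sM opprD.
  have eq S : symm S -> \tr (\adj (J + M1) *m S) = \tr (\adj J *m S).
    move=> sS; have := h (J + S); rewrite addrAC !tr_formE //; exact: std_skew_skew hJ.
  have dJM : \det (J + M1) = 0.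
    by apply: det_skew_odd sJM; rewrite ?pnatr_eq0 //= em.
  have symadj A : skew A -> symm (\adj A).
    by move=> sA; rewrite /symm trmx_adj sA -scaleN1r adjZ /= -signr_odd (negPf em) expr0 scale1r.
  have adjE : \adj (J + M1) = \adj J.
    apply/matrixP => i j; pose S := E i j + E j i.
    have sS : symm S by rewrite /symm linearD /= !trmx_delta addrC.
    have trE X a b : \tr (X *m E a b) = X b a.
      rewrite /mxtrace (bigD1 b) //= big1 ?addr0 => [|k kb]; rewrite mul_deltarE ?eqxx ?mulr1 //.
      by rewrite (negPf kb) mulr0.
    have := eq _ sS; rewrite !mulmxDr !mxtraceD !trE.
    rewrite (symm_entry j i (symadj _ sJM)) (symm_entry j i (symadj _ (std_skew_skew hJ))).
    by rewrite -!mulr2n => /eqP; rewrite eqr_pMn2r // => /eqP.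
  have := mul_mx_adj (J + M1); rewrite dJM adjE (adj_std_skew hJ em) -scalemxAr => /matrixP e.
  apply/matrixP => i j; rewrite (ord1 j); have := e i ord0; rewrite mxE mulmxDl mxE !mul_deltarE eqxx !mulr1.
  rewrite (std_skew_col0 hJ) add0r [RHS]mxE mul0rn => /eqP; rewrite mulf_eq0 (negPf (kap_neq0 hJ)) /= => /eqP e1.
  by rewrite -[e0]/(evec K ord0) mul_ev e1 mxE.
move=> h; have all_v (v : 'cV[K]_n) : M0 *m v = 0.
  have [->|v0] := eqVneq v 0; first by rewrite mulmx0.
  have [g gu gv] := exists_unit_dual v0.
  pose M1 := invmx g *m M0 *m (invmx g)^T.
  have gM : g *m M1 *m g^T = M0.
    by rewrite /M1 !mulmxA mulmxV // mul1mx -mulmxA -trmx_mul mulmxV // trmx1 mulmx1.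
  have d0 : \det g ^+ 2 != 0 by rewrite expf_neq0 // -unitfE -[_ \is a _]/(g \in unitmx).
  have : M1 *m e0 = 0.
    apply: key => M; apply: (mulfI d0); rewrite -!tr_form_conj mulmxDr mulmxDl gM; exact: h.
  by move=> e; rewrite -gM -(mulmxA _ g^T v) gv -mulmxA e mulmx0.
apply/matrixP => i j; by rewrite -mul_ev all_v !mxE.
Qed.

Lemma det_not_tr_form (u : 'End('M[K]_n)) c : c != 0 ->
  (forall M, tr_form M = c * \det (u M)) -> False.
Proof.
move=> c0 hu.
have uinj M : u M = 0 -> M = 0.
  by move=> uM; apply: tr_form_essential => M'; rewrite !hu linearD /= uM addr0.
have ker0 : lker u == 0%VS.
  by apply/lker0P => M M' e; apply/eqP; rewrite -subr_eq0; apply/eqP/uinj; rewrite linearB /= e subrr.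
(* With Y = u(M), [tr_form_scale] gives det(t Y + u S) the factor t^m that [rank_le1_of_det] asks
   for. *)
have rank1 S : symm S -> (\rank (u S) <= 1)%N.
  move=> sS; apply: rank_le1_of_det => Y; pose M := (u^-1)%VF Y.
  have uM : u M = Y by rewrite /M lker0_lfunVK.
  pose A := skew_part M; pose S' := sym_part M.
  exists (c^-1 * tr_form (A + S')), (c^-1 * tr_form (A + S)) => t.
  rewrite -uM -linearZ -linearD; apply: (mulfI c0); rewrite -hu.
  rewrite {1}(skew_sym_partE M) tr_form_scale //; [|exact: skew_part_skew|exact: sym_part_symm].
  by move: (tr_form _) (tr_form _) (t ^+ m) => x y z; field.
have [S0 sS0 u0] : exists2 S0, symm S0 & u S0 != 0.
  exists 1%:M; first by rewrite /symm trmx1.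
  by apply/eqP => /uinj/eqP; rewrite -mxrank_eq0 mxrank1.
have [i [j N0ij]] : exists i j, u S0 i j != 0.
  apply: contrapT => h; case/eqP: u0; apply/matrixP => i j; rewrite [RHS]mxE.
  by apply: contrapT => /eqP hij; apply: h; exists i, j.
(* A matrix of rank at most 1 is determined by its row i and column j when entry (i, j) is nonzero.
   These 2n - 1 equations therefore leave no nonzero symmetric S. *)
have dead S : symm S -> (forall l, u S i l = 0) -> (forall k, u S k j = 0) -> S = 0.
  move=> sS ri cj; apply: uinj; apply/matrixP => k l; rewrite [RHS]mxE.
  have sSS : symm (S0 + S) by rewrite /symm linearD /= sS0 sS.
  have aD a b : u (S0 + S) a b = u S0 a b + u S a b by rewrite linearD mxE.
  have := rank_le1_minor i j k l (rank1 _ sSS); rewrite !aD ri cj [u S i l]ri !addr0.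
  rewrite mulrDr (rank_le1_minor i j k l (rank1 _ sS0)) => /eqP.
  by rewrite -subr_eq0 addrAC subrr add0r mulf_eq0 (negPf N0ij) => /eqP.
have lt1 : (1 < n)%N by lia.
pose i1 : 'I_n := Ordinal lt1; pose i2 : 'I_n := Ordinal (m_gt1 : (2 < n)%N).
(* There are 2n symmetric matrices against 2n - 1 equations; they are those with a 1 in row 0 or row
   [i1], and one diagonal unit, available because n >= 3. *)
pose T := ('I_n + 'I_m + unit)%type; pose T' := ('I_n + 'I_m)%type.
pose basis (t : T) : 'M[K]_n := match t with
  | inl (inl k) => E ord0 k + E k ord0
  | inl (inr k) => E i1 (lift ord0 k) + E (lift ord0 k) i1
  | inr _ => E i2 i2 end.
pose cons (t : T') (X : 'M[K]_n) : K := match t with inl l => X i l | inr k => X (lift i k) j end.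
have card : (#|{: T'}| < #|{: T}|)%N by rewrite !card_sum !card_ord card_unit; lia.
have [w [[t0 wt0] hw]] := lindep (fun t t' => cons t' (u (basis t))) card.
pose S := \sum_t w t *: basis t.
have sS : symm S.
  rewrite /symm /S linear_sum; apply: eq_bigr => -[[k|k]|[]] _; rewrite linearZ /= ?linearD /= !trmx_delta //.
    by rewrite addrC.
  by rewrite addrC.
have uS a b : u S a b = \sum_t w t * u (basis t) a b.
  by rewrite /S linear_sum summxE; apply: eq_bigr => t _; rewrite linearZ mxE.
have ri l : u S i l = 0 by rewrite uS (hw (inl l)).
have cj k : u S k j = 0.
  have [->|ik] := eqVneq k i; first exact: ri.
  have [k' ->] : exists k', k = lift i k'.
    by case: (unliftP i k) ik => [k' ->|->]; [exists k'|rewrite eqxx].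
  by rewrite uS (hw (inr k')).
have S_eq0 := dead S sS ri cj.
have Sab a b : \sum_t w t * basis t a b = 0.
  transitivity (S a b); last by rewrite S_eq0 mxE.
  by rewrite /S summxE; apply: eq_bigr => t _; rewrite mxE.
move: wt0; apply/negP; rewrite negbK.
(* Independence: each chosen matrix has an entry at which all the others vanish. Its value is 1, or
   2 when E_ij + E_ji falls on the diagonal. *)
suff [a [b [x [x0 hx]]]] : exists a b (x : K), x != 0 /\ forall t, basis t a b = x * (t == t0)%:R.
  have := Sab a b; rewrite (bigD1 t0) //= big1 => [|t tt0]; last first.
    by rewrite hx (negPf tt0) !mulr0.
  by rewrite hx eqxx mulr1 addr0 => /eqP; rewrite mulf_eq0 (negPf x0) orbF.
have n1 k : (ord0 == lift ord0 k :> 'I_n) = false by [].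
have i10 : (i1 == ord0) = false by []. have i20 : (i2 == ord0) = false by [].
have i21 : (i2 == i1) = false by []. have i12 : (i1 == i2) = false by [].
have i01 : (ord0 == i1) = false by []. have i02 : (ord0 == i2) = false by [].
case: t0 => [[k|k]|[]].
- exists ord0, k, (1 + (k == ord0)%:R); split; first by rewrite -[1]/(1%:R) -natrD pnatr_eq0.
  move=> [[k'|k']|[]] /=; rewrite !mxE ?i01 ?i02 ?n1 /= ?addr0 ?mulr0 //.
  have -> : (inl (inl k') == inl (inl k) :> T) = (k == k') by rewrite eq_sym.
  have [->|kk'] := eqVneq k k'; first by rewrite mulr1 [ord0 == _]eq_sym andbb.
  rewrite mulr0 add0r; have [k'0|] //= := eqVneq ord0 k'.
  by case: eqP => // k0; rewrite k0 k'0 eqxx in kk'.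
- exists i1, (lift ord0 k), (1 + (lift ord0 k == i1)%:R); split; first by rewrite -[1]/(1%:R) -natrD pnatr_eq0.
  move=> [[k'|k']|[]] /=; rewrite !mxE ?i10 ?i12 ?[lift ord0 k == ord0]eq_sym ?n1 ?andbF /= ?addr0 ?mulr0 //.
  have -> : (inl (inr k') == inl (inr k) :> T) = (k == k') by rewrite eq_sym.
  rewrite [lift ord0 k == lift ord0 k'](inj_eq lift_inj).
  have [->|kk'] := eqVneq k k'; first by rewrite mulr1 [i1 == _]eq_sym andbb.
  rewrite mulr0 add0r; have [k'0|] //= := eqVneq i1 (lift ord0 k').
  by rewrite k'0 (inj_eq lift_inj) (negPf kk').
- exists i2, i2, 1; split; first exact: oner_neq0.
  by move=> [[k'|k']|[]] /=; rewrite !mxE ?i20 ?i21 ?andbF ?eqxx /= ?addr0 ?mulr0 ?mulr1.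
Qed.

End NotEndOrbit.

(** * Universality of the determinant *)

Section Universality.
Variables (K : numFieldType) (M : nat).
Local Notation P_ := {mpoly K[M]}.
Implicit Types p q : P_.

Definition affine p := exists a0 (a : 'rV[K]_M), p = a0%:MP + linform a.
Definition affine_mx m n (A : 'M[P_]_(m, n)) := forall i j, affine (A i j).

Lemma affineC a : affine a%:MP.
Proof.
exists a, 0; rewrite /linform big1 ?addr0 // => k _; by rewrite mxE scale0r.
Qed.

Lemma affine0 : affine 0. Proof. by rewrite -mpolyC0; apply: affineC. Qed.
Lemma affine1 : affine 1. Proof. by rewrite -mpolyC1; apply: affineC. Qed.

Lemma affineX i : affine 'X_i.
Proof.
exists 0, (delta_mx 0 i); rewrite mpolyC0 add0r /linform (bigD1 i) //= big1 ?addr0 => [|k ki].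
  by rewrite mxE !eqxx scale1r.
by rewrite mxE (negPf ki) andbF scale0r.
Qed.

Lemma affineN p : affine p -> affine (- p).
Proof.
move=> [a0 [a ->]]; exists (- a0), (- a); rewrite opprD mpolyCN /linform -sumrN.
by congr (_ + _); apply: eq_bigr => k _; rewrite mxE scaleNr.
Qed.

Lemma affine_mx0 m n : affine_mx (0 : 'M[P_]_(m, n)).
Proof. by move=> i j; rewrite mxE; apply: affine0. Qed.

Lemma affine_mx1 n : affine_mx (1%:M : 'M[P_]_n).
Proof. by move=> i j; rewrite mxE; case: (_ == _); [apply: affine1|apply: affine0]. Qed.

Lemma affine_block m1 m2 n1 n2 (A : 'M[P_]_(m1, n1)) B C (D : 'M_(m2, n2)) :
  affine_mx A -> affine_mx B -> affine_mx C -> affine_mx D -> affine_mx (block_mx A B C D).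
Proof.
move=> hA hB hC hD i j; rewrite -(splitK i) -(splitK j).
by case: (split i) => i'; case: (split j) => j'; rewrite /= ?block_mxEul ?block_mxEur ?block_mxEdl ?block_mxEdr.
Qed.

Lemma affine_row m n1 n2 (A : 'M[P_]_(m, n1)) (B : 'M_(m, n2)) :
  affine_mx A -> affine_mx B -> affine_mx (row_mx A B).
Proof.
by move=> hA hB i j; rewrite -(splitK j); case: (split j) => j'; rewrite /= ?row_mxEl ?row_mxEr.
Qed.

Lemma affine_col m1 m2 n (A : 'M[P_]_(m1, n)) (B : 'M_(m2, n)) :
  affine_mx A -> affine_mx B -> affine_mx (col_mx A B).
Proof.
by move=> hA hB i j; rewrite -(splitK i); case: (split i) => i'; rewrite /= ?col_mxEu ?col_mxEd.
Qed.

(* An algebraic branching program for p. *)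
Definition branching p := exists N (L L' : 'M[P_]_N) (c : 'rV_N) (b : 'cV_N),
  [/\ affine_mx L, affine_mx c & affine_mx b] /\
  [/\ L *m L' = 1%:M, \det L = 1 & (c *m L' *m b) 0 0 = p].

Lemma branchingC a : branching a%:MP.
Proof.
exists 1%N, 1%:M, 1%:M, 1%:M, (a%:MP)%:M; split; split; try exact: affine_mx1.
- by move=> i j; rewrite mxE !ord1 eqxx; apply: affineC.
- by rewrite mulmx1.
- by rewrite det1.
- by rewrite mulmx1 mul1mx mxE eqxx.
Qed.

Lemma branchingD p q : branching p -> branching q -> branching (p + q).
Proof.
move=> [N1 [L1 [I1 [c1 [b1 [[aL1 ac1 ab1] [LI1 d1 e1]]]]]]].
move=> [N2 [L2 [I2 [c2 [b2 [[aL2 ac2 ab2] [LI2 d2 e2]]]]]]].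
exists (N1 + N2)%N, (block_mx L1 0 0 L2), (block_mx I1 0 0 I2), (row_mx c1 c2), (col_mx b1 b2).
split; split.
- by apply: affine_block => //; apply: affine_mx0.
- exact: affine_row.
- exact: affine_col.
- by rewrite mulmx_block !(mulmx0, mul0mx, addr0, add0r) LI1 LI2 -scalar_mx_block.
- by rewrite det_ublock d1 d2 mulr1.
- by rewrite mul_row_block !(mulmx0, mul0mx, addr0, add0r) mul_row_col mxE e1 e2.
Qed.

(** Multiplying b by X_i would destroy affineness, so b moves into L as a new column. The inverse
    then contains - L' b, whose sign is cancelled by - X_i. *)
Lemma branchingMX p i : branching p -> branching ('X_i * p).
Proof.
move=> [N [L [L' [c [b [[aL ac ab] [LL' dL e]]]]]]].
exists (N + 1)%N, (block_mx L b 0 1%:M), (block_mx L' (- (L' *m b)) 0 1%:M), (row_mx c 0),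
  (col_mx 0 (- 'X_i)%:M).
split; split.
- by apply: affine_block => //; [apply: affine_mx0|apply: affine_mx1].
- by apply: affine_row => //; apply: affine_mx0.
- apply: affine_col; first exact: affine_mx0.
  by move=> k j; rewrite mxE !ord1 eqxx; apply/affineN/affineX.
- rewrite mulmx_block !(mulmx0, mul0mx, addr0, add0r, mulmx1) mulmxN mulmxA LL' mul1mx addNr.
  by rewrite -scalar_mx_block.
- by rewrite det_ublock dL det1 mulr1.
- rewrite mul_row_block !(mulmx0, mul0mx, addr0, add0r) mul_row_col mulmx0 add0r mul_mx_scalar.
  by rewrite mulmxN mulmxA scalerN scaleNr opprK mxE e.
Qed.

Lemma branching_all p : branching p.
Proof.
elim/mpolyind: p => [|a m p _ _ bp]; first by rewrite -mpolyC0; apply: branchingC.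
apply: branchingD => //; rewrite -mul_mpolyC mpolyXE_id mulrC.
elim/big_rec: _ => [|i q _ bq]; first by rewrite mul1r; apply: branchingC.
rewrite -mulrA; elim: (m i) => [|k IH]; first by rewrite expr0 mul1r.
by rewrite exprS -mulrA; apply: branchingMX.
Qed.

(** The determinant of the block matrix with rows (L, b) and (- c, 0) is det L times the Schur
    complement c L' b. The identity block makes arbitrarily large sizes available. *)
Lemma affine_det p : exists N, forall k, exists2 D : 'M[P_]_(N + k), affine_mx D & \det D = p.
Proof.
have [N [L [L' [c [b [[aL ac ab] [LL' dL e]]]]]]] := branching_all p.
exists (N + 1)%N => k; pose D := block_mx L b (- c) (0 : 'M_1).
have dD : \det D = p.
  have e' : D *m block_mx 1%:M (- (L' *m b)) 0 1%:M = block_mx L 0 (- c) (c *m L' *m b).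
    rewrite /D mulmx_block !(mulmx0, mul0mx, addr0, add0r, mulmx1) mulmxN mulmxA LL' mul1mx addNr.
    by rewrite mulNmx mulmxN opprK mulmxA.
  have := congr1 determinant e'; rewrite det_mulmx det_ublock !det1 !mulr1 => ->.
  by rewrite det_lblock dL mul1r det_mx11 e.
have aD : affine_mx D.
  apply: affine_block => //; last exact: affine_mx0.
  by move=> i j; rewrite mxE; apply: affineN.
exists (block_mx D 0 0 1%:M); last by rewrite det_ublock det1 mulr1.
by apply: affine_block => //; [apply: affine_mx0|apply: affine_mx0|apply: affine_mx1].
Qed.

End Universality.

Lemma free_delta (K : fieldType) M N (f : 'I_M -> 'I_N) : injective f ->
  free [seq (delta_mx 0 (f k) : 'rV[K]_N) | k <- enum 'I_M].
Proof.
move=> fi; have -> : [seq (delta_mx 0 (f k) : 'rV[K]_N) | k <- enum 'I_M]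
    = [tuple (delta_mx 0 (f k) : 'rV[K]_N) | k < M] by [].
have nE (j : 'I_M) : [seq (delta_mx 0 (f k) : 'rV[K]_N) | k <- enum 'I_M]`_j = delta_mx 0 (f j).
  by rewrite (nth_map j) ?size_enum_ord // nth_ord_enum.
apply/freeP => k h i; have /matrixP/(_ 0 (f i)) := h; rewrite summxE (bigD1 i) //= big1 ?addr0.
  by rewrite nE !mxE !eqxx mulr1.
by move=> j ji; rewrite nE !mxE (inj_eq fi) [i == j]eq_sym (negPf ji) mulr0.
Qed.

Lemma linform_delta (K : fieldType) N i : linform (delta_mx 0 i : 'rV[K]_N) = 'X_i.
Proof.
rewrite /linform (bigD1 i) //= big1 ?addr0 => [|k ki]; first by rewrite mxE !eqxx scale1r.
by rewrite mxE (negPf ki) andbF scale0r.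
Qed.

(** Homogenize an affine matrix D with det D = P: replacing constants by multiples of l gives l^n
    P(y / l) = l^(n - m) P(y). The size is taken large enough to have m < n and room for M + 1
    independent forms. *)
Lemma determinantal_representation (K : numFieldType) M m (P : {mpoly K[M]}) : P \is m.-homog ->
  exists n, (m < n)%N /\ exists2 Q : {mpoly K[n * n]}, padding m P Q
    & exists u : 'End('M[K]_n), Q = act u (det_form K n).
Proof.
move=> hP; have [N0 hN] := affine_det P; pose n := (N0 + (m + M).+1)%N.
have [D aD dD] := hN (m + M).+1; exists n; split; first by rewrite /n; lia.
have leMn : (M.+1 <= n * n)%N by rewrite /n; nia.
pose wid := widen_ord leMn.
pose l : 'rV[K]_(n * n) := delta_mx 0 (wid ord0).
pose y i : 'rV[K]_(n * n) := delta_mx 0 (wid (lift ord0 i)).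
exists (linform l ^+ (n - m) * (P \mPo [tuple linform (y i) | i < M])).
  exists l, y; split=> //; rewrite ifF; last by apply/negbTE; rewrite /n; lia.
  have := @free_delta K M.+1 (n * n) wid; rewrite enum_ordSl map_cons -map_comp; apply.
  by move=> a b /(congr1 val) /= e; apply: val_inj.
have /fin_all_exists[a0 /fin_all_exists[a ha]] : forall x : 'I_n * 'I_n, exists a0, exists a : 'rV[K]_M,
    D x.1 x.2 = a0%:MP + linform a by move=> [i j]; apply: aD.
pose h x : 'rV[K]_(n * n) := a0 x *: l + \sum_(k < M) a x 0 k *: y k.
pose val_at (v : 'rV[K]_(n * n)) (X : 'M[K]_n) := \sum_q v 0 q * mxvec X 0 q.
pose u0 (X : 'M[K]_n) : 'M[K]_n := \matrix_(i, j) val_at (h (i, j)) X.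
have u0lin : linear u0.
  move=> t X Y; apply/matrixP => i j; rewrite !mxE /val_at mulr_sumr -big_split /=.
  by apply: eq_bigr => q _; rewrite linearP !mxE; ring.
have [u uE] : exists u : 'End('M[K]_n), forall X, u X = u0 X.
  pose U0 : {linear 'M[K]_n -> 'M[K]_n} := HB.pack u0 (GRing.isLinear.Build _ _ _ _ u0 u0lin).
  by exists (linfun U0) => X; rewrite lfunE.
(* After multiplication by l, values need comparing only where l is nonzero, and there the y_i may
   be divided by l. *)
exists u; apply: (mulfI (x := linform l)).
  rewrite linform_delta; apply/eqP => /(congr1 (mcoeff U_(wid ord0)%MM)).
  by rewrite mcoeffXU eqxx mcoeff0 => /eqP; rewrite oner_eq0.
apply: mpoly_eq_value => v.
have pE (p : {mpoly K[n * n]}) : p.@[v] = p.@[mxvec (vec_mx (\row_q v q)) 0].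
  by apply: meval_eq => q; rewrite vec_mxK mxE.
rewrite !pE; set X := vec_mx _; rewrite !mevalM act_meval det_form_meval uE !linform_meval.
rewrite -/(val_at l X); set t := val_at l X.
have [->|t0] := eqVneq t 0; first by rewrite !mul0r.
congr (_ * _); rewrite rmorphXn /= linform_meval -/(val_at l X) -/t comp_mpoly_meval.
pose z i := val_at (y i) X.
have -> : P.@[fun i => (tnth [tuple linform (y i) | i < M] i).@[mxvec X 0]] = t ^+ m * P.@[fun i => t^-1 * z i].
  rewrite (meval_homog _ _ hP) mulrA -exprMn mulfV // expr1n mul1r.
  by apply: meval_eq => i; rewrite tnth_mktuple linform_meval.
rewrite mulrA -exprD subnK; last by rewrite /n; lia.
rewrite -dD -det_map_mx -detZ; congr (\det _); apply/matrixP => i j.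
rewrite !mxE (ha (i, j)) /= mevalD mevalC linform_meval /val_at.
under [RHS]eq_bigr do rewrite mxE summxE.
under [RHS]eq_bigr do rewrite mulrDl mulr_suml.
rewrite big_split mulrDr; congr (_ + _).
  rewrite mulrC mulr_sumr; under [RHS]eq_bigr do rewrite mxE -mulrA.
  by rewrite -mulr_sumr [RHS]/= /t /val_at mulr_sumr.
rewrite exchange_big mulr_sumr; apply: eq_bigr => k _ /=.
rewrite mulrCA [t * _]mulVKf // /z /val_at mulr_sumr; apply: eq_bigr => q _.
by rewrite [(a _ 0 k *: y k) 0 q]mxE mulrA.
Qed.

(** * Orbits and orbit closures of forms *)

Lemma homog_of_values (K : numFieldType) N d (p : {mpoly K[N]}) :
  (forall t v, t != 0 -> p.@[fun i => t * v i] = t ^+ d * p.@[v]) -> p \is d.-homog.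
Proof.
move=> h; rewrite (pihomog_partition p); apply: rpred_sum => e _.
have [<-|ed] := eqVneq (e : nat) d; first exact: pihomogP.
suff -> : pihomog mdeg e p = 0 by apply: rpred0.
apply: mpoly_eq_value => v; rewrite meval0.
pose q : {poly K} := \sum_(f < msize p) ((pihomog mdeg f p).@[v])%:P * 'X^f - (p.@[v])%:P * 'X^d.
have q0 : q = 0.
  apply: poly_eq0_off0 => t t0; apply/eqP; rewrite hornerD hornerN hornerM hornerC hornerXn.
  rewrite subr_eq0 mulrC -h // [X in _ == X.@[_]](pihomog_partition p) horner_sum raddf_sum /=.
  apply/eqP/eq_bigr => f _.
  by rewrite (meval_homog _ _ (pihomogP _ _ _)) hornerM hornerC hornerXn mulrC.
have := congr1 (fun q : {poly K} => q`_e) q0; rewrite coefB coefCM coefXn (negPf ed) mulr0 subr0 coef0.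
rewrite coef_sum (bigD1 e) //= coefCM coefXn eqxx mulr1 big1 ?addr0 => [//|f fe].
by rewrite coefCM coefXn; case: eqP => [de|_]; rewrite ?mulr0 //; case/eqP: fe; apply: val_inj.
Qed.

Section LinearAction.
Variables (K : numFieldType) (N : nat).
Implicit Types (G H : 'M[K]_N) (P Q : {mpoly K[N]}) (x : 'rV[K]_N).

Definition actm G P := P \mPo [tuple linform (col k G)^T | k < N].

Lemma actm_meval G P x : (actm G P).@[x 0] = P.@[(x *m G) 0].
Proof.
rewrite /actm comp_mpoly_meval; apply: meval_eq => k.
rewrite tnth_mktuple linform_meval mxE; apply: eq_bigr => j _; by rewrite !mxE mulrC.
Qed.

Lemma meval_row P v : P.@[v] = P.@[(\row_i v i : 'rV_N) 0].
Proof. by apply: meval_eq => i; rewrite mxE. Qed.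

Lemma mpoly_eq_row P Q : (forall x, P.@[x 0] = Q.@[x 0]) -> P = Q.
Proof. by move=> h; apply: mpoly_eq_value => v; rewrite !(meval_row _ v). Qed.

Lemma meval_homog_row d P t x : P \is d.-homog -> P.@[(t *: x) 0] = t ^+ d * P.@[x 0].
Proof. by move=> hP; rewrite -(meval_homog _ _ hP); apply: meval_eq => i; rewrite mxE. Qed.

Lemma homog_of_rows d P : (forall t x, P.@[(t *: x) 0] = t ^+ d * P.@[x 0]) -> P \is d.-homog.
Proof.
move=> h; apply: homog_of_values => t v t0; rewrite (meval_row _ v) -h.
by apply: meval_eq => i; rewrite !mxE.
Qed.

Lemma actm_homog d G P : P \is d.-homog -> actm G P \is d.-homog.
Proof.
move=> hP; apply: homog_of_rows => t x.
by rewrite !actm_meval -scalemxAl (meval_homog_row _ _ hP).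
Qed.

Lemma actm_mul G H P : actm G (actm H P) = actm (G *m H) P.
Proof. by apply: mpoly_eq_row => x; rewrite !actm_meval mulmxA. Qed.

Lemma actm1 P : actm 1%:M P = P.
Proof. by apply: mpoly_eq_row => x; rewrite actm_meval mulmx1. Qed.

Lemma actmD G P Q : actm G (P + Q) = actm G P + actm G Q.
Proof. by rewrite /actm raddfD. Qed.

Lemma actmZ G t P : actm G (t *: P) = t *: actm G P.
Proof. by rewrite /actm comp_mpolyZ. Qed.

Lemma actm_scale d G t P : P \is d.-homog -> actm (t *: G) P = t ^+ d *: actm G P.
Proof.
move=> hP; apply: mpoly_eq_row => x; rewrite mevalZ !actm_meval -scalemxAr.
by rewrite (meval_homog_row _ _ hP).
Qed.

Lemma actm_neq0 G P : G \in unitmx -> P != 0 -> actm G P != 0.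
Proof.
move=> Gu; apply: contraNneq => /(congr1 (actm (invmx G))).
by rewrite actm_mul mulVmx // actm1 /actm comp_mpoly0 => ->.
Qed.

Lemma polyfam_actm s (G : ('I_s -> K) -> 'M[K]_N) P :
  (forall i j, polyfun (fun v => G v i j)) -> polyfam (fun v => actm (G v) P).
Proof.
move=> hG; apply: (@polyfam_comp _ _ _ _ P (fun k v => linform (col k (G v))^T)) => k.
apply: polyfam_linform => j; apply: eq_polyfun (hG j k) => v; by rewrite !mxE.
Qed.

Lemma actm_taylor G P : exists R : {poly {mpoly K[N]}}, forall t,
  actm (1%:M + t *: G) P
    = P + t *: dir_deriv (fun k => linform (col k G)^T) P + t ^+ 2 *: R.[t%:MP].
Proof.
have [R hR] := taylor1 (fun k => linform (col k G)^T) P; exists R => t; rewrite -hR.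
congr (_ \mPo _); apply: eq_from_tnth => k; rewrite !tnth_mktuple.
apply: mpoly_eq_row => x; rewrite mevalD mevalZ mevalXU !linform_meval mulr_sumr.
rewrite (eq_bigr (fun j => (j == k)%:R * x 0 j + t * (((col k G)^T) 0 j * x 0 j))) => [|j _].
  rewrite big_split /= (bigD1 k) //= big1 ?addr0 => [|j jk]; last by rewrite (negPf jk) mul0r.
  by rewrite eqxx mul1r.
by rewrite !mxE mulrDl mulrA.
Qed.

End LinearAction.

Section EndActions.
Variables (K : numFieldType) (n : nat).

Lemma actE (u : 'End('M[K]_n)) P : act u P = actm (lin_mx u) P.
Proof. by []. Qed.

Lemma end_of_mx (G : 'M[K]_(n * n)) : exists u : 'End('M[K]_n),
  lin_mx u = G /\ forall X, u X = vec_mx (mxvec X *m G).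
Proof.
pose u : 'End('M[K]_n) := linfun (vec_mx \o mulmxr G \o mxvec).
have h X : u X = vec_mx (mxvec X *m G) by rewrite lfunE.
exists u; split=> //; apply/row_matrixP => i; rewrite !rowE; set x := delta_mx _ _.
by rewrite -[x]vec_mxK mul_vec_lin /= h !vec_mxK.
Qed.

Lemma lin_mx_unit (u : 'End('M[K]_n)) : (lker u = 0%VS) <-> (lin_mx u \in unitmx).
Proof.
split=> [/eqP k0|uu].
  have /mulmx1_unit[] // : lin_mx (u^-1)%VF *m lin_mx u = 1%:M.
  apply/row_matrixP => i; rewrite !rowE mulmx1 mulmxA; set x := delta_mx _ _.
  by rewrite -[x]vec_mxK !mul_vec_lin /= lker0_lfunVK.
apply/eqP/lker0P => X Y e; apply: (can_inj mxvecK).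
have := congr1 mxvec e; rewrite -!mul_vec_lin => /(congr1 (mulmx^~ (invmx (lin_mx u)))) /=.
by rewrite !mulmxK.
Qed.

End EndActions.

Section OrbitClosure.
Variables (K : numClosedFieldType) (n : nat).
Hypothesis n_gt0 : (0 < n)%N.
Local Notation N := (n * n)%N.
Implicit Types (G H : 'M[K]_N) (Q : {mpoly K[N]}).

Section OneForm.
Variable P : {mpoly K[N]}.
Hypothesis P_neq0 : P != 0.
Hypothesis P_homog : P \is n.-homog.

Let Gv (v : 'I_(N * N) -> K) : 'M[K]_N := vec_mx (\row_i v i).
Let phi v := actm (Gv v) P.
Let delta v := \det (Gv v).

Let GvE v i j : Gv v i j = v (mxvec_index i j). Proof. by rewrite !mxE. Qed.

Let Gv_surj G : exists v, Gv v = G.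
Proof. by exists (mxvec G 0); apply/matrixP => i j; rewrite GvE mxvecE. Qed.

Let hphi : polyfam phi.
Proof.
apply: polyfam_actm => i j; apply: eq_polyfun (polyfun_coord _ (mxvec_index i j)) => v.
by rewrite GvE.
Qed.

Let hdelta : polyfun delta.
Proof.
apply: polyfun_det => i j; apply: eq_polyfun (polyfun_coord _ (mxvec_index i j)) => v.
by rewrite GvE.
Qed.

(** The projective factor is absorbed into G by an n-th root, since P has degree n. *)
Lemma GL_orbitP Q : GL_orbit P Q <-> exists2 G, G \in unitmx & Q = actm G P.
Proof.
split.
  move=> [g /lin_mx_unit gu [_ [c c0 ->]]].
  exists (n.-root c *: lin_mx g).
    by rewrite unitmxZ // unitfE rootC_eq0.
  by rewrite (actm_scale _ _ P_homog) rootCK.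
move=> [G Gu ->]; have [u [uG _]] := end_of_mx G.
exists u; first by apply/lin_mx_unit; rewrite uG.
rewrite actE uG; split; first exact: actm_neq0.
by exists 1; rewrite ?oner_eq0 ?scale1r.
Qed.

Let orbitE : GL_orbit P = param_set phi delta.
Proof.
apply/funext => Q; apply/propext; rewrite GL_orbitP; split.
  move=> [G Gu ->]; have [v vG] := Gv_surj G; exists v; rewrite ?/delta ?/phi vG //.
  by rewrite -unitfE -unitmxE.
by move=> [v dv ->]; exists (Gv v) => //; rewrite unitmxE unitfE.
Qed.

Let phi_homog v : phi v \is n.-homog. Proof. exact: actm_homog. Qed.

Let phi_proj v : delta v != 0 -> proj_point n (phi v).
Proof. by move=> dv; split=> //; apply: actm_neq0 => //; rewrite unitmxE unitfE. Qed.

Let delta0 : exists v, delta v != 0.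
Proof. by have [v vG] := Gv_surj 1%:M; exists v; rewrite /delta vG det1 oner_eq0. Qed.

Let orbit_conic : conic (param_set phi delta).
Proof.
rewrite -orbitE => t Q t0 /GL_orbitP[G Gu ->]; apply/GL_orbitP.
exists (n.-root t *: G); first by rewrite unitmxZ // unitfE rootC_eq0.
by rewrite (actm_scale _ _ P_homog) rootCK.
Qed.

Lemma GL_orbit_conic : conic (GL_orbit P). Proof. by rewrite orbitE. Qed.

Lemma GL_orbit_proj : psub (GL_orbit P) (proj_point n).
Proof. by rewrite orbitE; apply: param_set_proj. Qed.

Lemma GL_orbit_refl : GL_orbit P P.
Proof. by apply/GL_orbitP; exists 1%:M; rewrite ?unitmx1 ?actm1. Qed.

Lemma GL_closure_closed : zclosed n (GL_closure P).
Proof. exact: zclosed_zclosure GL_orbit_proj. Qed.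

Lemma GL_closure_irreducible : irreducible n (GL_closure P).
Proof.
apply: irreducible_zclosure; first exact: GL_orbit_proj.
by rewrite orbitE; apply: param_set_irreducible.
Qed.

Lemma GL_closure_open : exists f, [/\ exists e : nat, f \is e.-homog,
    exists2 Q, GL_orbit P Q & f.@[@coefs K N n Q] != 0
  & forall Q, GL_closure P Q -> f.@[@coefs K N n Q] != 0 -> GL_orbit P Q].
Proof.
have [f [fe [v [dv fv]] h]] :=
  param_set_open hphi hdelta phi_proj phi_homog delta0 orbit_conic.
exists f; rewrite /GL_closure orbitE; split=> //.
by exists (phi v) => //; exists v.
Qed.

Lemma vanishes_GL_closure f : vanishes (d := n) f (GL_orbit P) -> vanishes (d := n) f (GL_closure P).
Proof. apply: vanishes_zclosure; [exact: GL_orbit_proj|exact: GL_orbit_conic]. Qed.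

Lemma GL_closureP Q : GL_closure P Q <-> proj_point n Q /\
  forall f, (exists e : nat, f \is e.-homog) -> vanishes (d := n) f (GL_orbit P) -> f.@[@coefs K N n Q] = 0.
Proof. exact: zclosureP GL_orbit_proj. Qed.

Lemma GL_closure_stable G Q : G \in unitmx -> GL_closure P Q -> GL_closure P (actm G Q).
Proof.
move=> Gu cQ; have [[Q0 hQ] _] := (GL_closureP Q).1 cQ.
apply/GL_closureP; split; first by split; [exact: actm_neq0|exact: actm_homog].
move=> f _ fP; have [g gE] := pullback_linear f (actmD G) (actmZ G).
rewrite -gE //; apply: (vanishes_GL_closure _ cQ) => Q' /[dup] oQ' /GL_orbitP[H Hu e].
rewrite gE; last by case: (GL_orbit_proj oQ').
apply: fP; apply/GL_orbitP; exists (G *m H); first by rewrite unitmx_mul Gu.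
by rewrite e actm_mul.
Qed.

End OneForm.

Variables (P R : {mpoly K[N]}).
Hypotheses (P_neq0 : P != 0) (P_homog : P \is n.-homog).
Hypotheses (R_neq0 : R != 0) (R_homog : R \is n.-homog).

Lemma GL_closure_psub : GL_closure P R -> psub (GL_closure R) (GL_closure P).
Proof.
move=> cR; apply: zclosure_min; first exact: GL_closure_closed.
move=> Q /(GL_orbitP R_neq0 R_homog)[G Gu ->]; exact: GL_closure_stable.
Qed.

(** If the closure of the orbit of R met the orbit of P, it would contain the closure of that orbit,
    so the two closures would be equal. The orbit of R, being open in its closure, would then meet
    the dense orbit of P. *)
Lemma GL_orbit_disjoint_closure : GL_closure P R -> ~ GL_orbit P R ->
  forall Q, GL_closure R Q -> ~ GL_orbit P Q.
Proof.
move=> cR nR Q cQ /[dup] oQ /(GL_orbitP P_neq0 P_homog)[G Gu e].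
have [f [fe [R1 oR1 fR1] fopen]] := GL_closure_open R_neq0 R_homog.
have PR : psub (GL_closure P) (GL_closure R).
  apply: zclosure_min; first exact: GL_closure_closed.
  move=> Q' /(GL_orbitP P_neq0 P_homog)[H Hu ->].
  have -> : actm H P = actm (H *m invmx G) Q by rewrite e actm_mul mulmxKV.
  by apply: GL_closure_stable => //; rewrite unitmx_mul Hu unitmx_inv.
have [Q1 oQ1 fQ1] : exists2 Q1, GL_orbit P Q1 & f.@[@coefs K N n Q1] != 0.
  apply: contrapT => h; case/eqP: fR1.
  have vf : vanishes (d := n) f (GL_orbit P).
    by move=> Q1 oQ1; apply: contrapT => /eqP ne; apply: h; exists Q1.
  apply: (vanishes_GL_closure P_neq0 P_homog vf).
  have /(GL_orbitP R_neq0 R_homog)[H Hu ->] := oR1.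
  exact: GL_closure_stable.
have := fopen Q1 (PR _ (zclosure_sub oQ1)) fQ1.
move=> /(GL_orbitP R_neq0 R_homog)[H Hu e1]; apply: nR.
move: oQ1 => /(GL_orbitP P_neq0 P_homog)[H' Hu' e2]; apply/(GL_orbitP P_neq0 P_homog).
exists (invmx H *m H'); first by rewrite unitmx_mul unitmx_inv Hu.
by rewrite -actm_mul -e2 e1 actm_mul mulVmx // actm1.
Qed.

End OrbitClosure.

(** * Dimensions of the two orbit closures *)

Section DetAndPLambda.
Variables (K : numClosedFieldType) (m : nat).
Local Notation n := m.+1.
Local Notation N := (n * n)%N.
Local Notation dF := (det_form K n).
Local Notation PL := (PLambda K n).
Local Notation "f .[% p ]" := (f.@[@coefs K N n p]) (at level 2, format "f .[%  p ]").
Implicit Types (G H : 'M[K]_N) (M X : 'M[K]_n).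

Lemma mpoly_eq_mx (P Q : {mpoly K[N]}) : (forall M, P.@[mxvec M 0] = Q.@[mxvec M 0]) -> P = Q.
Proof. by move=> h; apply: mpoly_eq_row => x; rewrite -[x]vec_mxK. Qed.

Lemma actm_meval_mx G (P : {mpoly K[N]}) M : (actm G P).@[mxvec M 0] = P.@[mxvec (vact G M) 0].
Proof. by rewrite actm_meval /vact vec_mxK. Qed.

Lemma det_form_homog : dF \is n.-homog.
Proof.
by apply: homog_of_rows => t x; rewrite -[x]vec_mxK -linearZ !det_form_meval detZ.
Qed.

Lemma det_form_neq0 : dF != 0.
Proof.
apply/eqP => /(congr1 (meval (mxvec (1%:M : 'M[K]_n) 0))); rewrite det_form_meval det1 meval0.
by move/eqP; rewrite oner_eq0.
Qed.

Lemma PLambda_value M : PL.@[mxvec M 0] = n%:R^-1 * tr_form M.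
Proof. by rewrite PLambda_meval ?PLambda_atE //; apply: pchar_num. Qed.

Hypothesis em : ~~ odd m.

Lemma PLambda_homog : PL \is n.-homog.
Proof.
apply: homog_of_rows => t x; rewrite -[x]vec_mxK -linearZ !PLambda_value mulrCA; congr (_ * _).
set M := vec_mx x; have sS := sym_part_symm M; have sA : skew (skew_part M) := skew_part_skew M.
have -> : t *: M = t *: (skew_part M + sym_part M) + 0 by rewrite addr0 -skew_sym_partE.
rewrite tr_form_scale //; last exact: symm0.
rewrite -skew_sym_partE addr0 /= [tr_form (skew_part M)](_ : _ = 0).
  by rewrite addr0 mulrA -exprSr.
by rewrite -[skew_part M]addr0 tr_formE ?mulmx0 ?mxtrace0 //; apply: symm0.
Qed.

Lemma PLambda_neq0 : PL != 0.
Proof.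
have [J hJ] := std_skew_exists K em.
apply/eqP => e; have sE : symm (delta_mx ord0 ord0 : 'M[K]_n) by rewrite /symm trmx_delta.
have := PLambda_value (J + delta_mx ord0 ord0); rewrite e meval0 tr_formE //; last exact: std_skew_skew hJ.
rewrite (adj_std_skew hJ em) -scalemxAl mul_delta_mx mxtraceZ.
have -> : \tr (delta_mx ord0 ord0 : 'M[K]_n) = 1.
  rewrite /mxtrace (bigD1 ord0) //= big1 ?addr0 => [|i i0]; rewrite mxE ?eqxx //.
  by rewrite (negPf i0).
by move/esym/eqP; rewrite mulr1 mulf_eq0 invr_eq0 pnatr_eq0 (negPf (kap_neq0 hJ)).
Qed.

(** The factor 1/2 is a scalar of K, so that it passes through evaluation directly. *)
Let gskew : 'M[{mpoly K[N]}]_n :=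
  \matrix_(i, j) (2^-1 *: ('X_(mxvec_index i j) - 'X_(mxvec_index j i))).
Let gsym : 'M[{mpoly K[N]}]_n :=
  \matrix_(i, j) (2^-1 *: ('X_(mxvec_index i j) + 'X_(mxvec_index j i))).
Let pencil := \det (lin_mx_poly gskew gsym).

Let pencil_value M : map_poly (meval (mxvec M 0)) pencil = \det (lin_mx_poly (skew_part M) (sym_part M)).
Proof.
rewrite -det_map_mx; congr (\det _); apply/matrixP => i j.
rewrite mxE !lin_mx_polyE !mxE rmorphD rmorphM /= !map_polyC map_polyX /=.
by rewrite !mevalZ mevalB mevalD !mevalXU !mxvecE.
Qed.

Let pencil_coef M k : (pencil`_k).@[mxvec M 0] = (\det (lin_mx_poly (skew_part M) (sym_part M)))`_k.
Proof. by rewrite -pencil_value coef_map. Qed.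

(* det (A + t S) = t (n P_Lambda + O(t)), since a skew matrix of odd size is singular. *)
Lemma PLambda_in_GL_closure : GL_closure dF PL.
Proof.
apply/(GL_closureP (isT : (0 < n)%N) det_form_neq0 det_form_homog).
split; first by split; [exact: PLambda_neq0|exact: PLambda_homog].
move=> f [e fe] fdet.
have q0 : pencil`_0 = 0.
  apply: mpoly_eq_mx => M; rewrite pencil_coef det_lin_coef0 meval0.
  by apply: det_skew_odd; rewrite ?pnatr_eq0 //= ?em //; apply: skew_part_skew.
have q1 : pencil`_1 = n%:R *: PL.
  apply: mpoly_eq_mx => M; rewrite pencil_coef det_lin_coef1 mevalZ PLambda_value mulVKf //.
  by rewrite pnatr_eq0.
suff : f.[% pencil`_1] = 0.
  rewrite q1 (coefsZ_homog _ _ fe) => /eqP; rewrite mulf_eq0 expf_eq0 pnatr_eq0 andbF => /eqP //.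
(* Shifted by one, the coefficients of the pencil are those of det(A + t S) / t, whose value at t =
   0 is n P_Lambda. *)
apply: (@limit_zero _ _ _ (size pencil) (fun k => pencil`_k.+1)) => t t0.
have [u uE] : exists u : 'End('M[K]_n), forall M, u M = skew_part M + t *: sym_part M.
  pose u0 M := skew_part M + t *: sym_part M.
  have u0lin : linear u0.
    by move=> a X Y; rewrite /u0 /skew_part /sym_part; apply/matrixP => i j; rewrite !mxE; ring.
  pose U0 : {linear 'M[K]_n -> 'M[K]_n} := HB.pack u0 (GRing.isLinear.Build _ _ _ _ u0 u0lin).
  by exists (linfun U0) => X; rewrite lfunE.
have ku : lker u = 0%VS.
  apply/eqP/lker0P => X Y; rewrite !uE => eXY.
  have sk : skew_part X = skew_part Y.
    have := congr1 (@skew_part K n) eXY.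
    have h Z : skew_part (skew_part Z + t *: sym_part Z) = skew_part Z.
      by apply/matrixP => i j; rewrite !mxE; field.
    by rewrite !h.
  move: eXY; rewrite sk => /addrI /(scalerI t0) ss.
  by rewrite (skew_sym_partE X) sk ss -skew_sym_partE.
have -> : \sum_(k < (size pencil).+1) t ^+ k *: pencil`_k.+1 = t^-1 *: act u dF.
  apply: mpoly_eq_mx => M; rewrite mevalZ act_meval det_form_meval uE raddf_sum /=.
  apply: (mulfI t0); rewrite mulVKf // -lin_mx_poly_horner.
  rewrite -[map_mx _ _]/(map_mx (horner_eval t) _) det_map_mx /horner_eval /= -pencil_value.
  have sz : (size (map_poly (meval (mxvec M 0)) pencil)%R <= (size pencil).+2)%N.
    by do 2 apply: leqW; exact: size_poly.
  rewrite -[RHS]/((map_poly (meval (mxvec M 0)) pencil).[t]) (horner_coef_wide _ sz).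
  rewrite [RHS]big_ord_recl coef_map /= q0 meval0 mul0r add0r mulr_sumr.
  by apply: eq_bigr => k _; rewrite mevalZ coef_map /= /bump /= exprS [RHS]mulrC mulrA.
rewrite (coefsZ_homog _ _ fe) fdet ?mulr0 //; exists u => //; split.
  rewrite actE; apply: actm_neq0 det_form_neq0; exact/lin_mx_unit.
by exists 1; rewrite ?oner_eq0 ?scale1r.
Qed.

Lemma PLambda_not_End : (1 < m)%N -> ~ End_orbit dF PL.
Proof.
move=> m1 [u [_ [c c0 e]]]; have [J hJ] := std_skew_exists K em.
apply: (det_not_tr_form em m1 hJ (u := u) (c := n%:R * c)).
  by rewrite mulf_neq0 // pnatr_eq0.
move=> M; have := PLambda_value M; rewrite e mevalZ act_meval det_form_meval => h.
by rewrite -mulrA h mulVKf // pnatr_eq0.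
Qed.

Lemma actm_two_sided A B G : \det A * \det B = 1 -> actm (two_sided A G B) dF = actm G dF.
Proof.
move=> dAB; apply: mpoly_eq_mx => M; rewrite !actm_meval_mx two_sided_vact !det_form_meval.
by rewrite !det_mulmx mulrAC dAB mul1r.
Qed.

(** The relation is found on the parametrized normal forms. As a function of the matrix it is
    polynomial on lines and invariant under [two_sided], so [normal_form_dense] extends it to all
    matrices. *)
Lemma det_closure_dependent q (H : 'I_q -> {mpoly K[#|{: 'X_{1..N < n.+1}}|]}) :
  (0 < m)%N -> (#|{: free_entries m}|.+1 < q)%N ->
  exists2 G : {mpoly K[q]}, G != 0 & forall p, GL_closure dF p -> G.@[fun i => (H i).[% p]] = 0.
Proof.
move=> m0 lt; have [Phi [hPhi Phi_nf]] := normal_form_parametrized K m0.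
have polyH (h : {mpoly K[#|{: 'X_{1..N < n.+1}}|]}) s (Gv : ('I_s -> K) -> 'M[K]_N) : (forall p q, polyfun (fun v => Gv v p q)) ->
    polyfun (fun v => h.[% actm (Gv v) dF]).
  move=> hG; apply: polyfun_meval => j.
  exact: (polyfam_actm dF hG (bmnm (enum_val j))).
have /fin_all_exists[F hF] : forall i, exists F, forall v, (H i).[% actm (Phi v) dF] = F.@[v].
  by move=> i; apply: polyH.
have [G G0 hG] := mpoly_dependent F lt.
exists G => //; pose f := G \mPo [tuple H i | i < q].
have fE p : f.[% p] = G.@[fun i => (H i).[% p]].
  by rewrite comp_mpoly_meval; apply: meval_eq => i; rewrite tnth_mktuple.
suff van : vanishes (d := n) f (GL_orbit dF).
  by move=> p cp; rewrite -fE; exact: (vanishes_GL_closure (isT : (0 < n)%N) det_form_neq0 det_form_homog van cp).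
move=> _ /(GL_orbitP (isT : (0 < n)%N) det_form_neq0 det_form_homog)[G1 _ ->].
apply: (@normal_form_dense K m m0 (fun G1 => f.[% actm G1 dF])).
- move=> G2 G3; pose Gv (v : 'I_(N * N) -> K) : 'M[K]_N := vec_mx (\row_i v i).
  have hGv : polyfun (fun v => f.[% actm (Gv v) dF]).
    apply: polyH => a b.
    by apply: eq_polyfun (polyfun_coord _ (mxvec_index a b)) => v; rewrite !mxE.
  have [r rE] := polyfun_line (mxvec G2 0) (mxvec G3 0) hGv; exists r => t; rewrite rE.
  suff -> : Gv (fun i => mxvec G2 0 i + t * mxvec G3 0 i) = G2 + t *: G3 by [].
  by apply/matrixP => a b; rewrite !mxE !mxvecE.
- by move=> A B G2 dAB; rewrite actm_two_sided.
- move=> G2 /Phi_nf[v ->]; rewrite fE -[RHS](hG v); apply: meval_eq => i; exact: hF.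
Qed.

End DetAndPLambda.

(** * The tangent space of the orbit of P_Lambda *)

Section TangentSpace.
Variables (K : numClosedFieldType) (m : nat).
Local Notation n := m.+1.
Local Notation N := (n * n)%N.
Local Notation c := #|{: 'X_{1..N < n.+1}}|.
Local Notation PL := (PLambda K n).
Local Notation co := (@coefs K N n).
Local Notation "f .[% p ]" := (f.@[co p]) (at level 2, format "f .[%  p ]").
Implicit Types (G : 'M[K]_N) (M X : 'M[K]_n) (v : 'rV[K]_(N * N)).
Hypotheses (em : ~~ odd m) (m_gt1 : (1 < m)%N).

Definition tangent G P : {mpoly K[N]} := dir_deriv (fun k => linform (col k G)^T) P.

Lemma linform_linear N' (a : K) (x y : 'rV[K]_N') : linform (a *: x + y) = a *: linform x + linform y.
Proof.
rewrite /linform scaler_sumr -big_split /=; apply: eq_bigr => k _.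
by rewrite !mxE scalerDl scalerA.
Qed.

Lemma tangent_linear P : linear (tangent^~ P).
Proof.
move=> a G H; rewrite /tangent /dir_deriv scaler_sumr -big_split /=; apply: eq_bigr => k _.
by rewrite !linearP /= linform_linear mulrDr scalerAr.
Qed.

Lemma dhomog_mderiv N' d (P : {mpoly K[N']}) k : P \is d.+1.-homog -> P^`M(k) \is d.-homog.
Proof.
move=> hP; apply/dhomogP => e; rewrite mcoeff_msupp mcoeff_deriv => ne.
have : (e + U_(k))%MM \in msupp P by rewrite mcoeff_msupp; apply: contraNneq ne => ->; rewrite mul0rn.
by move/(dhomogP _ _ _ hP) => /=; rewrite mdegD mdeg1 addn1 => -[].
Qed.

Lemma dhomog_linform N' (a : 'rV[K]_N') : linform a \is 1.-homog.
Proof. by apply: rpred_sum => k _; apply: rpredZ; rewrite dhomogX /= mdeg1. Qed.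

Lemma tangent_homog G d (P : {mpoly K[N]}) : P \is d.+1.-homog -> tangent G P \is d.+1.-homog.
Proof.
move=> hP; apply: rpred_sum => k _; rewrite -[d.+1]addn1; apply: dhomogM; last exact: dhomog_linform.
exact: dhomog_mderiv.
Qed.

(** By Taylor expansion, n P_Lambda along M + t G(M) is its value at t = 0 plus a multiple of t^2,
    so its coefficient of t is 0. *)
Lemma PLambda_tangent_annihilates G : tangent G PL = 0 -> annihilates (vact G).
Proof.
move=> G0 A S sA sS; set X := vact G (A + S).
have [R hR] := actm_taylor G PL.
pose r := map_poly (meval (mxvec (A + S) 0)) R.
set q : {poly K} := \tr _.
suff -> : q = (\tr (\adj A *m S))%:P + 'X^2 * (n%:R *: r).
  by rewrite coefD coefC mulrC coefMXn addr0.
apply/eqP; rewrite -subr_eq0; apply/eqP/poly_eq0_off0 => t _.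
rewrite hornerD hornerN hornerD hornerC hornerM hornerXn hornerZ.
have -> : q.[t] = tr_form (A + S + t *: X).
  rewrite -[LHS]/(horner_eval t q) /q -trace_map_mx map_mxM map_mx_adj !lin_mx_poly_horner.
  rewrite -tr_formE; last 2 first.
  - by rewrite /skew linearD linearZ /= sA (_ : _^T = - skew_part X) ?scalerN ?opprD //; exact: skew_part_skew.
  - by rewrite /symm linearD linearZ /= sS (_ : _^T = sym_part X) //; exact: sym_part_symm.
  by congr tr_form; rewrite {3}(skew_sym_partE X) scalerDr addrACA.
have n0 : n%:R != 0 :> K by rewrite pnatr_eq0.
have valE M : tr_form M = n%:R * PL.@[mxvec M 0] by rewrite PLambda_value mulVKf.
have := congr1 (meval (mxvec (A + S) 0)) (hR t).
rewrite actm_meval_mx -/(tangent G PL) G0 scaler0 addr0 mevalD mevalZ.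
have -> : vact (1%:M + t *: G) (A + S) = A + S + t *: X.
  by rewrite /X /vact mulmxDr mulmx1 -scalemxAr linearD linearZ /= mxvecK.
have -> : R.[t%:MP_[N]].@[mxvec (A + S) 0] = r.[t].
  by rewrite /r -[in RHS](mevalC (mxvec (A + S) 0) t) horner_map.
by rewrite valE => ->; rewrite -tr_formE // valE; ring.
Qed.

Let tangent_row v : 'rV[K]_c := \row_i co (tangent (vec_mx v) PL) i.

Let tangent_row_linear : linear tangent_row.
Proof.
move=> a v w; apply/rowP => i.
by rewrite !mxE linearP /= tangent_linear /coefs mcoeffD mcoeffZ.
Qed.

HB.instance Definition _ := GRing.isLinear.Build _ _ _ _ tangent_row tangent_row_linear.

(** The matrix of G |-> [tangent G PL]; its rank is the dimension of the tangent space at P_Lambda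
    to the cone over the orbit. *)
Let Dmx : 'M[K]_(N * N, c) := lin1_mx tangent_row.

Let DmxE v i : (v *m Dmx) 0 i = co (tangent (vec_mx v) PL) i.
Proof. by rewrite mul_rV_lin1 mxE. Qed.

(* Indices of the 2n^2 - 1 conditions in annihilator_trivial. *)
Let cond_index := {x : 'I_n * 'I_n + 'I_n * 'I_n | x != inl (ord0, ord0)}.

Let skew_unit i j : 'M[K]_n := delta_mx i j - delta_mx j i.

(** The diagonal pairs (j, j) with j != 0 encode [cond_row0]. The entry of the image of 0 only makes
    each case a sum of two entries, which [cond_sum] treats alike. *)
Let cond (x : cond_index) v : K := match val x with
  | inl (i, j) => if i == j
      then vact (vec_mx v) (skew_unit ord0 j) ord0 j + vact (vec_mx v) (skew_unit ord0 j) j ord0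
      else vact (vec_mx v) (skew_unit i j) j j + vact (vec_mx v) 0 j j
  | inr (k, l) => vact (vec_mx v) (delta_mx l l) k l + vact (vec_mx v) (delta_mx l l) l k
  end.

Let vact_sum v X i j :
  vact (vec_mx v) X i j = \sum_t v 0 t * vact (vec_mx (delta_mx 0 t)) X i j.
Proof.
rewrite /vact {1}(row_sum_delta v) linear_sum mulmx_sumr linear_sum summxE.
by apply: eq_bigr => t _; rewrite linearZ -scalemxAr linearZ mxE.
Qed.

Let cond_sum x v : cond x v = \sum_t v 0 t * cond x (delta_mx 0 t).
Proof.
rewrite /cond; case: (val x) => [[i j]|[i j]]; first case: eqP => _.
all: rewrite !(vact_sum v) -big_split /=; apply: eq_bigr => t _; by rewrite mulrDr.
Qed.

Lemma card_cond_index : #|{: cond_index}| = (2 * n ^ 2).-1.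
Proof. by rewrite card_sig cardC1 card_sum !card_prod !card_ord mulnn mul2n addnn. Qed.

(** Otherwise the rank many equations for v [Dmx] = 0, together with the 2n^2 - 1 conditions, would
    be fewer than the n^4 unknowns, and [annihilator_trivial] would be contradicted. *)
Lemma tangent_rank : (#|{: free_entries m}| <= \rank Dmx)%N.
Proof.
have [J hJ] := std_skew_exists K em; have m0 := ltnW m_gt1.
rewrite leqNgt; apply/negP => lt.
pose a (t : 'I_(N * N)) (x : 'I_(\rank Dmx) + cond_index) : K :=
  match x with inl i => col_base Dmx t i | inr s => cond s (delta_mx 0 t) end.
have [|w [[t wt] hw]] := @lindep K _ _ a.
  by rewrite card_sum card_cond_index !card_ord -[X in (_ < X)%N](card_free_entries K m0) ltn_add2r.
case/eqP: wt; pose v := \row_t w t.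
have vD : v *m Dmx = 0.
  rewrite -(mulmx_base Dmx) mulmxA (_ : v *m _ = 0) ?mul0mx //.
  apply/rowP => i; rewrite mxE [RHS]mxE -[RHS](hw (inl i)).
  by apply: eq_bigr => s _; rewrite mxE.
have vC x : cond x v = 0.
  by rewrite cond_sum -[RHS](hw (inr x)); apply: eq_bigr => s _; rewrite mxE.
have T0 : tangent (vec_mx v) PL = 0.
  apply/mpolyP => e; rewrite mcoeff0.
  have [le|gt] := ltnP (mdeg e) n.+1.
    have := DmxE v (enum_rank (BMultinom le)); rewrite vD mxE /coefs enum_rankK => <-//.
  apply: contraTeq gt; rewrite -mcoeff_msupp => /(dhomogP _ _ _ (tangent_homog _ (PLambda_homog K m))) ->.
  by rewrite ltnn.
pose u0 := vact (vec_mx v).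
pose u : {linear 'M[K]_n -> 'M[K]_n} := HB.pack u0 (GRing.isLinear.Build _ _ _ _ u0 (vact_linear _)).
have u_triv := @annihilator_trivial _ _ _ hJ em m_gt1 u (PLambda_tangent_annihilates T0).
have v0 X : vact (vec_mx v) X = 0.
  apply: (u_triv).
  - move=> i j ij; have neq : inl (i, j) != inl (ord0, ord0) :> 'I_n * 'I_n + 'I_n * 'I_n.
      by apply: contra ij => /eqP[-> ->].
    have := vC (exist (fun x => is_true (x != inl (ord0, ord0))) _ neq); rewrite /cond /= (negPf ij).
    by rewrite [vact _ 0](linear0 u) [X in _ + X]mxE addr0.
  - move=> j j0; have neq : inl (j, j) != inl (ord0, ord0) :> 'I_n * 'I_n + 'I_n * 'I_n.
      by apply: contra j0 => /eqP[-> _].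
    by have := vC (exist (fun x => is_true (x != inl (ord0, ord0))) _ neq); rewrite /cond /= eqxx.
  - move=> k l; have neq : inr (k, l) != inl (ord0, ord0) :> 'I_n * 'I_n + 'I_n * 'I_n by [].
    exact: (vC (exist (fun x => is_true (x != inl (ord0, ord0))) _ neq)).
have V0 : vec_mx v = 0 :> 'M[K]_N.
  apply/row_matrixP => i; rewrite row0 rowE; apply: (can_inj vec_mxK).
  by have := v0 (vec_mx (delta_mx 0 i)); rewrite /vact vec_mxK linear0.
have : v = 0 by rewrite -[v]vec_mxK V0 linear0.
by move/rowP/(_ t); rewrite !mxE.
Qed.

(** The [F i] are linear forms that read coordinates on the tangent space in the basis
    [row_base Dmx]. For each w, some curve (1 + t G) P_Lambda has these coordinates as its velocity;
    it stays in the orbit for almost all t, so [tangent_independent] applies. *)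
Lemma PLambda_closure_independent : exists k (F : 'I_k -> {mpoly K[c]}),
  (#|{: free_entries m}| <= k)%N /\
  forall H : {mpoly K[k]}, (forall p, GL_closure PL p -> H.@[fun i => (F i).[% p]] = 0) -> H = 0.
Proof.
pose k := \rank Dmx; have /submxP[B BE] : (row_base Dmx <= Dmx)%MS by rewrite eq_row_base.
have /row_freeP[R RE] := row_base_free Dmx.
pose F (i : 'I_k) : {mpoly K[c]} := \sum_j R j i *: 'X_j.
have FE p i : (F i).[% p] = \sum_j R j i * co p j.
  by rewrite raddf_sum /=; apply: eq_bigr => j _; rewrite mevalZ mevalXU.
exists k, F; split; first exact: tangent_rank.
move=> H HZ; apply: (tangent_independent (a := fun i => (F i).[% PL])) => w.
pose v : 'rV[K]_(N * N) := (\row_i w i) *m B; pose G : 'M[K]_N := vec_mx v.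
have [T TE] := actm_taylor G PL.
pose s i : {poly K} := \sum_(e < size T) ((F i).[% T`_e])%:P * 'X^e.
have sE i t : (s i).[t] = (F i).[% T.[t%:MP]].
  rewrite FE horner_sum; under [RHS]eq_bigr => j _.
    rewrite horner_coef /coefs raddf_sum /= mulr_sumr.
    under eq_bigr => e _ do rewrite -(rmorphXn (@mpolyC N K)) /= [_ * _%:MP_[_] ]mulrC mul_mpolyC mcoeffZ mulrCA.
    over.
  rewrite exchange_big; apply: eq_bigr => e _ /=.
  by rewrite hornerM hornerC hornerXn FE mulr_suml; apply: eq_bigr => j _; rewrite mulrC.
have wE i : (F i).[% tangent G PL] = w i.
  have -> : w i = ((\row_i w i) *m (row_base Dmx *m R)) 0 i by rewrite RE mulmx1 mxE.
  rewrite BE !mulmxA -/v FE mxE; apply: eq_bigr => j _; by rewrite DmxE mulrC.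
exists (fun i => (w i)%:P + 'X * s i); split=> [i|t]; first by rewrite hornerD hornerC hornerM hornerX mul0r addr0.
have gE i t' : (F i).[% PL] + t' * ((w i)%:P + 'X * s i).[t'] = (F i).[% actm (1%:M + t' *: G) PL].
  rewrite TE !hornerE sE -wE !FE mulrDr mulrA -expr2 !mulr_sumr -!big_split /=.
  by apply: eq_bigr => j _; rewrite /coefs !mcoeffD !mcoeffZ; ring.
pose q := mmap polyC (fun i => ((F i).[% PL])%:P + 'X * ((w i)%:P + 'X * s i)) H.
have qE t' : q.[t'] = H.@[fun i => (F i).[% PL] + t' * ((w i)%:P + 'X * s i).[t']].
  by rewrite horner_mmap; apply: meval_eq => i; rewrite [LHS]hornerD [in LHS]hornerC [in LHS]hornerM [in LHS]hornerX.
have n0 : (0 < n)%N by [].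
have P0 := PLambda_neq0 K em; have Ph := PLambda_homog K m.
suff q0 : q = 0 by rewrite -qE q0 horner0.
(* The curve lies in the orbit where det(1 + t G) is nonzero, which includes t = 0. *)
apply: (line_density (k := \det (lin_mx_poly 1%:M G))) => [|t'].
  by exists 0; rewrite -[X in X != 0]/(horner_eval 0 _) -det_map_mx lin_mx_poly_horner scale0r addr0 det1 oner_eq0.
rewrite -[X in X != 0]/(horner_eval t' _) -det_map_mx lin_mx_poly_horner => d0.
rewrite qE (meval_eq _ (fun i => gE i t')); apply: HZ; apply: zclosure_sub.
by apply/(GL_orbitP n0 P0 Ph); exists (1%:M + t' *: G); rewrite // unitmxE unitfE.
Qed.

End TangentSpace.

(** * The boundary component *)

Section Boundary.
Variables (K : numClosedFieldType) (m : nat).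
Local Notation n := m.+1.
Local Notation N := (n * n)%N.
Local Notation dF := (det_form K n).
Local Notation PL := (PLambda K n).
Local Notation X := (GL_closure dF).
Local Notation Z := (GL_closure PL).
Hypotheses (em : ~~ odd m) (m_gt1 : (1 < m)%N).

Let n_gt0 : (0 < n)%N. Proof. by []. Qed.
Let dF_neq0 : dF != 0. Proof. exact: det_form_neq0. Qed.
Let dF_homog : dF \is n.-homog. Proof. exact: det_form_homog. Qed.
Let PL_neq0 : PL != 0. Proof. exact: PLambda_neq0. Qed.
Let PL_homog : PL \is n.-homog. Proof. exact: PLambda_homog. Qed.

Lemma PLambda_not_GL_orbit : ~ GL_orbit dF PL.
Proof. by move=> [u _ h]; apply: (PLambda_not_End em m_gt1); exists u. Qed.

Lemma PLambda_closure_boundary : psub Z (@det_boundary K n).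
Proof.
have XPL : X PL := PLambda_in_GL_closure em; move=> Q ZQ; split.
  exact: (GL_closure_psub n_gt0 dF_neq0 dF_homog PL_neq0 PL_homog XPL).
exact: (GL_orbit_disjoint_closure n_gt0 dF_neq0 dF_homog PL_neq0 PL_homog XPL PLambda_not_GL_orbit).
Qed.

Lemma no_chain_in_det_closure C1 C2 : zclosed n C1 -> irreducible n C1 -> zclosed n C2 -> irreducible n C2 ->
  psub Z C1 -> ~ psub C1 Z -> psub C1 C2 -> ~ psub C2 C1 -> ~ psub C2 X.
Proof.
have [k [F [le_k indep]]] := PLambda_closure_independent K em m_gt1.
have dep H := @det_closure_dependent K m k.+2 H (ltnW m_gt1) le_k.
apply: (no_long_chain indep dep); exact: GL_closure_closed.
Qed.

Lemma det_closure_not_boundary : ~ psub X (@det_boundary K n).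
Proof.
by move=> h; have [_] := h dF (zclosure_sub (GL_orbit_refl n_gt0 dF_neq0 dF_homog)); apply; apply: GL_orbit_refl.
Qed.

(** [Z'] need not be closed, so the chain is formed with its closure. *)
Lemma PLambda_component : irreducible_component n Z (@det_boundary K n).
Proof.
split; [exact: GL_closure_irreducible|exact: PLambda_closure_boundary|].
move=> Z' iZ' ZZ' Z'B; apply: contrapT => nZ'Z.
have Z'X : psub Z' X by move=> p /Z'B[].
have Z'p : psub Z' (proj_point n).
  by move=> p /Z'X; apply: zclosed_proj; apply: GL_closure_closed.
have [f [fe [Q oQ fQ] fopen]] := GL_closure_open n_gt0 dF_neq0 dF_homog.
(* Points of X where f is nonzero lie in the orbit of det_n, so f vanishes on the boundary; this
   keeps the closure of [Z'] different from X. *)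
have Z'f : psub Z' (fun p => proj_point n p /\ forall g, g = f -> g.@[coefs p] = 0).
  move=> p /[dup] Z'p' /Z'B[Xp np]; split=> [|_ ->]; first exact: Z'p.
  by apply: contrapT => /eqP /(fopen p Xp).
apply: (@no_chain_in_det_closure (zclosure n Z') X).
- exact: zclosed_zclosure.
- exact: irreducible_zclosure.
- exact: GL_closure_closed.
- exact: GL_closure_irreducible.
- by move=> p /ZZ'; apply: zclosure_sub.
- by move=> h; apply: nZ'Z => p /zclosure_sub/h.
- by apply: zclosure_min Z'X; apply: GL_closure_closed.
- move=> h; have [|_ /(_ f erefl) f0] := zclosure_min _ Z'f (h Q (zclosure_sub oQ)).
    by apply: zclosed_zeros => _ ->.
  by rewrite f0 eqxx in fQ.
- by [].
Qed.

Lemma PLambda_codim1 : has_codim n Z X 1.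
Proof.
have ZX : psub Z X by move=> p /PLambda_closure_boundary[].
split.
  exists (fun i => if i is 0%N then Z else X); split=> [//|[|i] _|[|i]//= _]; split=> //.
  - exact: GL_closure_closed.
  - exact: GL_closure_irreducible.
  - exact: GL_closure_closed.
  - exact: GL_closure_irreducible.
  - by move=> h; apply: det_closure_not_boundary => p /h; apply: PLambda_closure_boundary.
move=> j [C [C0 hC lC]]; rewrite leqNgt; apply/negP => j2.
have [cC1 iC1 _] := hC 1%N (ltnW j2); have [cC2 iC2 C2X] := hC 2%N j2.
have [C01 nC10] := lC 0%N (ltnW j2); have [C12 nC21] := lC 1%N j2.
apply: (no_chain_in_det_closure cC1 iC1 cC2 iC2 _ _ C12 nC21 C2X).
- by move=> p /C0/C01.
- by move=> h; apply: nC10 => p /h/C0.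
Qed.

Lemma PLambda_closure_not_End : ~ psub Z (End_orbit dF).
Proof.
move=> h; apply: (PLambda_not_End em m_gt1); apply: h; apply: zclosure_sub.
exact: GL_orbit_refl.
Qed.

End Boundary.

(** * The two determinantal complexities of P_Lambda *)

Section Complexity.
Variables (K : numClosedFieldType) (m : nat).
Local Notation n := m.+1.
Local Notation dF := (det_form K n).
Local Notation PL := (PLambda K n).
Hypothesis em : ~~ odd m.

Lemma padding_self n' (P : {mpoly K[n' * n']}) : padding n' P P.
Proof.
exists 0, (fun i => delta_mx 0 i); rewrite eqxx; split; first exact: (free_delta K (f := id)).
rewrite subnn expr0 mul1r -[LHS]comp_mpoly_id; congr (_ \mPo _).
by apply: eq_from_tnth => i; rewrite !tnth_mktuple linform_delta.
Qed.

Lemma padding_same_size n' (P Q : {mpoly K[n' * n']}) : padding n' P Q ->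
  exists2 G, G \in unitmx & Q = actm G P.
Proof.
move=> [l [y []]]; rewrite eqxx subnn expr0 mul1r => fy ->.
pose Y := \matrix_k y k; have yE k : y k = row k Y by rewrite rowK.
exists Y^T; last first.
  by congr (_ \mPo _); apply: eq_from_tnth => k; rewrite !tnth_mktuple -tr_row trmxK yE.
rewrite unitmx_tr -row_free_unit -kermx_eq0; apply/rowV0P => v /sub_kermxP vY.
have := fy; rewrite (_ : codom y = [tuple y k | k < n' * n']); last by [].
move/freeP => /(_ (v 0)) h; apply/rowP => k; rewrite [RHS]mxE; apply: h.
rewrite -[RHS]vY mulmx_sum_row; apply: eq_bigr => j _.
by rewrite -tnth_nth tnth_mktuple yE.
Qed.

Lemma PLambda_dcbar : is_dcbar n PL n.
Proof.
split=> [|j [//]]; split=> //; exists PL; [exact: padding_self|exact: PLambda_in_GL_closure].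
Qed.

(** Universality of the determinant provides some size, hence a least one. For d = n the padding is
    an invertible change of variables, and undoing it would put P_Lambda in the End orbit. *)
Lemma PLambda_dc : (1 < m)%N -> exists2 d, is_dc n PL d & (n < d)%N.
Proof.
move=> m_gt1; pose A d := (n <= d)%N /\ exists2 Q : {mpoly K[d * d]},
  padding n PL Q & exists u : 'End('M[K]_d), Q = act u (det_form K d).
have exA : exists d, `[< A d >].
  have [d [lt [Q pQ uQ]]] := determinantal_representation (PLambda_homog K m).
  by exists d; apply/asboolP; split; [exact: ltnW|exists Q].
have [d /asboolP Ad min] := ex_minnP exA; exists d; first by split=> // j /asboolP/min.
have [le [Q pQ [u e]]] := Ad; rewrite ltn_neqAle le andbT; apply/eqP => nd.
move: Q pQ u e; rewrite -nd => Q pQ u e; apply: (PLambda_not_End em m_gt1).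
have [G Gu QE] := padding_same_size pQ.
(* The endomorphism u composed with the inverse of the change of variables. *)
have [g [gE _]] := end_of_mx (invmx G *m lin_mx u).
exists g; split; last by exists 1; rewrite ?oner_eq0 // scale1r actE gE -actm_mul -actE -e QE actm_mul mulVmx // actm1.
rewrite actE gE -actm_mul -actE -e QE actm_mul mulVmx // actm1; exact: PLambda_neq0.
Qed.

End Complexity.

Theorem proposition3p5p1 (R : realType) :
  (forall n : nat, odd n ->
     GL_closure (det_form R[i] n) (PLambda R[i] n) /\
     ((1 < n)%N ->
      [/\ irreducible_component n
            (GL_closure (PLambda R[i] n)) (@det_boundary R[i] n),
          has_codim n (GL_closure (PLambda R[i] n))
            (GL_closure (det_form R[i] n)) 1
        & ~ psub (GL_closure (PLambda R[i] n)) (End_orbit (det_form R[i] n))])) /\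
  (forall m : nat, odd m ->
     is_dcbar m (PLambda R[i] m) m /\
     ((1 < m)%N -> exists2 d : nat, is_dc m (PLambda R[i] m) d & (m < d)%N)).
Proof.
(* With n = m + 1 odd, n > 1 means n >= 3; the lemmas on the annihilator and on [End_orbit] need
   three distinct indices. *)
have gt1 m : ~~ odd m -> (1 < m.+1)%N -> (1 < m)%N by case: m => [|[]].
split=> [] [//|m] /= em; split.
- exact: PLambda_in_GL_closure.
- move=> /(gt1 m em) m_gt1; split.
  + exact: PLambda_component.
  + exact: PLambda_codim1.
  + exact: PLambda_closure_not_End.
- exact: PLambda_dcbar.
- by move=> /(gt1 m em); apply: PLambda_dc.
Qed.
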